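(* Let $(P,\pi)$ be a regular Poisson manifold whose symplectic foliation $\mathcal F$ is transversally oriented of codimension $1$. The following assertions are equivalent: 1) The modular class of $P$ vanishes, i.e. $mod(P)=0$ in $H^1_\pi(P)$. 2) The symplectic foliation $\mathcal F$ is a Riemannian foliation.
   Context: A Poisson manifold $(P,\pi)$ is a smooth manifold with a Poisson bivector $\pi$; the bundle map $\pi:T^*P\to TP$ is defined by $\beta(\pi(\alpha))=\pi(\alpha,\beta)$. It is regular if this bundle map has constant rank; its symplectic foliation $\mathcal F$ is then the regular foliation with tangent bundle $T\mathcal F=\pi(T^*P)$. $\mathcal F$, of codimension $q$, is transversally oriented if there is a nowhere vanishing $q$-form $\nu$ on $P$ with $i_X\nu=0$ for all $X$ tangent to $\mathcal F$ (this makes $P$ orientable, since the leaves are symplectic). A foliation is Riemannian if there exists a bundle-like Riemannian metric $g$ on the manifold, i.e. one with $(L_Xg)(Y,Z)=0$ for every vector field $X$ tangent to $\mathcal F$ and all vector fields $Y,Z$ orthogonal to $\mathcal F$. Modular class: $H^1_\pi(P)$ denotes the first Poisson cohomology space, i.e. vector fields $\xi$ with $L_\xi\pi=0$ modulo Hamiltonian vector fields $\pi(df)$, $f\in C^\infty(P)$. For a volume form $\mu$ on $P$, the map $f\mapsto \mathrm{div}_\mu\,\pi(df)$, where $L_X\mu=(\mathrm{div}_\mu X)\mu$, is a derivation of $C^\infty(P)$, i.e. a vector field $\phi_\mu$ (the modular vector field). It satisfies $L_{\phi_\mu}\pi=0$ and its class in $H^1_\pi(P)$ does not depend on $\mu$;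 this class is the modular class $mod(P)$. *)

(* Defs.v *)
From HB Require Import structures.
From mathcomp Require Import all_boot all_order all_algebra.
From mathcomp Require Import boolp classical_sets functions reals.
From mathcomp Require Import interval_inference topology.
From mathcomp Require Import normedtype landau derive.
From mathcomp Require Import ring.

Set Implicit Arguments.
Unset Strict Implicit.
Unset Printing Implicit Defensive.

Import Order.TTheory GRing.Theory Num.Theory.
Import numFieldNormedType.Exports.

Local Open Scope classical_set_scope.
Local Open Scope ring_scope.

Section Ck.
Context {R : realType} {V W : normedModType R}.

Fixpoint Ck (k : nat) (U : set V) (f : V -> W) : Prop :=
  match k with
  | 0 => forall x, U x -> {for x, continuous f}
  | k'.+1 => (forall x, U x -> differentiable f x) /\
             (forall v, Ck k' U (fun x => 'D_v f x))
  end.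

Definition smooth_on (U : set V) (f : V -> W) : Prop := forall k, Ck k U f.

Lemma near_eq_differentiable (f g : V -> W) (x : V) :
  (\near x, f x = g x) -> differentiable f x -> differentiable g x.
Proof.
move=> fg df.
have e : g \o shift x = cst (g x) + 'd f x +o_ 0 id.
  apply/eqaddoP => _/posnumP[eps].
  have /eqaddoP/(_ eps%:num (gt0 _)) := diff_locally df.
  have fg0 : \forall h \near 0, f (h + x) = g (h + x).
    by move: fg; rewrite (near_shift 0 x) => fg; near do rewrite -(subr0 x).
  rewrite -(nbhs_singleton fg); apply: filterS2 fg0 => h /= fgh.
  by rewrite !fctE /= fgh.
have dc := diff_continuous df.
apply/diff_locallyP; rewrite (diff_unique dc e); split => //.
Unshelve. all: by end_near. Qed.

Lemma Ck_eq k (U : set V) (f g : V -> W) : open U ->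
  (forall x, U x -> f x = g x) -> Ck k U f -> Ck k U g.
Proof.
move=> oU; elim: k f g => [|k IH] f g fg /=; last first.
  have fgx x (Ux : U x) : \near x, f x = g x.
    by apply: filterS (open_nbhs_nbhs (conj oU Ux)) => y; exact: fg.
  move=> [df Df]; split=> [x Ux|v].
    exact: near_eq_differentiable (fgx x Ux) (df x Ux).
  by apply: IH (Df v) => x /fgx; exact: near_eq_derive.
move=> cf x Ux; rewrite /prop_for /continuous_at -(fg _ Ux).
apply: cvg_trans (cf x Ux); apply: near_eq_cvg.
by apply: filterS (open_nbhs_nbhs (conj oU Ux)) => y /fg.
Qed.

Lemma CkS k (U : set V) (f : V -> W) : Ck k.+1 U f -> Ck k U f.
Proof.
elim: k f => [|k IH] f [df Df]; last by split=> // v; exact: IH (Df v).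
by move=> x /df; exact: differentiable_continuous.
Qed.

Lemma Ck_cst k (U : set V) (a : W) : Ck k U (cst a).
Proof.
elim: k a => [|k IH] a /=; first by move=> x _; exact: cst_continuous.
split=> // v; rewrite (_ : (fun x => _) = cst 0) //.
by apply/funext => x; rewrite derive_cst.
Qed.

Lemma CkD k (U : set V) (f g : V -> W) : open U ->
  Ck k U f -> Ck k U g -> Ck k U (f + g).
Proof.
move=> oU; elim: k f g => [|k IH] f g.
  by move=> cf cg x Ux; apply: continuousD; [exact: cf|exact: cg].
move=> [df Df] [dg Dg]; split=> [x Ux|v].
  by apply: differentiableD; [exact: df|exact: dg].
apply: Ck_eq oU _ (IH _ _ (Df v) (Dg v)) => x Ux.
by rewrite deriveD //; apply: diff_derivable; [exact: df|exact: dg].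
Qed.

End Ck.

Lemma CkM (R : realType) (V : normedModType R) k (U : set V) (f g : V -> R^o) :
  open U -> Ck k U f -> Ck k U g -> Ck k U (f * g).
Proof.
move=> oU; elim: k f g => [|k IH] f g.
  by move=> cf cg x Ux; apply: continuousM; [exact: cf|exact: cg].
move=> Cf Cg; have [[df Df] [dg Dg]] := (Cf, Cg); split=> [x Ux|v].
  by apply: differentiableM; [exact: df|exact: dg].
have C := CkD oU (IH _ _ (CkS Cf) (Dg v)) (IH _ _ (CkS Cg) (Df v)).
apply: Ck_eq oU _ C => x Ux.
by rewrite deriveM //; apply: diff_derivable; [exact: df|exact: dg].
Qed.

(* Only the values of [cmap] on [cdom] and of [cinv] on the image of [cdom]
   are meaningful. *)
Record chart (R : realType) (n : nat) (M : topologicalType) := Chart {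
  cdom : set M;
  cmap : M -> 'rV[R]_n;
  cinv : 'rV[R]_n -> M;
  cdom_open : open cdom;
  cimg_open : open (cmap @` cdom);
  cmapK : forall p, cdom p -> cinv (cmap p) = p;
  cmap_cont : forall p, cdom p -> {for p, continuous cmap};
  cinv_cont : forall x, (cmap @` cdom) x -> {for x, continuous cinv}
}.

(* The atlas is not required to be maximal. *)
Record manifold (R : realType) (n : nat) := Manifold {
  carrier :> topologicalType;
  atlas : set (chart R n carrier);
  manifold_hausdorff : hausdorff_space carrier;
  manifold_second_countable : @second_countable carrier;
  atlas_cover : forall p, exists2 c, atlas c & cdom c p;
  atlas_compat : forall c d, atlas c -> atlas d ->
    smooth_on (cmap c @` (cdom c `&` cdom d)) (cmap d \o cinv c)
}.

Section SmoothFunctions.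
Context {R : realType} {n : nat} {M : manifold R n}.

Definition smooth (f : M -> R^o) : Prop := forall c, @atlas R n M c ->
  smooth_on (cmap c @` cdom c) (f \o cinv c).

Definition smooth_pred : {pred M -> R^o} := [pred f | `[< smooth f >]].

Lemma smooth_cst (a : R) : smooth (cst (a : R^o)).
Proof. by move=> c _ k; exact: Ck_cst. Qed.

Lemma smoothD f g : smooth f -> smooth g -> smooth (f + g).
Proof.
move=> sf sg c ac k.
by apply: CkD; [exact: cimg_open|exact: sf|exact: sg].
Qed.

Lemma smoothM f g : smooth f -> smooth g -> smooth (f * g).
Proof.
move=> sf sg c ac k.
by apply: CkM; [exact: cimg_open|exact: sf|exact: sg].
Qed.

Lemma smoothZ (a : R) f : smooth f -> smooth (a *: f).
Proof. by move=> sf; apply: (smoothM (smooth_cst a)). Qed.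

Fact smooth_subring : subring_closed smooth_pred.
Proof.
split; first by apply/asboolP; exact: smooth_cst.
  move=> f g /asboolP sf /asboolP sg; apply/asboolP.
  by rewrite -scaleN1r; apply: smoothD => //; exact: smoothZ.
by move=> f g /asboolP sf /asboolP sg; apply/asboolP; exact: smoothM.
Qed.

Fact smooth_scaler : GRing.scaler_closed smooth_pred.
Proof. by move=> a f /asboolP sf; apply/asboolP; exact: smoothZ. Qed.

HB.instance Definition _ :=
  GRing.isSubringClosed.Build (M -> R^o) smooth_pred smooth_subring.
HB.instance Definition _ :=
  GRing.isScaleClosed.Build R (M -> R^o) smooth_pred smooth_scaler.

End SmoothFunctions.

Section SmoothAlgebra.
Context {R : realType} {n : nat} (M : manifold R n).

Record Cinf := MkCinf {
  Cinf_fun :> M -> R^o;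
  Cinf_subproof : Cinf_fun \in smooth_pred
}.

HB.instance Definition _ := [isSub for Cinf_fun].
HB.instance Definition _ := [Choice of Cinf by <:].
HB.instance Definition _ :=
  GRing.SubChoice_isSubComPzRing.Build _ _ Cinf (subringClosedP _).
HB.instance Definition _ := [SubZmodule_isSubLmodule of Cinf by <:].

End SmoothAlgebra.

Section TangentSpaces.
Context {R : realType} {n : nat} {M : manifold R n}.
Implicit Types p : M.

Definition is_derivation_at p (v : Cinf M -> R^o) : Prop :=
  linear v /\ forall f g : Cinf M, v (f * g) = f p * v g + g p * v f.

Definition derivation_pred p : {pred Cinf M -> R^o} :=
  [pred v | `[< is_derivation_at p v >]].

Fact derivation_closed p : subsemimod_closed (derivation_pred p).
Proof.
split; first split; first 1 last.
- move=> u v /asboolP[lu Lu] /asboolP[lv Lv]; apply/asboolP; split.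
    by move=> a f g; rewrite !fctE lu lv scalerDr addrACA.
  by move=> f g; rewrite !fctE Lu Lv !mulrDr addrACA.
- move=> a u /asboolP[lu Lu]; apply/asboolP; split.
    by move=> b f g; rewrite !fctE lu scalerDr !scalerA mulrC.
  by move=> f g; rewrite !fctE Lu scalerDr !scalerAr.
- rewrite (_ : 0 = cst 0) //; apply/asboolP.
  by split=> [a f g|f g]; rewrite !fctE ?scaler0 ?mulr0 addr0.
Qed.

HB.instance Definition _ p := GRing.isSubmodClosed.Build R (Cinf M -> R^o)
  (derivation_pred p) (derivation_closed p).

End TangentSpaces.

Record tangent (R : realType) (n : nat) (M : manifold R n) (p : M) :=
  MkTangent {
    tangent_fun :> Cinf M -> R^o;
    tangent_subproof : tangent_fun \in derivation_pred p
  }.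

HB.instance Definition _ (R : realType) (n : nat) (M : manifold R n) (p : M) :=
  [isSub for @tangent_fun R n M p].
HB.instance Definition _ (R : realType) (n : nat) (M : manifold R n) (p : M) :=
  [Choice of tangent p by <:].
HB.instance Definition _ (R : realType) (n : nat) (M : manifold R n) (p : M) :=
  [SubChoice_isSubLmodule of tangent p by <:].

Section CotangentSpaces.
Context {R : realType} {n : nat} {M : manifold R n}.
Implicit Types p : M.

Definition covector_pred p : {pred tangent p -> R^o} :=
  [pred a : tangent p -> R^o | `[< linear a >]].

Fact covector_closed p : subsemimod_closed (@covector_pred p).
Proof.
split; first split; first 1 last.
- move=> u v /asboolP lu /asboolP lv; apply/asboolP => a f g.
  by rewrite !fctE lu lv scalerDr addrACA.
- move=> a u /asboolP lu; apply/asboolP => b f g.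
  by rewrite !fctE lu scalerDr !scalerA mulrC.
- rewrite (_ : 0 = cst 0) //; apply/asboolP => a f g.
  by rewrite !fctE scaler0 addr0.
Qed.

HB.instance Definition _ p := GRing.isSubmodClosed.Build R (tangent p -> R^o)
  (@covector_pred p) (@covector_closed p).

End CotangentSpaces.

Record cotangent (R : realType) (n : nat) (M : manifold R n) (p : M) :=
  MkCotangent {
    cotangent_fun :> tangent p -> R^o;
    cotangent_subproof : cotangent_fun \in @covector_pred R n M p
  }.

HB.instance Definition _ (R : realType) (n : nat) (M : manifold R n) (p : M) :=
  [isSub for @cotangent_fun R n M p].
HB.instance Definition _ (R : realType) (n : nat) (M : manifold R n) (p : M) :=
  [Choice of cotangent p by <:].
HB.instance Definition _ (R : realType) (n : nat) (M : manifold R n) (p : M) :=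
  [SubChoice_isSubLmodule of cotangent p by <:].

Section Fields.
Context {R : realType} {n : nat}.
Implicit Types M : manifold R n.

Definition mkCinf M (f : M -> R^o) (sf : smooth f) : Cinf M :=
  MkCinf (asboolT sf).

Record vfield M := MkVfield {
  vf_val :> forall p : M, tangent p;
  vf_smooth : forall f : Cinf M, smooth (fun p => vf_val p f)
}.

Definition vf_app M (X : vfield M) (f : Cinf M) : Cinf M :=
  mkCinf (vf_smooth X f).

Record oneform M := MkOneform {
  of_val :> forall p : M, cotangent p;
  of_smooth : forall X : vfield M, smooth (fun p => of_val p (X p))
}.

Lemma tangentP M (p : M) (v : tangent p) : is_derivation_at p v.
Proof. by case: v => v /= /asboolP. Qed.

Lemma tangent_linear M (p : M) (v : tangent p) : linear v.
Proof. by case: (tangentP v). Qed.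

Lemma tangentM M (p : M) (v : tangent p) (f g : Cinf M) :
  v (f * g) = f p * v g + g p * v f.
Proof. by case: (tangentP v). Qed.

Lemma cotangent_linear M (p : M) (a : cotangent p) : linear a.
Proof. by case: a => a /= /asboolP. Qed.

Lemma smoothB M (f g : M -> R^o) : smooth f -> smooth g -> smooth (f - g).
Proof.
by move=> sf sg; rewrite -scaleN1r; apply: smoothD => //; exact: smoothZ.
Qed.

Fact vzero_smooth M (f : Cinf M) : smooth (fun p : M => (0 : tangent p) f).
Proof. exact: smooth_cst. Qed.

Definition vzero M : vfield M := MkVfield (@vzero_smooth M).

Section LieBracket.
Context {M : manifold R n}.
Implicit Types X Y : vfield M.

Lemma vf_appE X (f : Cinf M) (p : M) : vf_app X f p = X p f.
Proof. by []. Qed.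

Lemma vf_app_linear X : linear (vf_app X).
Proof. by move=> a f g; apply/val_inj/funext => p; exact: tangent_linear. Qed.

Lemma vf_appM X (f g : Cinf M) :
  vf_app X (f * g) = f * vf_app X g + g * vf_app X f.
Proof. by apply/val_inj/funext => p; exact: tangentM. Qed.

Fact lie_subproof X Y (p : M) :
  (fun f => X p (vf_app Y f) - Y p (vf_app X f) : R^o) \in derivation_pred p.
Proof.
apply/asboolP; split=> [a f g|f g].
  by rewrite !vf_app_linear !tangent_linear scalerBr opprD addrACA.
have XD (Z : vfield M) (u v : Cinf M) : Z p (u + v) = Z p u + Z p v :> R^o.
  by have := tangent_linear (Z p) 1 u v; rewrite !scale1r.
rewrite !vf_appM !XD !tangentM !vf_appE; ring.
Qed.

Fact lie_smooth X Y (f : Cinf M) :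
  smooth (fun p => MkTangent (lie_subproof X Y p) f).
Proof. by apply: smoothB; exact: vf_smooth. Qed.

Definition lie X Y : vfield M := MkVfield (lie_smooth X Y).

End LieBracket.

Section Differential.
Context {M : manifold R n}.

Fact differential_subproof (f : Cinf M) (p : M) :
  (fun v : tangent p => v f) \in @covector_pred R n M p.
Proof. by apply/asboolP. Qed.

Fact differential_smooth (f : Cinf M) (X : vfield M) :
  smooth (fun p => MkCotangent (differential_subproof f p) (X p)).
Proof. exact: vf_smooth. Qed.

Definition differential (f : Cinf M) : oneform M :=
  MkOneform (differential_smooth f).

Lemma differential_linear (p : M) (a : R) (f g : Cinf M) :
  differential (a *: f + g) p = a *: differential f p + differential g p.
Proof. by apply/val_inj/funext => v; exact: tangent_linear. Qed.

Lemma differentialM (p : M) (f g : Cinf M) :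
  differential (f * g) p = f p *: differential g p + g p *: differential f p.
Proof. by apply/val_inj/funext => v; exact: tangentM. Qed.

End Differential.

Record kform M (k : nat) := MkKform {
  kf_val :> forall p : M, ('I_k -> tangent p) -> R^o;
  kf_linear : forall (p : M) (v : 'I_k -> tangent p) (i : 'I_k),
    linear (fun x => @kf_val p [eta v with i |-> x]);
  kf_alternating : forall (p : M) (v : 'I_k -> tangent p) (i j : 'I_k),
    i != j -> v i = v j -> @kf_val p v = 0;
  kf_smooth : forall X : 'I_k -> vfield M,
    smooth (fun p => @kf_val p (fun i => X i p))
}.

Definition kf_app M k (w : kform M k) (X : 'I_k -> vfield M) : Cinf M :=
  mkCinf (kf_smooth w X).

Definition nowhere_vanishing M k (w : kform M k) : Prop :=
  forall p, exists v, w p v != 0.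

(* (L_X w)(Y_1, ..., Y_k) at the point p *)
Definition lie_kform M k (X : vfield M) (w : kform M k)
    (Y : 'I_k -> vfield M) (p : M) : R :=
  X p (kf_app w Y) -
  \sum_(i < k) w p (fun j => [eta Y with i |-> lie X (Y i)] j p).

Definition volume_form M (mu : kform M n) : Prop := nowhere_vanishing mu.

Definition is_divergence M (mu : kform M n) (X : vfield M) (h : M -> R) :=
  forall (Y : 'I_n -> vfield M) (p : M),
    lie_kform X mu Y p = h p * mu p (fun i => Y i p).

Record metric M := MkMetric {
  metric_val :> forall p : M, tangent p -> tangent p -> R^o;
  metric_linear : forall (p : M) (v : tangent p),
    linear (fun u => @metric_val p u v);
  metric_sym : forall (p : M) (u v : tangent p),
    @metric_val p u v = @metric_val p v u;
  metric_pos : forall (p : M) (v : tangent p), v != 0 -> 0 < @metric_val p v v;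
  metric_smooth : forall X Y : vfield M,
    smooth (fun p => @metric_val p (X p) (Y p))
}.

Definition metric_app M (g : metric M) (X Y : vfield M) : Cinf M :=
  mkCinf (metric_smooth g X Y).

(* (L_X g)(Y, Z) at the point p *)
Definition lie_metric M (X : vfield M) (g : metric M) (Y Z : vfield M) (p : M)
    : R :=
  X p (metric_app g Y Z) - g p (lie X Y p) (Z p) - g p (Y p) (lie X Z p).

End Fields.

Arguments kf_val {R n M k} _ p _.
Arguments metric_val {R n M} _ p _ _.

Section Foliations.
Context {R : realType} {n : nat} {M : manifold R n}.

(* A foliation is represented by its tangent bundle. *)
Definition distribution := forall p : M, set (tangent p).

Definition has_dim (V : lmodType R) (A : set V) (r : nat) : Prop :=
  exists e : 'I_r -> V,
    A = [set v | exists c : 'I_r -> R, v = \sum_i c i *: e i] /\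
    forall c : 'I_r -> R, \sum_i c i *: e i = 0 -> forall i, c i = 0.

Definition constant_rank (D : distribution) : Prop :=
  exists r, forall p, has_dim (D p) r.

Definition has_codim (D : distribution) (q : nat) : Prop :=
  forall p, exists2 r, has_dim (D p) r & (r + q)%N = n.

Definition tangent_to (D : distribution) (X : vfield M) : Prop :=
  forall p, D p (X p).

(* Contracting X into an arbitrary slot changes i_X nu only by a sign. *)
Definition transversally_oriented (D : distribution) (q : nat) : Prop :=
  exists nu : kform M q, nowhere_vanishing nu /\
    forall X, tangent_to D X ->
    forall (p : M) (v : 'I_q -> tangent p) (i : 'I_q),
      nu p [eta v with i |-> X p] = 0.

Definition orthogonal_to (g : metric M) (D : distribution) (Y : vfield M) :=
  forall p v, D p v -> g p (Y p) v = 0.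

Definition bundle_like (D : distribution) (g : metric M) : Prop :=
  forall X Y Z, tangent_to D X -> orthogonal_to g D Y ->
    orthogonal_to g D Z -> forall p, lie_metric X g Y Z p = 0.

Definition riemannian_foliation (D : distribution) : Prop :=
  exists g : metric M, bundle_like D g.

End Foliations.

Section Poisson.
Context {R : realType} {n : nat}.
Implicit Types M : manifold R n.

Record bivector M := MkBivector {
  bv_val :> forall p : M, cotangent p -> cotangent p -> R^o;
  bv_linearl : forall (p : M) (b : cotangent p), linear (@bv_val p ^~ b);
  bv_linearr : forall (p : M) (a : cotangent p), linear (@bv_val p a);
  bv_alternating : forall (p : M) (a : cotangent p), @bv_val p a a = 0;
  bv_smooth : forall a b : oneform M, smooth (fun p => @bv_val p (a p) (b p))
}.

Definition bracket M (pi : bivector M) (f g : Cinf M) : Cinf M :=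
  mkCinf (bv_smooth pi (differential f) (differential g)).

(* The Jacobi identity of the bracket is the vanishing of the Schouten bracket
   [pi, pi], evaluated on exact 1-forms. *)
Record poisson M := MkPoisson {
  poisson_bivector :> bivector M;
  poisson_jacobi : forall f g h : Cinf M,
    let br := bracket poisson_bivector in
    br f (br g h) + br g (br h f) + br h (br f g) = 0
}.

Fact sharp_subproof M (pi : bivector M) (p : M) (a : cotangent p) :
  (fun g : Cinf M => pi p a (differential g p)) \in derivation_pred p.
Proof.
apply/asboolP; split=> [c f g|f g].
  by rewrite differential_linear bv_linearr.
have pi0 : pi p a 0 = 0 by have := bv_linearr pi a (-1) 0 0;
  rewrite scaler0 addr0 scaleN1r addNr.
have piZ := bv_linearr pi a (g p) (differential f p) 0.
by rewrite differentialM bv_linearr -[_ *: differential f p]addr0 piZ pi0 addr0.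
Qed.

(* The bundle map T*M -> TM, determined by b (pi a) = pi (a, b): it suffices to
   take b = dg, and dg (v) = v g. *)
Definition sharp M (pi : bivector M) (p : M) (a : cotangent p) : tangent p :=
  MkTangent (sharp_subproof pi a).

Fact hamiltonian_smooth M (pi : bivector M) (f g : Cinf M) :
  smooth (fun p => sharp pi (differential f p) g).
Proof. exact: bv_smooth. Qed.

Definition hamiltonian M (pi : bivector M) (f : Cinf M) : vfield M :=
  MkVfield (hamiltonian_smooth pi f).

Definition symplectic_foliation M (pi : poisson M) : @distribution R n M :=
  fun p => range (@sharp M pi p).

Definition regular M (pi : poisson M) : Prop :=
  constant_rank (symplectic_foliation pi).

(* L_xi pi = 0, evaluated on exact 1-forms, with L_xi df = d (xi f). *)
Definition poisson_vfield M (pi : poisson M) (xi : vfield M) : Prop :=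
  forall f g : Cinf M, vf_app xi (bracket pi f g) =
    bracket pi (vf_app xi f) g + bracket pi f (vf_app xi g).

(* The class of xi in the first Poisson cohomology space, as a coset. *)
Definition H1_class M (pi : poisson M) (xi : vfield M) : set (vfield M) :=
  [set eta | poisson_vfield pi eta /\
    exists f, forall p, eta p = xi p + hamiltonian pi f p].

Definition H1_zero M (pi : poisson M) : set (vfield M) :=
  H1_class pi (vzero M).

Definition modular_vfield M (pi : poisson M) (mu : kform M n)
    (phi : vfield M) : Prop :=
  forall f, is_divergence mu (hamiltonian pi f) (vf_app phi f).

(* All volume forms give the same class, so the union over them is mod(P). *)
Definition modular_class M (pi : poisson M) : set (vfield M) :=
  [set xi | exists mu : kform M n, exists phi : vfield M,
    [/\ volume_form mu, modular_vfield pi mu phi & H1_class pi phi xi]].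

End Poisson.

Arguments bv_val {R n M} _ p _ _.

(* Main.v *)
(** Fix a nowhere vanishing 1-form nu with kernel the tangent bundle of F and a
    vector field N with nu(N) = 1.  In a local frame (x, E), let B be the skew
    matrix obtained by bordering ({x_i, x_j}) with the row (N x_j); it is
    invertible, and its pfaffian is the coefficient of N /\ pi^k.  For a volume
    form mu the function D = det B * mu(E)^2 does not depend on the frame.
    Invariance of pi under the hamiltonian field X_f gives
    X_f(B) = C B + B C^T, where the trace of C differs from that of the Jacobian
    matrix of X_f by nu([X_f, N]), and Jacobi's formula then yields
      div_mu X_f = X_f(log |D|) / 2 - nu([X_f, N]).

    If g is bundle-like, take N orthogonal to F: then - nu([X_f, N]) is half of
    X_f(log nu(Y)), where Y is the g-dual of nu, so that every modular field is
    hamiltonian; the quotients det(v_j x_i) / pf(B) define a volume form.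
    Conversely, if the modular class vanishes, then nu([X_f, N]) = X_f u for
    some function u, exp(u) nu is a closed form, and any metric for which the
    leaves are orthogonal to exp(-u) N, with exp(-u) N of norm 1, is
    bundle-like. *)

From HB Require Import structures.
From mathcomp Require Import all_boot all_order all_algebra all_fingroup reals.
From mathcomp Require Import boolp classical_sets functions cardinality.
From mathcomp Require Import topology normedtype landau.
From mathcomp Require Import constructive_ereal derive realfun sequences exp.
From mathcomp Require Import measure.
From mathcomp Require Import lebesgue_measure lebesgue_integral ftc.
From mathcomp Require Import ring lra.
Require Import Defs.

Set Implicit Arguments.
Unset Strict Implicit.
Unset Printing Implicit Defensive.

Import Order.TTheory GRing.Theory Num.Theory.
Import numFieldNormedType.Exports.

Local Open Scope classical_set_scope.
Local Open Scope ring_scope.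

(** * Calculus of [Ck] functions *)

(** Tangent vectors are derivations of the algebra of global functions, so every local computation
    uses globally defined coordinates and fields, cut off by bump functions and dual to each other
    only near a point. The row of N is added because pi alone is degenerate: its matrix has
    determinant 0, which carries no information when differentiated. The divergence is computed with
    the determinant of B, a polynomial in which signs do not matter. The pfaffian serves only to
    produce a volume form, which the determinant would fix only up to a sign at each point. Such a
    form is indispensable because mod(P) is encoded as a union over all volume forms, which would be
    empty without one. In the converse, the modular class gives information on hamiltonian fields
    only, whereas a bundle-like metric is tested on all fields tangent to F. The gap is closed by an
    exterior derivative, whose value at a point depends on its first argument only through the value
    of that field there. *)

Section CkCalculus.
Context {R : realType} {V : normedModType R}.
Implicit Types (W : normedModType R) (U : set V).

Lemma Ck_sub W k U U' (f : V -> W) : U `<=` U' -> Ck k U' f -> Ck k U f.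
Proof.
move=> UU'; elim: k f => [|k IH] f /=; first by move=> cf x /UU'; exact: cf.
by move=> [df Df]; split=> [x /UU'|v]; [exact: df|exact: IH].
Qed.

(** [Ck] on a set is a pointwise condition on a function defined on the whole space, so the sets
    [U'] need not be open. *)
Lemma Ck_local W k U (f : V -> W) :
  (forall x, U x -> exists2 U' : set V, U' x & Ck k U' f) -> Ck k U f.
Proof.
elim: k f => [|k IH] f /= loc.
  by move=> x /loc[U' U'x]; apply.
split=> [x /loc[U' U'x []]|v]; first by move/(_ _ U'x).
by apply: IH => x /loc[U' U'x [_ /(_ v)]]; exists U'.
Qed.

Lemma Ck0 W k U (f : V -> W) : Ck k U f -> Ck 0 U f.
Proof. by elim: k => // k IH /CkS. Qed.

Lemma Ck_opp k U (f : V -> R^o) : open U -> Ck k U f -> Ck k U (- f).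
Proof.
move=> oU Cf; rewrite -mulN1r.
by have -> : -1 = cst (-1 : R^o) :> (V -> R^o) by []; apply: CkM => //;
  exact: Ck_cst.
Qed.

Lemma Ck_sum k U (I : Type) (r : seq I) (f : I -> V -> R^o) : open U ->
  (forall i, Ck k U (f i)) -> Ck k U (fun x => \sum_(i <- r) f i x).
Proof.
move=> oU Cf; elim: r => [|i r IH].
  by apply: Ck_eq oU _ (Ck_cst k U (0 : R^o)) => x _; rewrite big_nil.
apply: Ck_eq oU _ (CkD oU (Cf i) IH) => x _; rewrite big_cons //.
Qed.

Lemma Ck_inv k U (f : V -> R^o) : open U -> (forall x, U x -> f x != 0) ->
  Ck k U f -> Ck k U (fun x => (f x)^-1 : R^o).
Proof.
move=> oU f0; elim: k => [|k IH] Cf.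
  by move=> x Ux; apply: continuousV; [exact: f0|exact: Cf].
have [df Df] := Cf; split=> [x Ux|v].
  by apply: differentiableV; [exact: df|exact: f0].
have Cv := IH (CkS Cf).
apply: Ck_eq oU _ (CkM oU (Ck_opp oU (CkM oU Cv Cv)) (Df v)) => x Ux.
rewrite deriveV ?f0//; last exact/diff_derivable/df.
by rewrite !fctE -exprVn expr2 scaleNr mulNr.
Qed.

Lemma derive_comp1 (phi : R -> R) (f : V -> R^o) (x v : V) (d : R) :
  is_derive (f x) 1 phi d -> differentiable f x ->
  differentiable (phi \o f) x /\ 'D_v (phi \o f) x = d * 'D_v f x.
Proof.
move=> dphi df.
have dp : differentiable phi (f x) by apply/derivable1_diffP; case: dphi.
split; first exact: differentiable_comp.
rewrite deriveE; last exact: differentiable_comp.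
rewrite diff_comp//= -(deriveE _ df) -[X in 'd phi _ X]mulr1.
rewrite (_ : _ * 1 = 'D_v f x *: (1 : R)) // linearZ /= -deriveE //.
by rewrite (@derive_val _ _ _ _ _ _ _ dphi) mulrC.
Qed.

Lemma Ck_expR k U (f : V -> R^o) : open U ->
  Ck k U f -> Ck k U (fun x => expR (f x) : R^o).
Proof.
move=> oU; elim: k => [|k IH] Cf.
  by move=> x Ux; apply: continuous_comp; [exact: Cf|exact: continuous_expR].
have [df Df] := Cf; split=> [x Ux|v].
  by have [] := derive_comp1 0 (is_derive_expR (f x)) (df x Ux).
apply: Ck_eq oU _ (CkM oU (IH (CkS Cf)) (Df v)) => x Ux.
by have [_ ->] := derive_comp1 v (is_derive_expR (f x)) (df x Ux).
Qed.

Lemma Ck_ln k U (f : V -> R^o) : open U -> (forall x, U x -> 0 < f x) ->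
  Ck k U f -> Ck k U (fun x => ln (f x) : R^o).
Proof.
move=> oU f0; case: k => [|k] Cf.
  move=> x Ux; apply: continuous_comp; first exact: Cf.
  exact/continuous_ln/f0.
have [df Df] := Cf; split=> [x Ux|v].
  by have [] := derive_comp1 0 (is_derive1_ln (f0 x Ux)) (df x Ux).
have fN0 x : U x -> f x != 0 by move/f0/lt0r_neq0.
apply: Ck_eq oU _ (CkM oU (Ck_inv oU fN0 (CkS Cf)) (Df v)) => x Ux.
by have [_ ->] := derive_comp1 v (is_derive1_ln (f0 x Ux)) (df x Ux).
Qed.

Lemma derive_coord m (f : V -> 'rV[R]_m) (x v : V) i : differentiable f x ->
  'D_v (fun y => f y ord0 i : R^o) x = ('D_v f x) ord0 i.
Proof. by move=> df; rewrite derive_mx ?mxE//; exact: diff_derivable. Qed.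

Lemma Ck_coord m k U (f : V -> 'rV[R]_m) i : open U ->
  Ck k U f -> Ck k U (fun x => f x ord0 i : R^o).
Proof.
move=> oU; elim: k f => [|k IH] f.
  move=> Cf x Ux; apply: (@continuous_comp _ _ _ f (fun v : 'rV[R]_m =>
    v ord0 i)).
    exact: Cf.
  exact: coord_continuous.
move=> [df Df]; split=> [x Ux|v].
  apply: (@differentiable_comp _ _ _ _ f (fun v : 'rV[R]_m => v ord0 i : R^o)).
    exact: df.
  exact: differentiable_coord.
by apply: Ck_eq oU _ (IH _ (Df v)) => x Ux; rewrite derive_coord//; exact: df.
Qed.

Lemma rV_delta m (x : 'rV[R]_m) : x = \sum_i x ord0 i *: delta_mx ord0 i.
Proof. exact: row_sum_delta. Qed.

Lemma derive_sum_delta m (g : 'rV[R]_m -> R^o) (x v : 'rV[R]_m) :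
  differentiable g x -> 'D_v g x = \sum_i v ord0 i * 'D_(delta_mx ord0 i) g x.
Proof.
move=> dg; rewrite deriveE// {1}(rV_delta v) linear_sum /=.
by apply: eq_bigr => i _; rewrite linearZ /= deriveE.
Qed.

Lemma derive_comp m (g : 'rV[R]_m -> R^o) (f : V -> 'rV[R]_m) (x v : V) :
  differentiable f x -> differentiable g (f x) ->
  'D_v (g \o f) x =
    \sum_i 'D_v (fun y => f y ord0 i : R^o) x * 'D_(delta_mx ord0 i) g (f x).
Proof.
move=> df dg; rewrite deriveE; last exact: differentiable_comp.
rewrite diff_comp//= -!deriveE// derive_sum_delta//.
by apply: eq_bigr => i _; rewrite derive_coord.
Qed.

(** [Ck] controls derivatives in fixed directions, while the chain rule differentiates [g] in a
    direction that moves with [x]. Expanding that direction in the standard basis restores fixed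
    directions; hence the row vectors. *)
Lemma Ck_comp m k U (U' : set 'rV[R]_m) (f : V -> 'rV[R]_m)
    (g : 'rV[R]_m -> R^o) : open U -> open U' -> (forall x, U x -> U' (f x)) ->
  Ck k U f -> Ck k U' g -> Ck k U (g \o f).
Proof.
move=> oU oU' UU'; elim: k g => [|k IH] g.
  by move=> Cf Cg x Ux; apply: continuous_comp; [exact: Cf|exact/Cg/UU'].
move=> Cf [dg Dg]; have [df Df] := Cf; split=> [x Ux|v].
  by apply: differentiable_comp; [exact: df|exact/dg/UU'].
have C i : Ck k U ((fun x => 'D_v (fun y => f y ord0 i : R^o) x) *
                   (fun x => 'D_(delta_mx ord0 i) g (f x) : R^o)).
  apply: CkM => //; last exact: IH (CkS Cf) (Dg _).
  by have [_] := Ck_coord i oU Cf; apply.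
apply: Ck_eq oU _ (Ck_sum (index_enum _) oU C) => x Ux.
by rewrite derive_comp//; [exact: df|exact/dg/UU'].
Qed.

End CkCalculus.

Lemma Ck_coord_id (R : realType) m k (U : set 'rV[R]_m) i :
  Ck k U (fun x => x ord0 i : R^o).
Proof.
apply: Ck_sub (subsetT _) (Ck_coord i openT _).
case: k => [|k]; first by move=> x _; exact: cvg_id.
split=> [x _|v]; first exact: ex_diff.
by apply: Ck_eq openT _ (Ck_cst _ _ v) => x _; rewrite derive_id.
Qed.

(** * A smooth function that vanishes exactly on the nonpositive half-line *)

Section Flat.
Context {R : realType}.
Implicit Types (t : R) (m : nat).

(* All the derivatives of [flat 0 t = exp (- 1 / t)] are combinations of the
   [flat m]. *)
Definition flat m t : R := if 0 < t then t^-1 ^+ m * expR (- t^-1) else 0.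

Lemma flat_ge0 m t : 0 <= flat m t.
Proof.
rewrite /flat; case: ifPn => // t0.
by rewrite mulr_ge0 ?expR_ge0// exprn_ge0// invr_ge0 ltW.
Qed.

Lemma flat_gt0 t : (0 < flat 0 t) = (0 < t).
Proof. by rewrite /flat; case: ifPn => t0; rewrite ?ltxx// mul1r expR_gt0. Qed.

Lemma flat_le0 m t : t <= 0 -> flat m t = 0.
Proof. by rewrite /flat leNgt => /negbTE ->. Qed.

(** This is exp s >= s^(m+1) / (m+1)! at s = 1/t. It makes every [flat m] tend to 0 at 0. *)
Lemma flat_le m t : flat m t <= m.+1`!%:R * `|t|.
Proof.
rewrite /flat; case: ifPn => [t0|_]; last by rewrite mulr_ge0.
have s0 : 0 < t^-1 by rewrite invr_gt0.
rewrite expRN ler_pdivrMr ?expR_gt0// gtr0_norm//.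
have := le_trans _ (expR_ge1Dxn m (ltW s0));
  move=> /(_ (t^-1 ^+ m.+1 / m.+1`!%:R)).
rewrite lerDr ler01 => /(_ isT); rewrite ler_pdivrMr ?ltr0n ?fact_gt0// => le.
have -> : t^-1 ^+ m = t^-1 ^+ m.+1 * t by rewrite exprSr divfK// lt0r_neq0.
by rewrite mulrAC ler_wpM2r ?(ltW t0)// mulrC.
Qed.

Lemma is_derive_flat m t :
  is_derive t (1 : R) (flat m) (flat m.+2 t - m%:R * flat m.+1 t).
Proof.
have [t0|t0|->] := ltgtP t 0.
- rewrite !flat_le0 ?ltW// mulr0 subr0.
  apply: (@near_eq_is_derive _ _ _ (cst 0)) => //.
  by near=> s; rewrite flat_le0// ltW//; near: s; exact: lt_nbhsl.
- have tN0 := lt0r_neq0 t0.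
  have dV : is_derive t (1 : R) (fun s : R => s^-1) (- t^-1 ^+ 2).
    have := @is_deriveV _ id t 1 1 tN0 (is_derive_id _ _).
    by rewrite [_ *: _]mulr1 exprVn.
  have dE : is_derive t (1 : R) (expR \o (fun s : R => - s^-1))
      (expR (- t^-1) * t^-1 ^+ 2).
    by apply: is_derive1_comp; apply: is_derive_eq; rewrite opprK.
  apply: (@near_eq_is_derive _ _ _ ((fun s : R => s^-1) ^+ m *
      (expR \o (fun s : R => - s^-1)))) => //.
    near=> s; rewrite /flat ifT ?fctE ?exprfctE//.
    by near: s; apply: (cvgr_gt t) => //; exact: cvg_id.
  apply: is_derive_eq.
  rewrite /flat !t0 /= !fctE ?exprfctE /=.
  rewrite /GRing.scale /=.
  by case: m => [|m]; rewrite /= ?exprS; ring.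
(* At 0 the difference quotient of [flat m] is [flat m.+1], which tends to 0 by [flat_le]. *)
- rewrite !(@flat_le0 _ 0)// mulr0 subr0.
  have lim0 : (fun h : R => h^-1 *: ((flat m \o shift 0) (h *: 1) - flat m 0))
      @ 0^' --> (0 : R).
    apply/cvgr0Pnorm_le => e e0; near=> h.
    rewrite /= addr0 [_%:A]mulr1 (flat_le0 _ (lexx 0)) subr0.
    have -> : h^-1 *: flat m h = flat m.+1 h.
      rewrite /flat; case: ifPn => h0; last by rewrite scaler0.
      by rewrite exprS -mulrA.
    rewrite ger0_norm ?flat_ge0// (le_trans (flat_le _ _))//.
    rewrite mulrC -ler_pdivlMr ?ltr0n ?fact_gt0// ltW//.
    by near: h; apply: dnbhs0_lt; rewrite divr_gt0// ltr0n fact_gt0.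
  by apply: DeriveDef; [apply/cvg_ex; exists 0|exact: cvg_lim].
Unshelve. all: by end_near. Qed.

End Flat.

Lemma Ck_flat (R : realType) (V : normedModType R) k m (U : set V)
    (f : V -> R^o) : open U -> Ck k U f -> Ck k U (fun x => flat m (f x) : R^o).
Proof.
move=> oU; elim: k m => [|k IH] m Cf.
  move=> x Ux; apply: continuous_comp; first exact: Cf.
  apply: differentiable_continuous; apply/derivable1_diffP.
  by case: (is_derive_flat m (f x)).
have [df Df] := Cf; split=> [x Ux|v].
  by have [] := derive_comp1 0 (is_derive_flat m (f x)) (df x Ux).
have C1 := IH m.+1 (CkS Cf); have C2 := IH m.+2 (CkS Cf).
have C := CkD oU C2 (Ck_opp oU (CkM oU (Ck_cst k U (m%:R : R^o)) C1)).
apply: Ck_eq oU _ (CkM oU C (Df v)) => x Ux.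
by have [_ ->] := derive_comp1 v (is_derive_flat m (f x)) (df x Ux).
Qed.

(** * Hadamard's lemma *)

Section UnitIntegral.
Context {R : realType}.
Implicit Types f g : R -> R.

Definition itg f : R := \int[@lebesgue_measure R]_(t in `[0, 1]) f t.

Lemma itg_integrable f : continuous f ->
  (@lebesgue_measure R).-integrable `[0, 1]%classic (EFin \o f).
Proof.
move=> cf; apply: continuous_compact_integrable; first exact: segment_compact.
exact: continuous_subspaceT.
Qed.

Lemma itgD f g : continuous f -> continuous g ->
  itg (fun t => f t + g t) = itg f + itg g.
Proof. by move=> cf cg; rewrite /itg RintegralD//; exact: itg_integrable. Qed.

Lemma itgZ a f : continuous f -> itg (fun t => a * f t) = a * itg f.
Proof. by move=> cf; rewrite /itg RintegralZl//; exact: itg_integrable. Qed.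

Lemma itgB f g : continuous f -> continuous g ->
  itg (fun t => f t - g t) = itg f - itg g.
Proof. by move=> cf cg; rewrite /itg RintegralB//; exact: itg_integrable. Qed.

Lemma itg_sum n (f : 'I_n -> R -> R) : (forall i, continuous (f i)) ->
  itg (fun t => \sum_i f i t) = \sum_i itg (f i).
Proof.
move=> cf; elim: n f cf => [|n IH] f cf.
  rewrite big_ord0 /itg -[RHS](mul0r (itg (cst 0))) -itgZ;
    last exact: cst_continuous.
  by apply: eq_Rintegral => t _; rewrite big_ord0 mul0r.
rewrite big_ord_recl -IH // -itgD//; last first.
  by apply: continuous_big => [|i _]; [exact: add_continuous|exact: cf].
by apply: eq_Rintegral => t _; rewrite big_ord_recl.
Qed.

Lemma itg_le f e : continuous f -> (forall t, t \in `[0, 1] -> `|f t| <= e) ->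
  `|itg f| <= e.
Proof.
move=> cf fe; apply: le_trans (le_normr_Rintegral _ (itg_integrable cf)) _ =>
  //.
have -> : e = \int[@lebesgue_measure R]_(t in `[0, 1]) (cst e) t.
  rewrite Rintegral_cst//= lebesgue_measure_itv/= lte_fin ltr01.
  by rewrite oppr0 adde0 mulr1.
apply: le_Rintegral => //.
- apply: (@itg_integrable (fun t => `|f t|)) => t.
  by apply: continuous_comp; [exact: cf|exact: norm_continuous].
- by apply: itg_integrable; exact: cst_continuous.
Qed.

Lemma itg_FTC f F : continuous f -> (forall t, is_derive t (1 : R) F (f t)) ->
  itg f = F 1 - F 0.
Proof.
move=> cf dF; rewrite /itg /Rintegral (@continuous_FTC2 _ f F)//.
- exact: continuous_subspaceT.
- have cF t : {for t, continuous F}.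
    by apply: differentiable_continuous; apply/derivable1_diffP; case: (dF t).
  split; first by move=> t _; case: (dF t).
    by apply: cvg_at_right_filter; exact: cF.
  by apply: cvg_at_left_filter; exact: cF.
- by move=> t _; rewrite derive1E derive_val.
Qed.

End UnitIntegral.

(* [filterS] and [filterI] for neighbourhoods; on ['rV[R]_n] the instance of
   [Filter (nbhs x)] is not found by unification. *)
Lemma near_imply (T : topologicalType) (x : T) (P Q : T -> Prop) :
  (\forall y \near x, P y) -> (forall y, P y -> Q y) -> \forall y \near x, Q y.
Proof. by move=> xP PQ; exact: filterS xP. Qed.

Lemma continuous_near_le (R : realType) (T : topologicalType) (W : normedModType
  R)
    (f : T -> W) (x : T) :
  {for x, continuous f} <->
  forall e, 0 < e -> \forall y \near x, `|f x - f y| <= e.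
Proof. by split=> [/cvgrPdist_le|fx]//; apply/cvgrPdist_le. Qed.

(** Tube lemma: compactness of [0, 1] replaces neighbourhoods of [x] depending on [t] by a single
    one. It supplies the uniformity needed under the integral sign. *)
Lemma near_segment (R : realType) (V : topologicalType) (x : V)
    (P : V -> R -> Prop) :
  (forall t : R, t \in `[0, 1] -> \forall s \near t & y \near x, P y s) ->
  \forall y \near x, forall t : R, t \in `[0, 1] -> P y t.
Proof.
by move=> xP; have /compact_near_coveringP := @segment_compact R 0 1; apply.
Qed.

Lemma near_and (T : topologicalType) (x : T) (P Q : T -> Prop) :
  (\forall y \near x, P y) -> (\forall y \near x, Q y) ->
  \forall y \near x, P y /\ Q y.
Proof. exact: filterI. Qed.

Lemma pair_continuous (T U W : topologicalType) (f : T -> U) (g : T -> W) :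
  continuous f -> continuous g -> continuous (fun t => (f t, g t)).
Proof. by move=> cf cg t; apply: cvg_pair; [exact: cf|exact: cg]. Qed.

Lemma differentiable_approx (R : realType) (V W : normedModType R) (f : V -> W)
    (x : V) (L : {linear V -> W}) : continuous L ->
  (forall e, 0 < e -> \forall h \near (0 : V),
     `|f (h + x) - f x - L h| <= e * `|h|) ->
  differentiable f x /\ forall v, 'D_v f x = L v.
Proof.
move=> cL fL; have E : f \o shift x = cst (f x) + L +o_ 0 id.
  apply/eqaddoP => e e0; apply: filterS (fL e e0) => h.
  by rewrite !fctE /= opprD addrA.
have dE := diff_unique cL E.
have df : differentiable f x by apply/diff_locallyP; rewrite dE.
by split=> // v; rewrite deriveE// dE.
Qed.

Section Hadamard.
Context {R : realType} {n : nat}.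
Notation V := 'rV[R]_n.
Notation "''d_' i f" := (fun x => 'D_(delta_mx ord0 i) f x : R^o)
  (at level 10, i at next level, f at next level).
Implicit Types (f g : V -> R^o) (x y v : V) (m : nat).

Section RowComb.
Context {W : normedModType R}.
Implicit Types a : 'I_n -> W.

Definition row_comb a (h : V) : W := \sum_i h ord0 i *: a i.

Lemma row_comb_linear a : linear (row_comb a).
Proof.
move=> c u v; rewrite /row_comb scaler_sumr -big_split;
  apply: eq_bigr => i _ /=.
by rewrite !mxE scalerDl scalerA.
Qed.

HB.instance Definition _ a := GRing.isLinear.Build R V W _ (row_comb a)
  (row_comb_linear a).

Lemma row_comb_continuous a : continuous (row_comb a).
Proof.
apply: continuous_big => [|i _]; first exact: add_continuous.
by move=> x; apply: cvgZr_tmp; [exact: nbhs_filter|exact: coord_continuous].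
Qed.

Lemma differentiable_row_comb (f : V -> W) x a :
  (forall e, 0 < e -> \forall h \near (0 : V),
     `|f (h + x) - f x - row_comb a h| <= e * `|h|) ->
  differentiable f x /\ forall v, 'D_v f x = row_comb a v.
Proof.
by move=> fa; exact: (differentiable_approx (@row_comb_continuous a) fa).
Qed.

End RowComb.

Lemma le_coord (v : V) i : `|v ord0 i| <= `|v|.
Proof.
rewrite [leRHS]/Num.Def.normr/= mx_normrE.
exact: (le_bigmax _ (fun ij => `|v ij.1 ij.2|) (ord0, i)).
Qed.

Lemma is_derive_line f x v (t : R) : differentiable f (x + t *: v) ->
  is_derive t (1 : R) (fun s : R => f (x + s *: v) : R) ('D_v f (x + t *: v)).
Proof.
move=> /(@diff_derivable _ _ _ _ _ v) df.
have E : (fun h : R => h^-1 *: (((fun s : R =>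
  f (x + s *: v)) \o shift t) (h *: 1)
    - f (x + t *: v))) = (fun h => h^-1 *: ((f \o shift (x + t *: v)) (h *: v)
    - f (x + t *: v))).
  apply/funext => h; congr (_ *: (_ - _)); congr f.
  by rewrite /= [_%:A]mulr1 scalerDl addrCA.
by apply: DeriveDef; rewrite /derivable /derive /= E.
Qed.

(** Both points vary, because along a segment the base point moves with the parameter. The mean
    value theorem on the segment from [y] to [z] reduces the estimate to the continuity of the
    partial derivatives at [x]. *)
Lemma strict_derivative f x : (forall y, differentiable f y) ->
    (forall i, {for x, continuous ('d_i f)}) -> forall e, 0 < e ->
  \forall z \near x & y \near x,
    `|f z - f y - row_comb (fun i => 'd_i f y) (z - y)| <= e * `|z - y|.
Proof.
(* Half, since the partial derivatives at two points are compared through [x]; [n.+1], to share [e]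
   among the [n] coordinates even when [n] is 0. *)
move=> df cf e e0; pose e' := e / n.+1%:R / 2.
have e'0 : 0 < e' by rewrite !divr_gt0.
have : \forall y \near x, forall i, `|'d_i f x - 'd_i f y| <= e'.
  by apply: (@filter_forall _ _ _ _ (nbhs_filter x)) => i;
    move/cvgrPdist_le: (cf i) => /(_ _ e'0).
move=> /nbhs_ballP[d /= d0 dP].
exists (ball x d, ball x d); first by split; exact: nbhsx_ballx.
move=> [z y] /= [xz xy].
have [c c01 ->] : exists2 c : R, c \in `[0, 1] &
    f z - f y = 'D_(z - y) f (y + c *: (z - y)).
  have := @MVT_segment R (fun s : R => f (y + s *: (z - y)))
    (fun s => 'D_(z - y) f (y + s *: (z - y))) 0 1 ler01.
  rewrite scale1r scale0r addr0 subrKC subr0.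
  have H s := is_derive_line (x := y) (v := z - y) (t := s) (df _).
  move=> /(_ (fun s _ => H s)) []; last by move=> c c01 ->; rewrite mulr1;
    exists c.
  apply: continuous_subspaceT => s; apply: differentiable_continuous.
  by apply/derivable1_diffP; case: (H s).
rewrite derive_sum_delta// /row_comb -sumrB.
have xc : ball x d (y + c *: (z - y)).
  have -> : y + c *: (z - y) = x - ((1 - c) *: (x - y) + c *: (x - z)).
    by apply/rowP => i; rewrite !mxE; ring.
  rewrite -ball_normE /= opprB addrC subrK.
  move: c01; rewrite in_itv /= => /andP[c0 c1].
  apply: le_lt_trans (ler_normD _ _) _.
  rewrite !normrZ (ger0_norm c0) ger0_norm ?subr_ge0//.
  move: xz xy; rewrite -ball_normE /= => xz xy.
  by have [AB|/ltW AB] := leP `|x - y| `|x - z|; nra.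
apply: le_trans (ler_norm_sum _ _ _) _.
apply: (@le_trans _ _ (\sum_(i < n) `|z - y| * (e / n.+1%:R))).
  apply: ler_sum => i _; rewrite -mulrBr normrM ler_pM ?le_coord//.
  have -> : e / n.+1%:R = e' + e' by exact: splitr.
  rewrite -(subrKA ('d_i f x)) (le_trans (ler_normD _ _))// lerD//.
    by rewrite distrC dP.
  by rewrite dP.
rewrite sumr_const card_ord -[_ *+ n]mulr_natr mulrAC mulrC mulrCA mulrC.
rewrite ler_wpM2r// mulrAC ler_pdivrMr ?ltr0n// ler_wpM2l ?(ltW e0)// ler_nat.
exact: leqnSn.
Qed.

Let seg x0 (t : R) x : V := x0 + t *: (x - x0).

(* The weights [t ^ m] make the family stable under differentiation. *)
Definition radial_mean x0 m f x : R^o := itg (fun t : R =>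
  t ^+ m * f (seg x0 t x)).

Lemma radial_integrand_continuous2 x0 m f : continuous f ->
  continuous (fun p : R * V => p.1 ^+ m * f (seg x0 p.1 p.2) : R).
Proof.
move=> cf p; apply: (@continuousM _ _ (fun p : R * V => p.1 ^+ m)).
  apply: (@continuous_comp _ _ _ fst (fun t : R => t ^+ m));
    first exact: cvg_fst.
  exact: exprn_continuous.
apply: (@continuous_comp _ _ _ (fun p : R * V => seg x0 p.1 p.2));
  last exact: cf.
apply: cvgD; first exact: cvg_cst.
apply: cvgZ; first exact: cvg_fst.
by apply: cvgB; [exact: cvg_snd|exact: cvg_cst].
Qed.

Lemma radial_integrand_continuous x0 m f x : continuous f ->
  continuous (fun t : R => t ^+ m * f (seg x0 t x) : R).
Proof.
move=> cf t; apply: (@continuous_comp _ _ _ (fun s : R => (s, x))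
  (fun p : R * V => p.1 ^+ m * f (seg x0 p.1 p.2) : R)).
  by apply: pair_continuous; [move=> s; exact: cvg_id|exact: cst_continuous].
exact: radial_integrand_continuous2.
Qed.

Lemma radial_mean_continuous x0 m f : continuous f ->
  continuous (radial_mean x0 m f).
Proof.
move=> cf x; apply/continuous_near_le => e e0.
have : \forall y \near x, forall t : R, t \in `[0, 1] ->
    `|t ^+ m * f (seg x0 t x) - t ^+ m * f (seg x0 t y)| <= e.
  apply: near_segment => t _.
  pose G (p : R * V) : R := p.1 ^+ m * f (seg x0 p.1 x) - p.1 ^+ m * f (seg x0
    p.1 p.2).
  have cG : continuous G.
    move=> p; apply: cvgB; last exact: (radial_integrand_continuous2 cf).
    apply: (@continuous_comp _ _ _ fst (fun s : R =>
      s ^+ m * f (seg x0 s x) : R)).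
      exact: cvg_fst.
    exact: (radial_integrand_continuous cf).
  have /continuous_near_le/(_ e e0) := cG (t, x).
  by apply: filterS => p; rewrite {1}/G /= subrr sub0r normrN.
apply: (@filterS _ _ (nbhs_filter x)) => y H.
rewrite /radial_mean -itgB; [|exact: radial_integrand_continuous..].
apply: itg_le => [t|t /H//].
by apply: cvgB; exact: radial_integrand_continuous.
Qed.

Lemma row_comb_radial_mean x0 m f x v : (forall i, continuous ('d_i f)) ->
  row_comb (fun i => radial_mean x0 m ('d_i f) x) v =
  itg (fun t : R => \sum_i v ord0 i * (t ^+ m * 'd_i f (seg x0 t x))).
Proof.
move=> cd; have cI i := @radial_integrand_continuous x0 m _ x (cd i).
rewrite itg_sum; last by move=> i t; apply: cvgM; [exact: cvg_cst|exact: cI].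
by apply: eq_bigr => i _; rewrite itgZ.
Qed.

Lemma seg_shift x0 t x h : seg x0 t (h + x) - seg x0 t x = t *: h.
Proof. by apply/rowP => i; rewrite !mxE; ring. Qed.

(** Differentiation under the integral sign. A displacement [h] of [x] moves the point at parameter
    [t] by [t *: h], which raises the weight from [m] to [m.+1]. *)
Lemma radial_mean_estimate x0 m f x : (forall y, differentiable f y) ->
    (forall i, continuous ('d_i f)) -> forall e, 0 < e ->
      \forall h \near (0 : V),
  `|radial_mean x0 m f (h + x) - radial_mean x0 m f x -
    row_comb (fun i => radial_mean x0 m.+1 ('d_i f) x) h| <= e * `|h|.
Proof.
move=> df cdf e e0.
have cf : continuous f by move=> y; exact: differentiable_continuous.
have : \forall h \near (0 : V), forall t : R, t \in `[0, 1] ->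
    t \in `[0, 1] -> `|f (seg x0 t (h + x)) - f (seg x0 t x) -
      row_comb (fun i => 'd_i f (seg x0 t x)) (t *: h)| <= e * `|t *: h|.
  apply: near_segment => t _.
  have : \forall y \near seg x0 t x & z \near seg x0 t x,
      `|f y - f z - row_comb (fun i => 'd_i f z) (y - z)| <= e * `|y - z|.
    by apply: strict_derivative => // i; exact: cdf.
  (* Continuity of [S] at (t, 0) transports the strict estimate to nearby parameters and small
     displacements. *)
  pose S (p : R * V) : V * V := (seg x0 p.1 (p.2 + x), seg x0 p.1 x).
  have cS : continuous S.
    have c1 : continuous (fun p : R * V => x0 + p.1 *: (p.2 + x - x0)).
      move=> p; apply: cvgD; first exact: cvg_cst.
      apply: cvgZ; first exact: cvg_fst.
      apply: cvgB; last exact: cvg_cst.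
      by apply: cvgD; [exact: cvg_snd|exact: cvg_cst].
    have c2 : continuous (fun p : R * V => x0 + p.1 *: (x - x0)).
      move=> p; apply: cvgD; first exact: cvg_cst.
      by apply: cvgZ; [exact: cvg_fst|exact: cvg_cst].
    exact: pair_continuous.
  move=> H; have := cS (t, 0); rewrite /S /continuous_at /= add0r =>
    /(_ _ H) H'.
  by apply: (near_imply H') => p /=; rewrite seg_shift.
apply: (@filterS _ _ (nbhs_filter (0 : V))) => h H.
rewrite row_comb_radial_mean// /radial_mean.
have cI y := @radial_integrand_continuous x0 m f y cf.
have cB : continuous (fun t : R => t ^+ m * f (seg x0 t (h + x)) -
    t ^+ m * f (seg x0 t x) : R) by move=> t; apply: cvgB; exact: cI.
have cS : continuous (fun t : R =>
    \sum_i h ord0 i * (t ^+ m.+1 * 'd_i f (seg x0 t x)) : R).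
  apply: continuous_big => [|i _ t]; first exact: add_continuous.
  apply: cvgM; first exact: cvg_cst.
  exact: (@radial_integrand_continuous x0 m.+1 _ x (cdf i)).
rewrite -itgB// -itgB//.
apply: itg_le => [t|t t01]; first by apply: cvgB; [exact: cB|exact: cS].
have {H} := H t t01 t01.
have /andP[t0 t1] : 0 <= t <= 1 by move: t01; rewrite in_itv.
rewrite normrZ ger0_norm// => H.
have -> : t ^+ m * f (seg x0 t (h + x)) - t ^+ m * f (seg x0 t x) -
    \sum_i h ord0 i * (t ^+ m.+1 * 'd_i f (seg x0 t x)) =
  t ^+ m * (f (seg x0 t (h + x)) - f (seg x0 t x) -
      row_comb (fun i => 'd_i f (seg x0 t x)) (t *: h)).
  rewrite mulrBr mulrBr /row_comb mulr_sumr; congr (_ - _).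
  apply: eq_bigr => i _; rewrite mxE exprS /GRing.scale /= !mulrA.
  by congr (_ * _); ring.
rewrite normrM ger0_norm ?exprn_ge0//.
have tm : t ^+ m <= 1 by rewrite exprn_ile1.
apply: le_trans (ler_wpM2r _ tm) _ => //; rewrite mul1r; apply: le_trans H _.
by rewrite ler_wpM2l ?(ltW e0)// ler_piMl.
Qed.

Lemma radial_mean_diff x0 m f x : (forall y, differentiable f y) ->
    (forall i, continuous ('d_i f)) ->
  differentiable (radial_mean x0 m f) x /\
  forall v, 'D_v (radial_mean x0 m f) x =
    radial_mean x0 m.+1 (fun y => 'D_v f y) x.
Proof.
move=> df cdf.
have [drm Drm] := differentiable_row_comb (radial_mean_estimate x0 m x df cdf).
split=> // v; rewrite Drm row_comb_radial_mean//.
apply: eq_Rintegral => t _; rewrite derive_sum_delta// mulr_sumr.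
by apply: eq_bigr => i _; rewrite mulrCA.
Qed.

Lemma Ck_radial_mean x0 k m f : Ck k setT f -> Ck k setT (radial_mean x0 m f).
Proof.
elim: k m f => [|k IH] m f.
  by move=> cf x _; apply: radial_mean_continuous => y; exact: cf.
move=> Cf; have [df Df] := Cf.
have dT y : differentiable f y by exact: df.
have cT i : continuous ('d_i f).
  by move=> y; exact: (Ck0 (Df (delta_mx ord0 i))).
split=> [x _|v]; first by have [] := radial_mean_diff x0 m x dT cT.
apply: Ck_eq openT _ (IH m.+1 _ (Df v)) => x _.
by have [_ ->] := radial_mean_diff x0 m x dT cT.
Qed.

(** The derivative of [f] is integrated along the segment from [x0] to [x], and [g i] is the mean of
    the i-th partial derivative on it. A derivation at [x0] applied to this formula sees only the
    partial derivatives. *)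
Lemma hadamard x0 f : smooth_on setT f -> exists2 g : 'I_n -> V -> R^o,
  (forall i, smooth_on setT (g i) /\ g i x0 = 'd_i f x0) &
  forall x, f x = f x0 + \sum_i (x - x0) ord0 i * g i x.
Proof.
move=> sf; exists (fun i => radial_mean x0 0 ('d_i f)) => [i|x].
  split=> [k|]; first by apply: Ck_radial_mean; have [_] := sf k.+1; apply.
  rewrite /radial_mean /seg subrr.
  have -> : (fun t : R => t ^+ 0 * 'd_i f (x0 + t *: (0 : V))) =
      (fun t : R => 'd_i f x0 * (cst 1 t)).
    by apply/funext => t; rewrite scaler0 addr0 mul1r mulr1.
  rewrite itgZ; last exact: cst_continuous.
  by rewrite (@itg_FTC _ _ id)//= ?subr0 ?mulr1//; exact: cst_continuous.
have df y : differentiable f y by have [+ _] := sf 1%N; apply.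
have cd v : continuous (fun y => 'D_v f y).
  by have [_ /(_ v) c] := sf 1%N; move=> y; exact: c.
rewrite -[\sum__ _]/(row_comb (fun i => radial_mean x0 0 ('d_i f) x) (x - x0)).
rewrite row_comb_radial_mean//.
have FTC : itg (fun t : R => 'D_(x - x0) f (seg x0 t x)) = f x - f x0.
  have c : continuous (fun t : R => 'D_(x - x0) f (seg x0 t x) : R).
    have := @radial_integrand_continuous x0 0 _ x (cd (x - x0)).
    by under eq_fun do rewrite mul1r.
  have d (t : R) : is_derive t (1 : R) (fun t : R => f (seg x0 t x) : R)
      ('D_(x - x0) f (seg x0 t x)) by exact: is_derive_line.
  rewrite (itg_FTC c d).
  by rewrite /seg scale1r scale0r addr0 subrKC.
apply/eqP; rewrite addrC -subr_eq -FTC; apply/eqP/eq_Rintegral => t _.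
rewrite derive_sum_delta//; apply: eq_bigr => i _.
by rewrite mul1r.
Qed.

End Hadamard.

(** * Smooth functions on a manifold *)

Section SmoothNear.
Context {R : realType} {V : normedModType R}.
Implicit Types (f g : V -> R^o) (x : V).

Definition smooth_near x f := exists2 U : set V, open_nbhs x U & smooth_on U f.

Lemma smooth_near_eq x f g : (\forall y \near x, f y = g y) ->
  smooth_near x f -> smooth_near x g.
Proof.
move=> /nbhs_interior fg [U oU sf].
have oI : open (U `&` [set y | f y = g y]°).
  by apply: openI; [case: oU|exact: open_interior].
exists (U `&` [set y | f y = g y]°).
  split=> //; split; first by case: oU.
  exact: nbhs_singleton.
move=> k; apply: Ck_eq oI _ (Ck_sub (@subIsetl _ _ _) (sf k)) => y [_].
exact: interior_subset.
Qed.

Lemma smooth_near_continuous x f : smooth_near x f -> {for x, continuous f}.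
Proof. by move=> [U [oU Ux] /(_ 0%N)]; exact. Qed.

Lemma smooth_near_cst x (a : R) : smooth_near x (cst (a : R^o)).
Proof. by exists setT; [split; [exact: openT|]|move=> k; exact: Ck_cst]. Qed.

Lemma smooth_nearD x f g : smooth_near x f -> smooth_near x g ->
  smooth_near x (fun y => f y + g y).
Proof.
move=> [U oU sf] [U' oU' sg]; exists (U `&` U'); first exact: open_nbhsI.
have oI : open (U `&` U') by apply: openI; [case: oU|case: oU'].
by move=> k; apply: CkD => //; apply: Ck_sub (sf k) || apply: Ck_sub (sg k).
Qed.

Lemma smooth_nearM x f g : smooth_near x f -> smooth_near x g ->
  smooth_near x (fun y => f y * g y : R^o).
Proof.
move=> [U oU sf] [U' oU' sg]; exists (U `&` U'); first exact: open_nbhsI.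
have oI : open (U `&` U') by apply: openI; [case: oU|case: oU'].
by move=> k; apply: CkM => //; apply: Ck_sub (sf k) || apply: Ck_sub (sg k).
Qed.

Lemma smooth_near_sum x (I : Type) (r : seq I) (P : pred I) (f : I -> V ->
  R^o) :
  (forall i, P i -> smooth_near x (f i)) ->
  smooth_near x (fun y => \sum_(i <- r | P i) f i y).
Proof.
move=> sf; elim: r => [|i r IH].
  by apply: smooth_near_eq (smooth_near_cst x 0); near=> y; rewrite big_nil.
case: (boolP (P i)) => Pi; [apply: smooth_near_eq (smooth_nearD (sf i Pi) IH)|
  apply: smooth_near_eq IH]; near=> y; rewrite big_cons ?Pi//.
by rewrite (negbTE Pi).
Unshelve. all: by end_near. Qed.

Lemma smooth_near_comp (phi : R -> R^o) (I : set R) x f :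
  (forall U : set V, open U -> (forall y, U y -> I (f y)) ->
    forall k, Ck k U f -> Ck k U (fun y => phi (f y))) ->
  open I -> I (f x) -> smooth_near x f -> smooth_near x (fun y => phi (f y)).
Proof.
move=> Cphi oI Ifx sf; have [U [oU Ux] sU] := sf.
have : \forall y \near x, I (f y).
  by apply: (smooth_near_continuous sf); exact: open_nbhs_nbhs.
move=> /nbhs_interior Ix; exists (U `&` [set y | I (f y)]°).
  apply: open_nbhsI; first by [].
  by split; [exact: open_interior|exact: nbhs_singleton].
move=> k; apply: Cphi.
- by apply: openI => //; exact: open_interior.
- by move=> y [_ /interior_subset].
- exact: Ck_sub (@subIsetl _ _ _) (sU k).
Qed.

Lemma smooth_nearV x f : f x != 0 -> smooth_near x f ->
  smooth_near x (fun y => (f y)^-1 : R^o).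
Proof.
apply: (@smooth_near_comp (fun t : R => t^-1 : R^o) [set t | t != 0]);
  last exact: open_neq.
by move=> U oU U0 k; exact: Ck_inv.
Qed.

Lemma smooth_near_expR x f : smooth_near x f ->
  smooth_near x (fun y => expR (f y) : R^o).
Proof.
by move=> [U oU sf]; exists U => // k; apply: Ck_expR => //; case: oU.
Qed.

Lemma smooth_near_flat x f m : smooth_near x f ->
  smooth_near x (fun y => flat m (f y) : R^o).
Proof.
by move=> [U oU sf]; exists U => // k; apply: Ck_flat => //; case: oU.
Qed.

Lemma smooth_near_ln x f : 0 < f x -> smooth_near x f ->
  smooth_near x (fun y => ln (f y) : R^o).
Proof.
apply: (@smooth_near_comp (fun t : R => ln t : R^o) [set t | 0 < t]);
  last exact: open_gt.
by move=> U oU U0 k; exact: Ck_ln.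
Qed.

Lemma smooth_near_derive x f v : smooth_near x f ->
  smooth_near x (fun y => 'D_v f y : R^o).
Proof. by move=> [U oU sf]; exists U => // k; have [_] := sf k.+1; apply. Qed.

Lemma smooth_near_differentiable x f : smooth_near x f -> differentiable f x.
Proof. by move=> [U [oU Ux] /(_ 1%N)[+ _]]; apply. Qed.

Lemma smooth_on_near (U : set V) f : (forall x, U x -> smooth_near x f) ->
  smooth_on U f.
Proof.
by move=> sf k; apply: Ck_local => x /sf[U' [oU' U'x] sU']; exists U'.
Qed.

End SmoothNear.

Section SmoothAt.
Context {R : realType} {n : nat} {M : manifold R n}.
Implicit Types (p : M) (c d : chart R n M) (f g : M -> R^o).
Notation V := 'rV[R]_n.

Definition smooth_at p f := forall c, @atlas R n M c -> cdom c p ->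
  smooth_near (cmap c p) (f \o cinv c).

Lemma smoothP f : smooth f <-> forall p, smooth_at p f.
Proof.
split=> [sf p c ac cp|sf c ac].
  exists (cmap c @` cdom c); last exact: sf.
  by split; [exact: cimg_open|exists p].
by apply: smooth_on_near => x [p cp <-]; exact: sf.
Qed.

Lemma near_cinv p c (A : set M) : cdom c p -> nbhs p A ->
  \forall x \near cmap c p, A (cinv c x).
Proof.
move=> cp pA; have ip : (cmap c @` cdom c) (cmap c p) by exists p.
by have := cinv_cont ip; rewrite /prop_for /continuous_at cmapK// => /(_ A pA).
Qed.

Lemma near_cmap_image p c (A : set M) : cdom c p -> nbhs p A ->
  \forall x \near cmap c p, (cmap c @` (cdom c `&` A)) x.
Proof.
move=> cp pA; have ip : (cmap c @` cdom c) (cmap c p) by exists p.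
have oi := open_nbhs_nbhs (conj (@cimg_open _ _ _ c) ip).
apply: filterS2 oi (near_cinv cp pA) => x [q cq <-]; rewrite cmapK// => Aq.
by exists q.
Qed.

Lemma open_cmap_image c (A : set M) : open A -> open (cmap c @` (cdom c `&` A)).
Proof.
move=> oA; rewrite openE => _ [p [cp Ap] <-].
by apply: near_cmap_image => //; exact: open_nbhs_nbhs.
Qed.

Lemma smooth_at_eq p f g : (\forall q \near p, f q = g q) ->
  smooth_at p f -> smooth_at p g.
Proof.
move=> fg sf c ac cp; apply: smooth_near_eq (sf c ac cp).
exact: near_cinv fg.
Qed.

(** One chart suffices because the transition maps are smooth. *)
Lemma smooth_at_chart p c f : @atlas R n M c -> cdom c p ->
  smooth_near (cmap c p) (f \o cinv c) -> smooth_at p f.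
Proof.
move=> ac cp [U' [oU' U'p] sU'] d ad dp.
pose A : set M := cdom c `&` (cmap c @^-1` U').
have oA : open A.
  rewrite openE => q [cq Uq]; apply: filterI.
    exact: (open_nbhs_nbhs (conj (@cdom_open _ _ _ c) cq)).
  by apply: (cmap_cont cq); exact: open_nbhs_nbhs.
have oU := @open_cmap_image d _ oA.
exists (cmap d @` (cdom d `&` A)); first by split=> //; exists p.
move=> k; apply: (@Ck_eq _ _ _ _ _ ((f \o cinv c) \o (cmap c \o cinv d))) => //.
  by move=> _ [q [dq [cq _]] <-] /=; rewrite !cmapK.
apply: (Ck_comp oU oU' _ _ (sU' k)).
  by move=> _ [q [dq [cq Uq]] <-] /=; rewrite cmapK.
apply: Ck_sub (atlas_compat ad ac k) => _ [q [dq [cq _]] <-].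
by exists q.
Qed.

Lemma smooth_atM p f g : smooth_at p f -> smooth_at p g ->
  smooth_at p (fun q => f q * g q : R^o).
Proof. by move=> sf sg c ac cp; apply: smooth_nearM; [exact: sf|exact: sg]. Qed.

Lemma smooth_at_sum p (I : Type) (r : seq I) (P : pred I) (f : I -> M -> R^o) :
  (forall i, P i -> smooth_at p (f i)) ->
  smooth_at p (fun q => \sum_(i <- r | P i) f i q).
Proof.
move=> sf c ac cp.
by apply: (@smooth_near_sum _ _ _ _ _ _ (fun i => f i \o cinv c)) => i Pi;
  exact: sf.
Qed.

Lemma smooth_atV p f : f p != 0 -> smooth_at p f ->
  smooth_at p (fun q => (f q)^-1 : R^o).
Proof.
move=> f0 sf c ac cp; apply: (smooth_nearV _ (sf c ac cp)).
by rewrite /= cmapK.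
Qed.

Lemma smooth_expR f : smooth f -> smooth (fun q => expR (f q) : R^o).
Proof.
move=> /smoothP sf; apply/smoothP => p c ac cp.
exact: (smooth_near_expR (sf p c ac cp)).
Qed.

Lemma smooth_flat f m : smooth f -> smooth (fun q => flat m (f q) : R^o).
Proof.
move=> /smoothP sf; apply/smoothP => p c ac cp.
exact: (smooth_near_flat m (sf p c ac cp)).
Qed.

Lemma smooth_ln f : (forall p, 0 < f p) -> smooth f ->
  smooth (fun q => ln (f q) : R^o).
Proof.
move=> f0 /smoothP sf; apply/smoothP => p c ac cp.
by apply: (smooth_near_ln _ (sf p c ac cp)); exact: f0.
Qed.

Lemma smoothV f : (forall p, f p != 0) -> smooth f ->
  smooth (fun q => (f q)^-1 : R^o).
Proof.
by move=> f0 /smoothP sf; apply/smoothP => p; apply: smooth_atV.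
Qed.

Lemma Cinf_smooth (f : Cinf M) : smooth f.
Proof. by apply/asboolP; case: f. Qed.

End SmoothAt.

Lemma continuous_near_lt (R : realType) (T : topologicalType) (f : T ->
  R) (x : T)
  (a : R) : {for x, continuous f} -> f x < a -> \forall y \near x, f y < a.
Proof. by move=> cf fa; exact: (cvgr_lt (f x)). Qed.

(** * Bump functions and extension by zero *)

Section Cutoff.
Context {R : realType} {n : nat}.
Notation V := 'rV[R]_n.

Lemma smooth_near_coord (x : V) i : smooth_near x (fun y : V => y ord0 i : R^o).
Proof. by exists setT; [split=> //; exact: openT|move=> k;
  exact: Ck_coord_id]. Qed.

Lemma rV_norm_le (v : V) (r : R) : 0 <= r -> (forall i, `|v ord0 i| <= r) ->
  `|v| <= r.
Proof.
move=> r0 vr; rewrite /Num.Def.normr/= mx_normrE.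
by apply: bigmax_le => // -[i j] _ /=; rewrite ord1.
Qed.

(** A quotient of flat functions of the squared Euclidean distance [s], the maximum norm not being
    smooth. The numerator vanishes for s >= r^2; the second term of the denominator vanishes for s
    <= r^2 / 2, where the quotient is 1. *)
Lemma cutoff (x0 : V) (r : R) : 0 < r -> exists chi : V -> R^o,
  [/\ forall x, smooth_near x chi, forall x, 0 <= chi x,
      \forall x \near x0, chi x = 1 &
      forall x, chi x != 0 -> forall i, `|x ord0 i - x0 ord0 i| <= r].
Proof.
move=> r0; pose s (x : V) : R^o := \sum_i (x ord0 i - x0 ord0 i) * (x ord0 i -
  x0 ord0 i).
have ss x : smooth_near x s.
  apply: smooth_near_sum => i _.
  have sc : smooth_near x (fun y : V => y ord0 i - x0 ord0 i : R^o).
    by apply: smooth_nearD; [exact: smooth_near_coord|exact: smooth_near_cst].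
  exact: smooth_nearM.
pose a := r ^+ 2 / 2; have a0 : 0 < a by rewrite divr_gt0// exprn_gt0.
have ab : a < r ^+ 2 by rewrite /a ltr_pdivrMr// ltr_pMr ?exprn_gt0// ltr1n.
pose num (x : V) : R^o := flat 0 (r ^+ 2 - s x).
pose den (x : V) : R^o := num x + flat 0 (s x - a).
have snum x : smooth_near x num.
  apply: smooth_near_flat; apply: smooth_nearD; first exact: smooth_near_cst.
  have : smooth_near x (fun y => cst (-1 : R^o) y * s y : R^o).
    by apply: smooth_nearM; [exact: smooth_near_cst|exact: ss].
  by apply: smooth_near_eq; near=> y; rewrite mulN1r.
have sden x : smooth_near x den.
  apply: smooth_nearD; first exact: snum.
  apply: smooth_near_flat; apply: smooth_nearD; first exact: ss.
  exact: smooth_near_cst.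
have den0 x : 0 < den x.
  have [sa|sa] := ltP (s x) (r ^+ 2).
    by rewrite ltr_pwDl ?flat_ge0// flat_gt0 subr_gt0.
  by rewrite ltr_pwDr ?flat_ge0// flat_gt0 subr_gt0 (lt_le_trans ab).
exists (fun x => num x * (den x)^-1); split.
- move=> x; apply: smooth_nearM; first exact: snum.
  by apply: smooth_nearV => //; rewrite gt_eqF.
- by move=> x; rewrite mulr_ge0 ?flat_ge0// invr_ge0 ltW.
- have : \forall x \near x0, s x < a.
    apply: (continuous_near_lt (smooth_near_continuous (ss x0))).
    by rewrite /s big1// => i _; rewrite subrr mul0r.
  move=> H; apply: (near_imply H) => x sxa;
    rewrite -[RHS](mulfV (lt0r_neq0 (den0 x))).
  by congr (_ * _); rewrite /den [flat 0 (s x - a)]flat_le0 ?addr0// subr_le0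
    ltW.
- move=> x; rewrite mulf_eq0 negb_or => /andP[+ _] i.
  rewrite /num; apply: contraR; rewrite -ltNge => ri.
  rewrite flat_le0// subr_le0 /s (bigD1 i)//= -expr2.
  have -> : (x ord0 i - x0 ord0 i) ^+ 2 = `|x ord0 i - x0 ord0 i| ^+ 2 by
    rewrite real_normK// num_real.
  apply: (@le_trans _ _ (`|x ord0 i - x0 ord0 i| ^+ 2)).
    by rewrite lerXn2r ?nnegrE ?(ltW r0)// ltW.
  by rewrite lerDl sumr_ge0// => j _; rewrite -expr2 sqr_ge0.
Unshelve. all: by end_near. Qed.

End Cutoff.

Section Extension.
Context {R : realType} {n : nat} {M : manifold R n}.
Implicit Types (p : M) (c d : chart R n M).
Notation V := 'rV[R]_n.

(** [K] is the closed cube of half-side [e / 2], inside the ball of radius [e] that the chart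
    covers. Its compactness is what extension by zero requires. *)
Lemma chart_cutoff c p (A : set M) : cdom c p -> nbhs p A ->
  exists chi : V -> R^o, exists K : set V,
  [/\ compact K, K `<=` cmap c @` (cdom c `&` A),
      (forall x, smooth_near x chi) /\ (forall x, 0 <= chi x),
      \forall x \near cmap c p, chi x = 1 & forall x, chi x != 0 -> K x].
Proof.
move=> cp pA; have := near_cmap_image cp pA => /nbhs_ballP[e /= e0 eA].
have r0 : 0 < e / 2 by rewrite divr_gt0.
have [chi [schi chi0 chi1 chiK]] := cutoff (cmap c p) r0.
exists chi, [set x : V | forall i, `[cmap c p ord0 i - e / 2,
  cmap c p ord0 i + e / 2]%classic (x ord0 i)].
split=> //.
- apply: (@rV_compact _ _ (fun i => `[cmap c p ord0 i - e / 2,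
    cmap c p ord0 i + e / 2]%classic)).
  by move=> i; exact: segment_compact.
- move=> x Kx; apply: eA; rewrite -ball_normE /=.
  apply: (@le_lt_trans _ _ (e / 2)); last by rewrite ltr_pdivrMr// ltr_pMr//
    ltr1n.
  apply: rV_norm_le => [|i]; first exact: ltW.
  by have := Kx i; rewrite /= in_itv /= !mxE distrC ler_distl.
- by move=> x /chiK cx i; rewrite /= in_itv /= -ler_distl cx.
Qed.

Definition extend c (phi : V -> R^o) p : R^o :=
  if `[< cdom c p >] then phi (cmap c p) else 0.

Lemma extendE c phi p : cdom c p -> extend c phi p = phi (cmap c p).
Proof. by move=> cp; rewrite /extend asboolT. Qed.

(** The image of [K] in the manifold is compact, hence closed because the manifold is Hausdorff. A
    point outside the chart therefore has a neighbourhood on which the extension is 0. *)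
Lemma smooth_extend c (phi : V -> R^o) (K : set V) : @atlas R n M c ->
  compact K -> K `<=` cmap c @` cdom c -> (forall x, phi x != 0 -> K x) ->
  (forall p, cdom c p -> smooth_near (cmap c p) phi) -> smooth (extend c phi).
Proof.
move=> ac cK Kc phiK sphi; apply/smoothP => p.
have [cp|cp] := pselect (cdom c p).
  apply: (smooth_at_chart ac cp); apply: smooth_near_eq (sphi p cp).
  have ip : (cmap c @` cdom c) (cmap c p) by exists p.
  have := open_nbhs_nbhs (conj (@cimg_open _ _ _ c) ip) => H.
  by apply: (near_imply H) => _ [q cq <-] /=; rewrite cmapK// extendE.
have cKM : closed (cinv c @` K).
  apply: compact_closed; first exact: manifold_hausdorff.
  apply: continuous_compact => //; apply: continuous_in_subspaceT => x.
  by rewrite inE => /Kc; exact: cinv_cont.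
have pK : (~` (cinv c @` K)) p.
  by move=> [x /Kc[q cq <-]]; rewrite cmapK// => qp; apply: cp; rewrite -qp.
have sc : smooth_at p (cst 0 : M -> R^o) by exact: ((smoothP _).1 (smooth_cst 0)
  p).
apply: smooth_at_eq sc.
have H := open_nbhs_nbhs (conj (closed_openC cKM) pK).
apply: (near_imply H) => q qK; rewrite /extend; case: asboolP => // cq.
apply/esym/eqP/negP => /negP/phiK Kq; apply: qK; exists (cmap c q) => //.
by rewrite cmapK.
Qed.

Lemma bump_function p (A : set M) : nbhs p A -> exists psi : Cinf M,
  [/\ forall q, 0 <= psi q :> R, \forall q \near p, psi q = 1 :> R &
      forall q, psi q != 0 :> R -> A q].
Proof.
move=> pA; have [c ac cp] := atlas_cover p.
have [chi [K [cK KA [schi chi0] chi1 chiK]]] := chart_cutoff cp pA.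
have Kc : K `<=` cmap c @` cdom c.
  by move=> x /KA[q [cq _] <-]; exists q.
have sE := smooth_extend ac cK Kc chiK (fun p _ => schi _).
exists (mkCinf sE); split=> /=.
- by move=> q; rewrite /extend; case: asboolP.
- have : \forall q \near p, chi (cmap c q) = 1 by exact: (cmap_cont cp chi1).
  have := open_nbhs_nbhs (conj (@cdom_open _ _ _ c) cp).
  by apply: filterS2 => q cq; rewrite extendE.
- move=> q; rewrite /extend; case: asboolP => [cq|_]; last by rewrite eqxx.
  by move=> /chiK/KA[q' [cq' Aq'] qq']; rewrite -(cmapK cq) -qq' cmapK.
Qed.

End Extension.

(** * Derivations at a point and coordinate frames *)

Section TangentVectors.
Context {R : realType} {n : nat} {M : manifold R n}.
Implicit Types (p : M) (c : chart R n M) (f g : Cinf M).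
Notation V := 'rV[R]_n.

HB.instance Definition _ p (v : tangent p) :=
  GRing.isLinear.Build R (Cinf M) R^o _ (tangent_fun v) (tangent_linear v).

HB.instance Definition _ p (a : cotangent p) :=
  GRing.isLinear.Build R (tangent p) R^o _ (cotangent_fun a) (cotangent_linear
    a).

Lemma tangent1 p (v : tangent p) : v (1 : Cinf M) = 0.
Proof.
have := tangentM v 1 1; rewrite mulr1 => /eqP.
by rewrite -subr_eq !mul1r subrr eq_sym => /eqP.
Qed.

Lemma tangentB p (v : tangent p) f g : v (f - g) = v f - v g.
Proof. exact: linearB. Qed.

Lemma tangentD p (v : tangent p) f g : v (f + g) = v f + v g.
Proof. exact: linearD. Qed.

Lemma tangentZ p (v : tangent p) a f : v (a *: f) = a * v f.
Proof. exact: linearZ. Qed.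

Lemma tangent0 p (v : tangent p) : v 0 = 0.
Proof. exact: linear0. Qed.

Lemma tangent_sum p (v : tangent p) (I : Type) (r : seq I) (P : pred I)
    (f : I -> Cinf M) : v (\sum_(i <- r | P i) f i) = \sum_(i <- r | P i) v (f
      i).
Proof. exact: linear_sum. Qed.

Lemma cotangentB p (a : cotangent p) (u v : tangent p) : a (u - v) = a u - a v.
Proof. exact: linearB. Qed.

Lemma cotangentD p (a : cotangent p) (u v : tangent p) : a (u + v) = a u + a v.
Proof. exact: linearD. Qed.

Lemma cotangentZ p (a : cotangent p) (r : R) (v : tangent p) : a (r *: v) = r *
  a v.
Proof. exact: linearZ. Qed.

Lemma tangent_sumE p (I : Type) (r : seq I) (P : pred I) (a : I -> R)
    (v : I -> tangent p) f :
  (\sum_(i <- r | P i) a i *: v i) f = \sum_(i <- r | P i) a i * v i f.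
Proof. by elim/big_rec2: _ => //= i _ w _ <-. Qed.

(** A bump function supported where [f] and [g] agree multiplies [f - g] to 0, and the Leibniz rule
    at [p] then leaves [v (f - g) = 0]. *)
Lemma tangent_local p (v : tangent p) f g :
  (\forall q \near p, f q = g q :> R) -> v f = v g.
Proof.
move=> fg; have [psi [_ /nbhs_singleton psi1 psi0]] := bump_function fg.
apply/eqP; rewrite -subr_eq0 -tangentB.
have : psi * (f - g) = 0.
  apply/val_inj/funext => q /=; rewrite -[LHS]/(psi q * (f q - g q)).
  case: (eqVneq (psi q : R) 0) => [->|/psi0 ->]; first by rewrite mul0r.
  by rewrite subrr mulr0.
move/(congr1 v); rewrite tangentM tangent0 psi1 mul1r.
have -> : (f - g) p = 0 by rewrite -[LHS]/(f p - g p) (nbhs_singleton fg) subrr.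
by rewrite mul0r addr0 => ->.
Qed.

Definition partial_fun c (chi : V -> R^o) i p f : R^o :=
  extend c (fun x => chi x * 'D_(delta_mx ord0 i) (f \o cinv c) x) p.

Lemma partial_derivation c chi i p : @atlas R n M c ->
  partial_fun c chi i p \in derivation_pred p.
Proof.
move=> ac; apply/asboolP.
have [cp|cp] := pselect (cdom c p); last first.
  by split=> [a f g|f g]; rewrite /partial_fun /extend asboolF// ?scaler0 ?mulr0
    addr0.
have df f v : derivable (f \o cinv c) (cmap c p) v.
  apply: diff_derivable; apply: smooth_near_differentiable.
  exact: ((smoothP _).1 (Cinf_smooth f) p).
split=> [a f g|f g]; rewrite /partial_fun !extendE//.
  have -> : (a *: f + g) \o cinv c = a *: (f \o cinv c) + (g \o cinv c) by [].
  rewrite deriveD//; last exact: derivableZ.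
  rewrite deriveZ// mulrDr /GRing.scale /=; congr (_ + _); exact: mulrCA.
have -> : (f * g) \o cinv c = (f \o cinv c) * (g \o cinv c) by [].
by rewrite deriveM// /= cmapK// /GRing.scale /=; ring.
Qed.

(** The coordinates and their partial derivatives are multiplied by a cutoff to become global, so
    the identities hold only where the cutoff is locally 1. That the [E i] span all derivations is
    Hadamard's lemma. *)
Lemma coordinate_frame p0 : exists (c : chart R n M) (x : 'I_n -> Cinf M)
    (E : 'I_n -> vfield M), [/\ @atlas R n M c, cdom c p0 &
  \forall p \near p0, [/\ forall i j, E i p (x j) = (i == j)%:R,
    forall v : tangent p, v = \sum_i v (x i) *: E i p &
    forall i f, E i p f = 'D_(delta_mx ord0 i) (f \o cinv c) (cmap c p)]].
Proof.
have [c ac cp0] := atlas_cover p0.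
have [chi [K [cK KA [schi chi0] chi1 chiK]]] := chart_cutoff cp0 filterT.
have Kc : K `<=` cmap c @` cdom c by move=> x /KA[q [cq _] <-]; exists q.
have chiM (phi : V -> R^o) : (forall x, chi x * phi x != 0 -> K x).
  by move=> x; rewrite mulf_eq0 negb_or => /andP[/chiK].
have sx i : smooth (extend c (fun y => chi y * y ord0 i : R^o)).
  apply: (smooth_extend ac cK Kc (chiM (fun y => y ord0 i))) => p cp.
  by apply: smooth_nearM; [exact: schi|exact: smooth_near_coord].
pose Ev i p := MkTangent (@partial_derivation c chi i p ac).
have sE i f : smooth (fun p => Ev i p f).
  apply: (smooth_extend ac cK Kc
    (chiM (fun y => 'D_(delta_mx ord0 i) (f \o cinv c) y))) => p cp.
  apply: smooth_nearM; first exact: schi.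
  apply: smooth_near_derive; exact: ((smoothP _).1 (Cinf_smooth f) p).
pose x i := mkCinf (sx i); pose E i := MkVfield (sE i).
exists c, x, E; split=> //.
(* The nested neighbourhoods give [chi = 1] around each nearby point, so that derivatives there do
   not see the cutoff. *)
have near1 : \forall y \near cmap c p0, \forall z \near y, chi z = 1.
  exact: nbhs_interior.
have cdp : \forall p \near p0, cdom c p by exact: open_nbhs_nbhs (conj
  (@cdom_open _ _ _ c) cp0).
have chi1M : \forall p \near p0, \forall z \near cmap c p, chi z = 1.
  exact: (cmap_cont cp0 near1).
have H0 : \forall p \near p0, cdom c p /\ \forall z \near cmap c p, chi z = 1.
  exact: (near_and cdp chi1M).
apply: (near_imply H0) => p [cp chi1p].
have EE i f : E i p f = 'D_(delta_mx ord0 i) (f \o cinv c) (cmap c p).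
  rewrite -[LHS]/(partial_fun c chi i p f) /partial_fun extendE//.
  by rewrite (nbhs_singleton chi1p) mul1r.
have xE i : \forall y \near cmap c p,
      (fun y : V => y ord0 i : R^o) y = (x i \o cinv c) y.
  have H := near_cmap_image cp (@filterT _ _ (nbhs_filter p)).
  have H1 := near_and H chi1p.
  apply: (near_imply H1) => y [[q [cq _] <-] chiy].
  rewrite /= cmapK// extendE// chiy. by rewrite mul1r.
split=> // [i j|v].
  rewrite EE -(near_eq_derive _ (xE j)).
  rewrite (@derive_coord _ _ _ id); last exact: ex_diff.
  by rewrite derive_id mxE eqxx eq_sym.
apply/val_inj/funext => f; rewrite [RHS]tangent_sumE.
(* [hadamard] asks for smoothness on the whole space, hence the cutoff in [F]. *)
pose F (y : V) : R^o := chi y * f (cinv c y).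
pose x1 := cmap c p.
have sF : smooth_on setT F.
  apply: smooth_on_near => y _; have [cy|cy] := pselect ((cmap c @` cdom c) y).
    apply: smooth_nearM; first exact: schi.
    by case: cy => q cq <-; exact: ((smoothP _).1 (Cinf_smooth f) q).
  have oK : open (~` K).
    by apply: closed_openC; apply: compact_closed => //; exact: norm_hausdorff.
  apply: smooth_near_eq (smooth_near_cst y 0).
  apply: (near_imply (open_nbhs_nbhs (conj oK (_ : (~` K) y)))) => [/Kc//|z Kz].
  rewrite /F; suff -> : chi z = 0 by rewrite mul0r.
  by apply/eqP; apply: contra_notT Kz => /chiK.
have FE : \forall y \near x1, F y = (f \o cinv c) y.
  by apply: (near_imply chi1p) => y chiy; rewrite /F chiy mul1r.
have [g sg Fg] := hadamard x1 sF.
have sG i : smooth (extend c (fun y => chi y * g i y : R^o)).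
  apply: (smooth_extend ac cK Kc (chiM (g i))) => q cq.
  apply: smooth_nearM; first exact: schi.
  by exists setT; [split=> //; exact: openT|have [] := sg i].
pose G i := mkCinf (sG i); pose x0 i := x i - x1 ord0 i *: (1 : Cinf M).
(* Hadamard's formula written with global functions, so that [v] applies to it. Since [x0 i]
   vanishes at [p], the Leibniz rule keeps only [v (x i) * G i p]. *)
have fE : \forall q \near p, f q = (f p *: (1 : Cinf M) + \sum_i x0 i * G i) q
  :> R.
  have H : \forall q \near p, chi (cmap c q) = 1 by exact: (cmap_cont cp chi1p).
  have cdp' : \forall q \near p, cdom c q.
    exact: open_nbhs_nbhs (conj (@cdom_open _ _ _ c) cp).
  apply: (near_imply (near_and H cdp')) => q [chiq cq].
  have -> : f q = F (cmap c q) by rewrite /F chiq mul1r cmapK.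
  have F1 : F x1 = f p by rewrite (nbhs_singleton FE) /= cmapK.
  have eval_sum (I : Type) (r : seq I) (h : I -> Cinf M) :
      (\sum_(i <- r) h i) q = \sum_(i <- r) h i q :> R.
    by elim/big_rec2: _ => //= i _ w _ <-.
  rewrite -[RHS]/(f p * 1 + (\sum_i x0 i * G i) q) eval_sum mulr1 Fg F1.
  congr (_ + _); apply: eq_bigr => i _.
  rewrite -[RHS]/((x i q - x1 ord0 i * 1) * G i q) /= !extendE// chiq !mul1r.
  by rewrite !mxE mulr1.
rewrite -[LHS]/(v f) (tangent_local v fE) tangentD tangentZ tangent1 mulr0 add0r
  tangent_sum.
apply: eq_bigr => i _; rewrite tangentM tangentB tangentZ tangent1 mulr0 subr0.
have -> : x0 i p = 0.
  rewrite -[LHS]/(x i p - x1 ord0 i * 1) /= extendE// (nbhs_singleton chi1p).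
  by rewrite mul1r mulr1 subrr.
rewrite mul0r add0r mulrC EE -(near_eq_derive _ FE); congr (_ * _).
by rewrite -(sg i).2 /= extendE// (nbhs_singleton chi1p) mul1r.
Qed.

End TangentVectors.

(** * Alternating forms, determinants and pfaffians *)

Section Alternating.
Context {R : comNzRingType}.

Definition upd (I : eqType) (V : Type) (v : I -> V) (i : I) (x : V) : I -> V :=
  fun j => if j == i then x else v j.

Definition alternating_form (V : lmodType R) n (w : ('I_n -> V) ->
  R^o) : Prop :=
  (forall v i, linear (fun x => w (upd v i (x)))) /\
  (forall v i j, i != j -> v i = v j -> w v = 0).

Section Form.
Context {V : lmodType R} {n : nat} (w : ('I_n -> V) -> R^o).
Hypothesis altw : alternating_form w.
Implicit Types (v : 'I_n -> V).

Lemma upd_id v i : (upd v i (v i)) = v.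
Proof. by apply/funext => j; rewrite /upd /=; case: eqP => [->|]. Qed.

Lemma alternating_comb v i (I : Type) (r : seq I) (P : pred I) (a : I -> R)
    (x : I -> V) :
  w (upd v i (\sum_(j <- r | P j) a j *: x j)) =
  \sum_(j <- r | P j) a j * w (upd v i (x j)).
Proof.
have lw := altw.1 v i.
elim/big_rec2: _ => [|j y z Pj <-]; last exact: lw.
by have := lw (-1) 0 0; rewrite scaler0 addr0 scaleN1r addNr.
Qed.

Lemma alternatingD v i x y :
  w (upd v i (x + y)) = w (upd v i (x)) + w (upd v i (y)).
Proof. by have := altw.1 v i 1 x y; rewrite !scale1r. Qed.

Lemma alternating_swap v a b : a != b -> w (v \o tperm a b) = - w v.
Proof.
move=> ab; pose u x y := (upd (upd v a x) b y).
have uD1 x y z : w (u (x + y) z) = w (u x z) + w (u y z).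
  have uC s t : u s t = (upd (upd v b t) a s).
    apply/funext => j; rewrite /u /upd /=; case: (eqVneq j b) => [->|//].
    by rewrite eq_sym (negbTE ab).
  by rewrite !uC alternatingD.
have uD2 x y z : w (u x (y + z)) = w (u x y) + w (u x z) by exact: alternatingD.
have u0 x : w (u x x) = 0.
  by apply: (altw.2 _ a b ab); rewrite /u /upd !eqxx (negbTE ab).
have := u0 (v a + v b); rewrite uD1 !uD2 !u0 add0r addr0 => /eqP.
rewrite addrC addr_eq0 => /eqP.
have -> : u (v a) (v b) = v by apply/funext => j; rewrite /u /upd;
  do 2!case: eqP => [->|_] //.
move=> <-; congr w; apply/funext => j; rewrite /u /=.
case: tpermP => [->|->|/eqP/negbTE ja /eqP/negbTE jb]; rewrite /upd.
- by rewrite (negbTE ab) eqxx.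
- by rewrite eqxx.
- by rewrite ja jb.
Qed.

(** Restricting to vanishing avoids tracking the sign of the permutation. *)
Lemma alternating_perm v (s : 'S_n) : w v = 0 -> w (v \o s) = 0.
Proof.
have [ts -> _] := prod_tpermP s; elim: ts v => [|[a b] ts IH] v v0.
  by rewrite big_nil -v0; congr w; apply/funext => j; rewrite /= perm1.
rewrite big_cons; set t := (\prod_(i <- ts) _)%g.
have -> : v \o (tperm a b * t)%g = (v \o t) \o tperm a b.
  by apply/funext => j; rewrite /= permM.
rewrite /=; case: (eqVneq a b) => [->|ab].
  rewrite tperm1 -(IH _ v0); congr w; apply/funext => j.
  by rewrite /= perm1.
by rewrite alternating_swap// (IH _ v0) oppr0.
Qed.

(** The list [s] contains the positions not yet known to hold a vector of [e]; expanding them one by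
    one leaves families taken from [e], which either repeat a vector or permute [e]. *)
Lemma alternating_eq0 (e : 'I_n -> V) :
  (forall x, exists c : 'I_n -> R, x = \sum_i c i *: e i) ->
  w e = 0 -> forall v, w v = 0.
Proof.
move=> span e0 v.
suff H (s : seq 'I_n) u : (forall j, j \notin s -> exists i, u j = e i) ->
  w u = 0.
  by apply: (H (enum 'I_n)) => j; rewrite mem_enum.
elim: s u => [|j s IH] u us.
  have /choice[f uf] : forall j, exists i, u j = e i by move=> j; exact: us.
  have [/injectiveP finj|/injectivePn[i [j ij fij]]] := boolP (injectiveb f).
    rewrite (_ : u = e \o perm finj); first exact: alternating_perm.
    by apply/funext => j; rewrite /= permE uf.
  by apply: altw.2 ij _; rewrite !uf fij.
have [c uj] := span (u j).
rewrite -(upd_id u j) uj alternating_comb big1// => i _.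
rewrite IH ?mulr0// => k ks; rewrite /upd; case: eqP => [_|/eqP kj];
  first by exists i.
by apply: us; rewrite inE negb_or kj.
Qed.

End Form.

Lemma alternating_det n : alternating_form (fun v : 'I_n -> 'rV[R]_n =>
  \det (\matrix_i v i) : R^o).
Proof.
split=> [v i c x y|v i j ij vij]; last first.
  by apply: (determinant_alternate ij) => k; rewrite !mxE vij.
rewrite -[X in _ = _ + X]mul1r; apply: (determinant_multilinear (i0 := i)).
- by apply/rowP => k; rewrite !mxE /upd eqxx !mxE mul1r.
- by apply/matrixP => j k; rewrite !mxE /upd eq_sym (negbTE (neq_lift _ _)).
- by apply/matrixP => j k; rewrite !mxE /upd eq_sym (negbTE (neq_lift _ _)).
Qed.

(** After pulling [w] back to rows along [sp], its difference with the determinant times [w e] is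
    alternating and vanishes on the standard basis, hence everywhere. The family [e] may be
    arbitrary. *)
Lemma alternating_detE (V : lmodType R) n (w : ('I_n -> V) -> R^o)
    (e : 'I_n -> V) (A : 'M[R]_n) : alternating_form w ->
  w (fun j => \sum_i A j i *: e i) = \det A * w e.
Proof.
move=> altw; pose sp (r : 'rV[R]_n) : V := \sum_i r ord0 i *: e i.
have spl : linear sp.
  move=> c x y; rewrite /sp scaler_sumr -big_split; apply: eq_bigr => i _ /=.
  by rewrite !mxE scalerDl scalerA.
have spe v i x : sp \o (upd v i (x)) = upd (sp \o v) i (sp x).
  by apply/funext => j; rewrite /upd /=; case: eqP.
pose w' (v : 'I_n -> 'rV[R]_n) : R^o := w (sp \o v) - \det (\matrix_i v i) * w
  e.
have altw' : alternating_form w'.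
  have [detl det0] := @alternating_det n.
  split=> [v i c x y|v i j ij vij].
    rewrite /w' !spe spl (altw.1 _ _ c) detl /GRing.scale /=.
    by rewrite mulrDl mulrBr opprD addrACA mulrA.
  by rewrite /w' (altw.2 _ i j)//= ?vij// (det0 _ i j)// mul0r subrr.
have w'e : w' (fun i => delta_mx ord0 i) = 0.
  rewrite /w' (_ : \matrix_i _ = 1%:M); last first.
    by apply/matrixP => i j; rewrite !mxE eqxx eq_sym.
  rewrite det1 mul1r; apply/eqP; rewrite subr_eq0; apply/eqP; congr w.
  apply/funext => i; rewrite /= /sp (bigD1 i)//= big1 => [|j ji].
    by rewrite mxE !eqxx scale1r addr0.
  by rewrite mxE (negbTE ji) andbF scale0r.
have span (x : 'rV[R]_n) : exists c : 'I_n ->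
  R, x = \sum_i c i *: delta_mx ord0 i.
  by exists (x ord0); exact: row_sum_delta.
have /eqP := alternating_eq0 altw' span w'e (fun j => row j A).
rewrite /w' subr_eq0 (_ : \matrix_i _ = A); last by apply/matrixP => i j;
  rewrite !mxE.
move/eqP <-; congr w; apply/funext => j; rewrite /= /sp.
by apply: eq_bigr => i _; rewrite mxE.
Qed.

End Alternating.

(** Expanded along its replaced row, the i-th determinant has the cofactors of [A], so it is the
    i-th diagonal entry of the product. *)
Lemma det_replace_rows (R : comNzRingType) n (A D : 'M[R]_n) :
  \sum_i \det (\matrix_(k, j) if k == i then D k j else A k j) =
  \tr (D *m \adj A).
Proof.
apply: eq_bigr => i _; rewrite (expand_det_row _ i) !mxE.
apply: eq_bigr => j _; rewrite !mxE eqxx; congr (_ * _).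
rewrite /cofactor; congr (_ * \det _); apply/matrixP => k l.
by rewrite !mxE eq_sym (negbTE (neq_lift _ _)).
Qed.

Section DerivationDet.
Context {R : comNzRingType} {S : comPzRingType} (e : {rmorphism S -> R}).
Variable v : S -> R.
Hypothesis vD : forall f g, v (f + g) = v f + v g.
Hypothesis vM : forall f g, v (f * g) = e f * v g + e g * v f.

Let v0 : v 0 = 0.
Proof. by have /eqP := vD 0 0; rewrite addr0 -subr_eq subrr eq_sym => /eqP. Qed.

Let vN f : v (- f) = - v f.
Proof. by apply/eqP; rewrite eq_sym -subr_eq0 -opprD oppr_eq0 -vD addrN v0. Qed.

Let v1 : v 1 = 0.
Proof.
have := vM 1 1; rewrite mulr1 rmorph1 mul1r => /eqP.
by rewrite -subr_eq subrr eq_sym => /eqP.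
Qed.

Lemma derivation_prod (I : eqType) (r : seq I) (F : I -> S) : uniq r ->
  v (\prod_(i <- r) F i) = \sum_(i <- r) v (F i) * \prod_(j <- r | j != i) e (F
    j).
Proof.
elim: r => [|a r IH] /=; first by rewrite !big_nil v1.
move=> /andP[ar ur]; rewrite !big_cons vM eqxx /= IH// addrC rmorph_prod.
rewrite [_ * v _]mulrC; congr (_ * _ + _).
  rewrite big_seq [RHS]big_seq_cond; apply: eq_bigl => i.
  by case: (boolP (i \in r)) => //= ir; apply/esym; apply: contraNneq ar => <-.
rewrite mulr_sumr; apply: eq_big_seq => i ir.
rewrite big_cons; case: eqP => [ai|_] /=; first by rewrite ai ir in ar.
by rewrite mulrCA.
Qed.

Lemma derivation_det n (A : 'M[S]_n) :
  v (\det A) = \tr (map_mx v A *m \adj (map_mx e A)).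
Proof.
have vsum (I : Type) (r : seq I) (F : I -> S) :
    v (\sum_(i <- r) F i) = \sum_(i <- r) v (F i).
  by elim/big_rec2: _ => // i x y _ <-; exact: vD.
rewrite -det_replace_rows.
rewrite /determinant vsum exchange_big /=; apply: eq_bigr => s _.
rewrite -mulr_sumr; transitivity ((-1) ^+ s * v (\prod_i A i (s i))).
  by rewrite !mulr_sign; case: (odd_perm s); rewrite ?vN.
congr (_ * _); rewrite derivation_prod ?index_enum_uniq//.
apply: eq_bigr => i _; rewrite [RHS](bigD1 i)//= !mxE eqxx; congr (_ * _).
by apply: eq_bigr => j ji; rewrite !mxE (negbTE ji).
Qed.

(** By Jacobi's formula and cyclicity of the trace, each of the two summands contributes the trace
    of [C] times the determinant. *)
Lemma derivation_det_congruence n (A : 'M[S]_n) (C : 'M[R]_n) :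
    map_mx v A = C *m map_mx e A + map_mx e A *m C^T ->
  v (\det A) = (\tr C * \det (map_mx e A)) *+ 2.
Proof.
move=> vA; rewrite derivation_det vA mulmxDl mxtraceD -mulmxA mul_mx_adj.
rewrite [\tr (_ *m C^T *m _)]mxtrace_mulC mulmxA mul_adj_mx.
by rewrite mul_mx_scalar mul_scalar_mx !mxtraceZ mxtrace_tr mulr2n mulrC.
Qed.

End DerivationDet.

(** * Pfaffians: congruence and nonvanishing on invertible skew matrices *)

Section Pfaffian.
Context {R : realFieldType} {m k : nat}.
(* The positions [c false i] and [c true i] are matched together. *)
Variables (c : bool -> 'I_k -> 'I_m) (h : 'I_m -> bool * 'I_k).
Hypothesis cK : forall s i, h (c s i) = (s, i).
Hypothesis hK : forall x, c (h x).1 (h x).2 = x.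

(* Every perfect matching is counted [2 ^ k * k!] times. *)
Definition pfaffian (B : 'M[R]_m) : R :=
  \sum_(s : 'S_m) (-1) ^+ s * \prod_i B (s (c false i)) (s (c true i)).

Definition std_symplectic : 'M[R]_m := \matrix_(x, y)
  if ((h x).2 == (h y).2) && ((h x).1 != (h y).1) then (-1) ^+ (h x).1 else 0.

Let bil (B : 'M[R]_m) (x y : 'rV[R]_m) : R := (x *m B *m y^T) 0 0.

Let bilDl B a x x' y : bil B (a *: x + x') y = a * bil B x y + bil B x' y.
Proof. by rewrite /bil !mulmxDl -!scalemxAl !mxE. Qed.

Let bilDr B a x y y' : bil B x (a *: y + y') = a * bil B x y + bil B x y'.
Proof. by rewrite /bil linearP /= mulmxDr -scalemxAr !mxE. Qed.

(** This is the pfaffian of S B S^T as a function of the rows of S; once it is alternating,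
    [alternating_detE] gives the congruence rule. Linearity holds because each position occurs in
    exactly one factor of each product. *)
Lemma pfaffian_alternating B : alternating_form (fun v : 'I_m -> 'rV[R]_m =>
  \sum_(s : 'S_m) (-1) ^+ s * \prod_i bil B (v (s (c false i))) (v (s (c true
    i))) : R^o).
Proof.
split=> [v j a x y|v i j ij vij].
  rewrite scaler_sumr -big_split; apply: eq_bigr => s _ /=.
  rewrite -[_ *: (_ * _)]/(a * _) mulrCA -mulrDr; congr (_ * _).
  pose l := h (s^-1%g j); have jE : j = s (c l.1 l.2) by rewrite hK permKV.
  rewrite (bigD1 l.2)//= [X in _ = _ * X + _](bigD1 l.2)//=.
  rewrite [X in _ = _ + X](bigD1 l.2)//= [a * _]mulrA.
  have E z i : i != l.2 ->
      bil B (upd v j z (s (c false i))) (upd v j z (s (c true i))) =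
      bil B (v (s (c false i))) (v (s (c true i))).
    move=> il; suff E t : upd v j z (s (c t i)) = v (s (c t i)) by rewrite !E.
    rewrite /upd; case: eqP => // /esym; rewrite jE => /perm_inj/(congr1 h).
    by rewrite !cK => -[_ li]; rewrite li eqxx in il.
  rewrite (eq_bigr _ (E _)) [in X in _ = _ * X + _](eq_bigr _ (E _)).
  rewrite [in X in _ = _ + _ * X](eq_bigr _ (E _)) -mulrDl; congr (_ * _).
  have neq : c l.1 l.2 != c (~~ l.1) l.2.
    by apply/eqP => /(congr1 h); rewrite !cK => -[]; case: (l.1).
  have U1 z : upd v j z (s (c l.1 l.2)) = z by rewrite /upd jE eqxx.
  have U2 z : upd v j z (s (c (~~ l.1) l.2)) = v (s (c (~~ l.1) l.2)).
    by rewrite /upd jE (inj_eq perm_inj) eq_sym (negbTE neq).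
  by move: U1 U2; case: (l.1) => /= U1 U2; rewrite !U1 !U2 (bilDl, bilDr).
(* The sum equals its opposite: composing with the transposition of [i] and [j] flips each sign and,
   as [v i = v j], preserves each product. *)
apply/eqP; rewrite -eqNr; apply/eqP.
rewrite [RHS](reindex_inj (mulIg (tperm i j))) /= -sumrN.
apply: eq_bigr => s _; rewrite odd_permM odd_tperm ij addbT signrN mulNr.
congr (- (_ * _)); apply: eq_bigr => l _.
have vt x : v (tperm i j x) = v x by case: tpermP => [->|->|].
by rewrite !permM !vt.
Qed.

Lemma pfaffian_congruence (S B : 'M[R]_m) :
  pfaffian (S *m B *m S^T) = \det S * pfaffian B.
Proof.
have bilE (T : 'M[R]_m) x y : bil B (row x T) (row y T) = (T *m B *m T^T) x y.
  by rewrite /bil -row_mul !mxE; apply: eq_bigr => j _; rewrite !mxE.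
have Srow (T : 'M[R]_m) j : \sum_i T j i *: delta_mx 0 i = row j T.
  by rewrite [RHS]row_sum_delta; apply: eq_bigr => i _; rewrite mxE.
have := alternating_detE (fun i => delta_mx 0 i) S (pfaffian_alternating B).
under [in LHS]eq_bigr => s _ do under eq_bigr => i _ do rewrite !Srow bilE.
move=> H; apply: (etrans H); congr (_ * _); apply: eq_bigr => s _;
  congr (_ * _).
apply: eq_bigr => i _; have := bilE 1%:M (s (c false i)) (s (c true i)).
by rewrite !row1 trmx1 mulmx1 mul1mx.
Qed.

Definition doubled (l : 'I_k -> 'I_k) x := c (h x).1 (l (h x).2).

Lemma doubled_inj (l : 'S_k) : injective (doubled l).
Proof.
move=> x y /(congr1 h); rewrite !cK => -[xy1 /perm_inj xy2].
by rewrite -(hK x) xy1 xy2 hK.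
Qed.

(** Exchanging two pairs is a product of two transpositions, hence even. *)
Lemma odd_doubled (l : 'S_k) : odd_perm (perm (@doubled_inj l)) = false.
Proof.
have [ts lE _] := prod_tpermP l.
have -> : perm (@doubled_inj l) = (\prod_(t <- ts)
    (tperm (c false t.1) (c false t.2) * tperm (c true t.1) (c true t.2)))%g.
  rewrite {}lE; apply/permP => x; rewrite permE.
  elim: ts x => [|[a b] ts IH] x.
    by rewrite !big_nil /doubled !perm1 hK.
  rewrite !big_cons !permM /= -IH /doubled permM.
  have cinj s : injective (c s) by move=> i j /(congr1 h); rewrite !cK => -[].
  have E s i : tperm (c true a) (c true b) (tperm (c false a) (c false b) (c s
    i))
      = c s (tperm a b i).
    have D j j' b' : c b' j != c (~~ b') j'.
      by apply/eqP => /(congr1 h); rewrite !cK => -[]; case: b'.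
    case: s; first by rewrite [tperm (c false a) _ _]tpermD ?(D _ _ false)//
      inj_tperm.
    by rewrite -inj_tperm// tpermD// (D _ _ true).
  by rewrite -[x in RHS]hK E cK.
elim: ts {lE} => [|[a b] ts IH]; first by rewrite big_nil odd_perm1.
rewrite big_cons !odd_permM IH addbF !odd_tperm /=.
have neq s : (c s a != c s b) = (a != b).
  by congr (~~ _); apply: inj_eq => i j /(congr1 h); rewrite !cK => -[].
by rewrite !neq addbb.
Qed.

Local Notation J := std_symplectic.

Lemma std_symplectic_skew x y : J y x = - J x y.
Proof.
rewrite !mxE [(h y).2 == _]eq_sym [(h y).1 == _]eq_sym;
  case: ifP => [/andP[_]|_]; last by rewrite oppr0.
by case: (h x).1; case: (h y).1 => // _; rewrite expr0 expr1 ?opprK.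
Qed.

Lemma std_symplectic_neq0 x y : J x y != 0 ->
  (h x).2 = (h y).2 /\ (h x).1 = ~~ (h y).1.
Proof.
rewrite mxE; case: ifP => [/andP[/eqP-> xy] _|]; last by rewrite eqxx.
by split=> //; case: (h x).1 xy; case: (h y).1.
Qed.

(** Unless a factor is 0, [s] sends pairs to pairs. Reversing one pair changes both the sign of [s]
    and the sign of one entry, so the term is unchanged; the induction is on the number of reversed
    pairs. With none left, [s] is a doubled permutation, which is even, and all entries are 1. *)
Lemma std_symplectic_term_ge0 (s : 'S_m) :
  0 <= (-1) ^+ s * \prod_i J (s (c false i)) (s (c true i)).
Proof.
have [r] := ubnP #|[pred i | (h (s (c false i))).1]|.
elim: r s => // r IH s; rewrite ltnS => sr.
have [/forallP J0|] := boolP [forall i, J (s (c false i)) (s (c true i)) != 0];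
  last first.
  by rewrite negb_forall => /existsP[i /negPn/eqP i0];
    rewrite (bigD1 i)//= i0 mul0r mulr0.
have {}J0 i := std_symplectic_neq0 (J0 i).
have [i0 i0s|s0] := pickP [pred i | (h (s (c false i))).1].
  pose t := (tperm (c false i0) (c true i0))%g.
  have cft : c false i0 != c true i0 by apply/eqP => /(congr1 h); rewrite !cK.
  have tE b i : i != i0 -> t (c b i) = c b i.
    move=> ii0; rewrite /t tpermD//; apply: contraNneq ii0 => /(congr1 h);
    by rewrite !cK => -[_ ->].
  have E : (-1) ^+ (t * s)%g * \prod_i J ((t * s)%g (c false i)) ((t * s)%g (c
    true i)) =
      (-1) ^+ s * \prod_i J (s (c false i)) (s (c true i)) :> R.
    rewrite odd_permM odd_tperm cft /= signrN mulNr -mulrN; congr (_ * _).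
    rewrite (bigD1 i0)//= [RHS](bigD1 i0)//= !permM tpermL tpermR.
    rewrite std_symplectic_skew mulNr opprK; congr (_ * _).
    by apply: eq_bigr => i ii0; rewrite !permM !tE.
  rewrite -E; apply: IH; apply: leq_trans sr; apply: proper_card.
  apply/properP; split.
    apply/fintype.subsetP => i; rewrite !inE permM;
      case: (eqVneq i i0) => [->//|ii0].
    by rewrite tE.
  exists i0; first exact: i0s.
  rewrite inE permM tpermL; have [_] := J0 i0; move: i0s => /= ->.
  by case: (h _).1.
pose l i := (h (s (c false i))).2.
have sE b i : s (c b i) = c b (l i).
  have [Ji1 Ji2] := J0 i; have := s0 i; rewrite /= in Ji2 * => si0.
  case: b; rewrite -[LHS]hK; last by rewrite si0.
  by rewrite -Ji1; congr (c _ _); move: Ji2; rewrite si0; case: (h _).1.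
have linj : injective l.
  move=> i j ij; have /(congr1 h) : c false i = c false j.
    by apply: (@perm_inj _ s); rewrite !sE ij.
  by rewrite !cK => -[].
rewrite (_ : s = perm (@doubled_inj (perm linj))); last first.
  by apply/permP => x; rewrite permE /doubled permE -{1}(hK x) sE.
rewrite odd_doubled mul1r prodr_ge0// => i _.
by rewrite !permE /doubled !cK mxE !cK eqxx.
Qed.

Lemma pfaffian_std_gt0 : 0 < pfaffian J.
Proof.
rewrite /pfaffian (bigD1 1%g)//= ltr_pwDl//; last first.
  by apply: sumr_ge0 => s _; exact: std_symplectic_term_ge0.
rewrite odd_perm1 mul1r prodr_gt0// => i _.
by rewrite !perm1 mxE !cK eqxx.
Qed.

(** A symplectic basis, built one pair at a time, gives S B S^T = J, so the positive pfaffian of J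
    is the determinant of S times that of B. *)
Lemma pfaffian_neq0 (B : 'M[R]_m) : B^T = - B -> B \in unitmx ->
  pfaffian B != 0.
Proof.
move=> skB uB; have bilN x y : bil B y x = - bil B x y.
  rewrite /bil (_ : y *m B *m x^T = (x *m B^T *m y^T)^T).
    by rewrite skB mulmxN mulNmx !mxE.
  by rewrite !trmx_mul !trmxK mulmxA.
have bil0 x : bil B x x = 0 by apply/eqP; rewrite -eqNr -bilN.
have mk : m = (k + k)%N.
  have : bijective h by exists (fun y => c y.1 y.2) => [x|[s i]];
    rewrite ?hK ?cK.
  by move/bij_eq_card; rewrite card_prod card_bool !card_ord mul2n addnn.
have bil_suml (I : Type) (r : seq I) (a : I -> R) (x : I -> 'rV[R]_m) y :
    bil B (\sum_(i <- r) a i *: x i) y = \sum_(i <- r) a i * bil B (x i) y.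
  elim/big_rec2: _ => [|i z w _ <-]; last exact: bilDl.
  by rewrite /bil !mul0mx mxE.
have [u uB'] : exists u : bool -> 'I_k -> 'rV[R]_m, forall s t i j,
    bil B (u s i) (u t j) = if (i == j) && (s != t) then (-1) ^+ s else 0.
  suff H j : (j <= k)%N -> exists u : bool -> 'I_j -> 'rV[R]_m, forall s t i l,
      bil B (u s i) (u t l) = if (i == l) && (s != t) then (-1) ^+ s else 0.
    exact: H.
  elim: j => [|j IH] jk; first by exists (fun _ _ => 0) => s t [].
  have [u uE] := IH (ltnW jk).
  pose N b : 'M[R]_(m, j) := \matrix_(x, i) (B *m (u b i)^T) x 0.
  (* Orthogonality to the [j] pairs already found imposes 2 j < m linear conditions, so a nonzero
     [x] satisfies them. *)
  have /rowV0Pn[x] : kermx (row_mx (N false) (N true)) != 0.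
    rewrite -mxrank_eq0 mxrank_ker subn_eq0 -ltnNge (leq_ltn_trans (rank_leq_col
      _))//.
    by rewrite mk -addnS leq_add// ltnW.
  rewrite sub_kermx mul_mx_row row_mx_eq0 => /andP[/eqP x0 /eqP x1] xn0.
  have xu b i : bil B x (u b i) = 0.
    have : (x *m N b) 0 i = 0 by case: b; rewrite (x0, x1) mxE.
    by rewrite /bil -mulmxA mxE => <-; rewrite mxE; apply: eq_bigr => l _;
      rewrite [in RHS]mxE.
  have [l xl] : exists l, (x *m B) 0 l != 0.
    apply/existsP; apply: contraR xn0; rewrite negb_exists => /forallP xB0.
    have : x *m B = 0 by apply/rowP => l; rewrite [RHS]mxE; apply/eqP;
      rewrite -[_ == _]negbK.
    by move/(congr1 (mulmx^~ (invmx B))); rewrite mulmxK// mul0mx => ->.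
  pose y0 : 'rV[R]_m := ((x *m B) 0 l)^-1 *: delta_mx 0 l.
  (* Symplectic Gram-Schmidt: the corrections make [y] orthogonal to the earlier pairs and keep
     [bil B x y = 1], as [x] is orthogonal to them. *)
  pose y := (y0 + \sum_i (- bil B y0 (u true i)) *: u false i) +
    \sum_i bil B y0 (u false i) *: u true i.
  have bilD z z' w : bil B (z + z') w = bil B z w + bil B z' w.
    by have := bilDl B 1 z z' w; rewrite scale1r mul1r.
  have xy0 : bil B x y0 = 1.
    have e : (x *m B *m delta_mx l (0 : 'I_1)) 0 0 = (x *m B) 0 l by rewrite
      -colE mxE.
    by rewrite /bil /y0 linearZ /= -scalemxAr trmx_delta mxE [X in _ * X]e
      mulVf.
  have xy : bil B x y = 1.
    rewrite -[LHS]opprK -bilN /y !bilD !bil_suml !big1;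
      first by rewrite !addr0 (bilN x) opprK.
      by move=> i _; rewrite (bilN x) xu oppr0 mulr0.
    by move=> i _; rewrite (bilN x) xu oppr0 mulr0.
  have yu b i : bil B y (u b i) = 0.
    rewrite /y !bilD !bil_suml; under eq_bigr do rewrite uE.
    under [X in _ + X = _]eq_bigr do rewrite uE.
    rewrite (bigD1 i)//= [X in _ + X = _](bigD1 i)//= !eqxx.
    rewrite big1 => [|i' /negbTE->]; last by rewrite mulr0.
    rewrite big1 => [|i' /negbTE->]; last by rewrite mulr0.
    by case: b => /=; rewrite ?mulr0 ?mulr1 ?mulrN1 ?expr0 ?expr1 ?addr0 ?mulr1
      ?mulrN1 addrN.
  exists (fun b i => if unlift ord_max i is Some i' then u b i' else if b then y
    else x).
  move=> s t i1 i2; case: unliftP => [i1'|] ->; case: unliftP => [i2'|] ->.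
  - by rewrite uE (inj_eq lift_inj).
  - rewrite eq_sym (negbTE (neq_lift _ _)) /=.
    by case: t; rewrite bilN ?yu ?xu oppr0.
  - by rewrite (negbTE (neq_lift _ _)) /=; case: s; rewrite ?yu ?xu.
  - rewrite eqxx; case: s; case: t => /=; rewrite ?bil0//.
    by rewrite bilN xy.
pose S : 'M[R]_m := \matrix_x u (h x).1 (h x).2.
have : S *m B *m S^T = J.
  apply/matrixP => x y; rewrite [RHS]mxE -uB' /bil.
  have rS z : u (h z).1 (h z).2 = row z S by apply/rowP => l; rewrite !mxE.
  by rewrite !rS -row_mul !mxE; apply: eq_bigr => l _; rewrite !mxE.
move=> /(congr1 pfaffian); rewrite pfaffian_congruence => H.
by apply: contra_eqN H => /eqP ->; rewrite mulr0 lt_eqF// pfaffian_std_gt0.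
Qed.

End Pfaffian.

(** * Local frames *)

Section Evaluation.
Context {R : realType} {n : nat} {M : manifold R n}.
Implicit Types (p : M) (f g : Cinf M) (X Y : vfield M).

Definition eval_at p f : R := f p.

Fact eval_additive p : zmod_morphism (eval_at p).
Proof. by []. Qed.

Fact eval_multiplicative p : monoid_morphism (eval_at p).
Proof. by []. Qed.

HB.instance Definition _ p :=
  GRing.isZmodMorphism.Build (Cinf M) R (eval_at p) (eval_additive p).
HB.instance Definition _ p :=
  GRing.isMonoidMorphism.Build (Cinf M) R (eval_at p) (eval_multiplicative p).

Lemma tangent_comp p (v : tangent p) (phi : R -> R^o) (d : R) f
    (sphi : smooth (fun q => phi (f q) : R^o)) :
  is_derive (f p : R) (1 : R) (phi : R -> R) d -> v (mkCinf sphi) = d * v f.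
Proof.
move=> dphi; have [c [x [E [ac cp /nbhs_singleton[_ vE EE]]]]]
  := coordinate_frame p.
rewrite (vE v) !tangent_sumE mulr_sumr; apply: eq_bigr => i _.
rewrite mulrCA; congr (_ * _); rewrite !EE.
have df : differentiable (f \o cinv c) (cmap c p).
  by apply: smooth_near_differentiable;
    exact: ((smoothP _).1 (Cinf_smooth f) p).
have dphi' : is_derive ((f \o cinv c) (cmap c p) : R) (1 : R) (phi : R -> R) d.
  by rewrite /= cmapK.
by have [_] := derive_comp1 (delta_mx ord0 i) dphi' df.
Qed.

Definition exp_fun f : Cinf M := mkCinf (smooth_expR (Cinf_smooth f)).

Lemma tangent_exp p (v : tangent p) f : v (exp_fun f) = expR (f p) * v f.
Proof. by apply: tangent_comp; exact: is_derive_expR. Qed.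

Definition ln_fun f (f0 : forall p, 0 < f p :> R) : Cinf M :=
  mkCinf (smooth_ln f0 (Cinf_smooth f)).

Lemma tangent_ln p (v : tangent p) f (f0 : forall p, 0 < f p :> R) :
  v (ln_fun f0) = v f / f p.
Proof. by rewrite mulrC; apply: tangent_comp; exact: is_derive1_ln. Qed.

Definition inv_fun f (f0 : forall p, f p != 0 :> R) : Cinf M :=
  mkCinf (smoothV f0 (Cinf_smooth f)).

Definition vadd X Y : vfield M :=
  MkVfield (fun f => smoothD (vf_smooth X f) (vf_smooth Y f) :
    smooth (fun p => (X p + Y p) f)).

Definition vscale f X : vfield M :=
  MkVfield (fun g => smoothM (Cinf_smooth f) (vf_smooth X g) :
    smooth (fun p => ((f p : R) *: X p) g)).

Definition frame p (x : 'I_n -> Cinf M) (E : 'I_n -> vfield M) : Prop :=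
  (forall i j, E i p (x j) = (i == j)%:R) /\
  (forall v : tangent p, v = \sum_i v (x i) *: E i p).

Lemma local_frame p0 : exists x E, \forall p \near p0, frame p x E.
Proof.
have [c [x [E [_ _ xE]]]] := coordinate_frame p0; exists x, E.
by apply: (near_imply xE) => p [].
Qed.

Lemma frame_fun p x E (v : tangent p) f : frame p x E ->
  v f = \sum_i v (x i) * E i p f.
Proof. by move=> [_ /(_ v) {1}->]; rewrite tangent_sumE. Qed.

Lemma frame_cotangent p x E (a : cotangent p) (v : tangent p) : frame p x E ->
  a v = \sum_i v (x i) * a (E i p).
Proof.
move=> [_ /(_ v) {1}->]; rewrite (linear_sum (cotangent_fun a)).
by apply: eq_bigr => i _; exact: linearZ.
Qed.

Lemma kform_alternating k (w : kform M k) p : alternating_form (kf_val w p).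
Proof. by split=> [v i|v i j]; [exact: kf_linear|exact: kf_alternating]. Qed.

Lemma kform_frame p x E (w : kform M n) (v : 'I_n -> tangent p) : frame p x E ->
  w p v = \det (\matrix_(j, i) v j (x i)) * w p (fun i => E i p).
Proof.
move=> [_ vE].
rewrite -(alternating_detE (fun i => E i p) _ (kform_alternating w p)).
by congr (kf_val w p); apply/funext => j; rewrite {1}(vE (v j));
  apply: eq_bigr => i _; rewrite mxE.
Qed.

Fact oneform_of_kform_subproof (w : kform M 1) p :
  (fun v : tangent p => w p (fun _ => v)) \in @covector_pred R n M p.
Proof.
apply/asboolP => a u v.
have E x : (fun _ : 'I_1 => x) = [eta (fun _ : 'I_1 =>
  0) with ord0 |-> x] :> (_ -> tangent p).
  by apply/funext => i; rewrite /= ord1.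
by rewrite (E (a *: u + v)) (E u) (E v); exact: kf_linear.
Qed.

Definition oneform_of_kform (w : kform M 1) : oneform M :=
  @MkOneform _ _ _ (fun p => MkCotangent (oneform_of_kform_subproof w p))
    (fun X => kf_smooth w (fun _ => X)).

Lemma oneform_of_kformE (w : kform M 1) p (v : tangent p) :
  oneform_of_kform w p v = w p (fun _ => v).
Proof. by []. Qed.

Lemma oneform_scale_subproof f (a : oneform M) X :
  smooth (fun p => ((f p : R) *: a p) (X p)).
Proof. exact: smoothM (Cinf_smooth f) (of_smooth a X). Qed.

Definition oneform_scale f (a : oneform M) : oneform M :=
  MkOneform (oneform_scale_subproof f a).

Definition of_app (a : oneform M) X : Cinf M := mkCinf (of_smooth a X).

End Evaluation.

(** * Divergence of hamiltonian vector fields *)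

Section PoissonFrame.
Context {R : realType} {n : nat} {M : manifold R n} (pi : poisson M).
Implicit Types (p : M) (f g : Cinf M) (X Y : vfield M).

Local Notation H := (hamiltonian pi).
Local Notation F := (symplectic_foliation pi : forall q, set (tangent q)).

Lemma bivector_skew p (a b : cotangent p) : pi p b a = - pi p a b.
Proof.
have := bv_alternating pi (a + b).
have D1 u v w : pi p (u + v) w = pi p u w + pi p v w.
  by have := bv_linearl pi w 1 u v; rewrite !scale1r.
have D2 u v w : pi p w (u + v) = pi p w u + pi p w v.
  by have := bv_linearr pi w 1 u v; rewrite !scale1r.
rewrite D1 !D2 !bv_alternating add0r addr0 addrC => /eqP.
by rewrite addr_eq0 => /eqP.
Qed.

Lemma bracket_skew f g : bracket pi g f = - bracket pi f g.
Proof. by apply/val_inj/funext => p; exact: bivector_skew. Qed.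

(** The Jacobi identity, read as the invariance of pi under its hamiltonian fields. *)
Lemma hamiltonian_bracket f g h :
  vf_app (H f) (bracket pi g h) =
  bracket pi (vf_app (H f) g) h + bracket pi g (vf_app (H f) h).
Proof.
have E u v : vf_app (H u) v = bracket pi u v by apply/val_inj.
rewrite !E; have := poisson_jacobi pi f g h => /=.
rewrite [bracket pi h (bracket pi f g)]bracket_skew [bracket pi h
  f]bracket_skew.
have -> : bracket pi g (- bracket pi f h) = - bracket pi g (bracket pi f h).
  by rewrite -!E; apply/val_inj/funext => p /=;
    exact: (linearN (tangent_fun (H g p))).
by move/eqP; rewrite subr_eq0 subr_eq => /eqP ->; rewrite addrC.
Qed.

Lemma hamiltonian_linear a f g p : H (a *: f + g) p = a *: H f p + H g p.
Proof.
apply/val_inj/funext => h.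
rewrite -[LHS]/(pi p (differential (a *: f + g) p) (differential h p)).
by rewrite differential_linear bv_linearl.
Qed.

Section Frame.
Context {p : M} {x : 'I_n -> Cinf M} {E : 'I_n -> vfield M}.
Hypothesis xE : frame p x E.

Definition coords (v : tangent p) : 'rV[R]_n := \row_i v (x i).

Definition poisson_mx : 'M[R]_n := \matrix_(i, j) bracket pi (x i) (x j) p.

Lemma coords_comb (I : Type) (r : seq I) (a : I -> R) (v : I -> tangent p) :
  coords (\sum_(i <- r) a i *: v i) = \sum_(i <- r) a i *: coords (v i).
Proof.
apply/rowP => j; rewrite mxE tangent_sumE summxE.
by apply: eq_bigr => i _; rewrite !mxE.
Qed.

Lemma coords_inj : injective coords.
Proof.
move=> u v uv; rewrite (xE.2 u) (xE.2 v); apply: eq_bigr => i _.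
by move/rowP/(_ i): uv; rewrite !mxE => ->.
Qed.

Lemma sharp_coords (a : cotangent p) :
  coords (sharp pi a) = (\row_i a (E i p)) *m poisson_mx.
Proof.
apply/rowP => j; rewrite !mxE.
have aE : a = \sum_i a (E i p) *: differential (x i) p.
  apply/val_inj/funext => v.
  have -> : \val (\sum_i a (E i p) *: differential (x i) p) v =
      \sum_i a (E i p) * v (x i).
    by elim/big_rec2: _ => //= i _ w _ <-.
  by rewrite [LHS](frame_cotangent a v xE); apply: eq_bigr => i _;
    rewrite mulrC.
rewrite -[LHS]/(pi p a (differential (x j) p)) {1}aE.
have -> : pi p (\sum_i a (E i p) *: differential (x i) p) (differential (x j) p)
  =
    \sum_i a (E i p) * pi p (differential (x i) p) (differential (x j) p).
  have pil := bv_linearl pi (differential (x j) p).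
  elim/big_rec2: _ => [|i y w _ <-]; last exact: pil.
  by have := pil (-1) 0 0; rewrite scaler0 addr0 scaleN1r addNr.
by apply: eq_bigr => i _; rewrite !mxE.
Qed.

Lemma poisson_mx_skew : poisson_mx^T = - poisson_mx.
Proof. by apply/matrixP => i j; rewrite !mxE; exact: bivector_skew. Qed.

(** In coordinates, F at [p] is the row space of the Poisson matrix. *)
Lemma rank_poisson_mx r : has_dim (F p) r ->
  \rank poisson_mx = r.
Proof.
move=> [e [De e_free]].
have De' v : F p v <-> exists c : 'I_r -> R, v = \sum_i c i *: e i.
  by rewrite De.
pose A : 'M[R]_(r, n) := \matrix_i coords (e i).
have rowA (u : 'rV[R]_r) : u *m A = coords (\sum_i u 0 i *: e i).
  by rewrite coords_comb mulmx_sum_row; apply: eq_bigr => i _; rewrite rowK.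
have freeA : row_free A.
  rewrite -kermx_eq0; apply/rowV0P => u; rewrite sub_kermx rowA => /eqP u0.
  have /e_free u0' : \sum_i u 0 i *: e i = 0.
    by apply: coords_inj; rewrite u0; apply/rowP => j; rewrite !mxE.
  by apply/rowP => i; rewrite u0' mxE.
have -> : \rank poisson_mx = \rank A; last by move/eqP: freeA.
apply/eqP; rewrite eqn_leq !mxrankS//.
  apply/row_subP => i; rewrite rowK.
  have [a _ <-] : F p (e i).
    apply/De'; exists (fun j => (j == i)%:R); rewrite (bigD1 i)//= eqxx scale1r.
    by rewrite big1 ?addr0// => j /negbTE->; rewrite scale0r.
  by rewrite sharp_coords submxMl.
apply/row_subP => i.
have /De'[c Hc] : F p (H (x i) p) by exists (differential (x i) p).
have -> : row i poisson_mx = coords (H (x i) p) by apply/rowP => j;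
  rewrite !mxE.
rewrite Hc; have -> : \sum_j c j *: e j = \sum_j (\row_j c j) 0 j *: e j.
  by apply: eq_bigr => j _; rewrite mxE.
by rewrite -rowA submxMl.
Qed.

Context {nu : oneform M}.
Hypothesis codim1 : exists2 r, has_dim (F p) r & (r + 1)%N = n.
Hypothesis nu0 : exists v, nu p v != 0.
Hypothesis nuH : forall f, nu p (H f p) = 0.

Definition conormal_mx : 'cV[R]_n := \col_i nu p (E i p).

Lemma conormal_mxE (v : tangent p) : coords v *m conormal_mx = (nu p v)%:M.
Proof.
apply/matrixP => i j; rewrite !ord1 !mxE (frame_cotangent (nu p) v xE) mulr1n.
by apply: eq_bigr => l _; rewrite !mxE.
Qed.

Lemma poisson_conormal : poisson_mx *m conormal_mx = 0.
Proof.
apply/row_matrixP => i; rewrite row_mul row0.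
have -> : row i poisson_mx = coords (H (x i) p) by apply/rowP => j;
  rewrite !mxE.
by rewrite conormal_mxE nuH; apply/matrixP => ? ?; rewrite !mxE mul0rn.
Qed.

(** The opposite inclusion says that nu kills hamiltonian fields; codimension 1 makes both
    dimensions n - 1. *)
Lemma ker_conormal : (kermx conormal_mx <= poisson_mx)%MS.
Proof.
have [r hr rn] := codim1; have rk := rank_poisson_mx hr.
have sub : (poisson_mx <= kermx conormal_mx)%MS by rewrite sub_kermx
  poisson_conormal.
have rk1 : \rank conormal_mx = 1%N.
  apply/eqP; rewrite eqn_leq rank_leq_col lt0n mxrank_eq0.
  have [v] := nu0; apply: contraNneq => c0; have := conormal_mxE v.
  by rewrite c0 mulmx0 => /matrixP/(_ 0 0); rewrite !mxE mulr1n => <-.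
rewrite -(mxrank_leqif_sup sub).2 mxrank_ker rk1 rk; apply/eqP.
by move: rn; move: (n) => n' <-; rewrite addnK.
Qed.

Lemma symplectic_foliationP (v : tangent p) :
  nu p v = 0 <-> F p v.
Proof.
split=> [v0|[a _ <-]].
  have : (coords v <= kermx conormal_mx)%MS.
    by rewrite sub_kermx conormal_mxE v0; apply/eqP/matrixP => ? ?;
      rewrite !mxE mul0rn.
  move=> /submx_trans/(_ ker_conormal)/submxP[u uv].
  exists (\sum_i u 0 i *: differential (x i) p) => //; apply: coords_inj.
  rewrite sharp_coords uv; congr (_ *m _); apply/rowP => i; rewrite mxE.
  have -> : (\sum_j u 0 j *: differential (x j) p) (E i p) = \sum_j u 0 j * E i
    p (x j).
    by elim/big_rec2: _ => //= j _ w _ <-.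
  rewrite (bigD1 i)//= xE.1 eqxx mulr1 big1 ?addr0// => j ji.
  by rewrite xE.1 eq_sym (negbTE ji) mulr0.
have := conormal_mxE (sharp pi a); rewrite sharp_coords -mulmxA poisson_conormal
  mulmx0.
by move/matrixP/(_ 0 0); rewrite !mxE mulr1n => <-.
Qed.

End Frame.

Lemma tangent_hamiltonian f : tangent_to (symplectic_foliation pi) (H f).
Proof. by move=> p; exists (differential f p). Qed.

End PoissonFrame.

Section Bordered.
Context {R : realType} {n : nat} {M : manifold R n} (pi : poisson M).
Implicit Types (p : M) (f g : Cinf M) (X Y : vfield M).
Variable N : vfield M.

Local Notation H := (hamiltonian pi).

(* The pfaffian of this matrix is, up to a constant, the coefficient of
   [N /\ pi^k], [n = 2 k + 1], in the coordinates [x]. *)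
Definition bordered (x : 'I_n -> Cinf M) : 'M[Cinf M]_(1 + n) :=
  block_mx 0 (\row_j vf_app N (x j)) (\col_i - vf_app N (x i))
    (\matrix_(i, j) bracket pi (x i) (x j)).

Definition bordered_at p x : 'M[R]_(1 + n) := map_mx (eval_at p) (bordered x).

Lemma bordered_atE p x : bordered_at p x =
  block_mx 0 (coords (x := x) (N p)) (- (coords (x := x) (N p))^T)
    (poisson_mx pi (p := p) (x := x)).
Proof.
rewrite /bordered_at map_block_mx map_mx0; congr block_mx.
- by apply/matrixP => i j; rewrite !mxE.
- by apply/matrixP => i j; rewrite !mxE.
- by apply/matrixP => i j; rewrite !mxE.
Qed.

Lemma bordered_skew p x : (bordered_at p x)^T = - bordered_at p x.
Proof.
rewrite bordered_atE tr_block_mx poisson_mx_skew opp_block_mx trmx0 oppr0.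
by rewrite linearN /= trmxK opprK.
Qed.

Section Frame.
Context {p : M} {x : 'I_n -> Cinf M} {E : 'I_n -> vfield M}.
Hypothesis xE : frame p x E.

(** The functions [f] are arbitrary, so [S] may be singular; its determinant is the Jacobian
    determinant of [f] in the frame. *)
Lemma bordered_change (f : 'I_n -> Cinf M) :
  let S := block_mx 1%:M 0 0 (\matrix_(i, l) E l p (f i)) : 'M[R]_(1 + n) in
  bordered_at p f = S *m bordered_at p x *m S^T.
Proof.
set T := \matrix_(i, l) E l p (f i) => /=.
rewrite !bordered_atE tr_block_mx !mulmx_block.
rewrite !(mul0mx, mulmx0, mul1mx, mulmx1, add0r, addr0, trmx0, trmx1).
have NT : coords (x := f) (N p) = coords (x := x) (N p) *m T^T.
  apply/rowP => j; rewrite !mxE (frame_fun (N p) (f j) xE).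
  by apply: eq_bigr => i _; rewrite !mxE.
congr block_mx; first by [].
  by rewrite NT trmx_mul trmxK mulmxN.
apply/matrixP => i j; rewrite !mxE.
rewrite -[LHS]/(H (f i) p (f j) : R) (frame_fun _ (f j) xE).
apply: eq_bigr => l _; rewrite !mxE; congr (_ * _).
rewrite -[LHS]/(bracket pi (f i) (x l) p) bracket_skew.
rewrite -[LHS]/(- (H (x l) p (f i) : R)) (frame_fun _ (f i) xE) -sumrN.
apply: eq_bigr => m _; rewrite !mxE -mulNr mulrC; congr (_ * _).
by rewrite bracket_skew.
Qed.

Context {nu : oneform M}.
Hypothesis codim1 : exists2 r, has_dim ((symplectic_foliation pi : forall q,
  set (tangent q)) p) r & (r + 1)%N = n.
Hypothesis nuN : nu p (N p) = 1.
Hypothesis nuH : forall f, nu p (H f p) = 0.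

(** Let (a, u) be in the left kernel. Pairing with nu gives a = 0; then u annihilates both N and the
    row space of the Poisson matrix, which is F, and together these span the tangent space. *)
Lemma bordered_unit : bordered_at p x \in unitmx.
Proof.
have nu0 : exists v, nu p v != 0 by exists (N p); rewrite nuN oner_eq0.
rewrite -row_free_unit -kermx_eq0; apply/rowV0P => w; rewrite sub_kermx => /eqP.
rewrite -[w]hsubmxK; set a := lsubmx w; set u := rsubmx w; clearbody a u => {w}.
rewrite bordered_atE mul_row_block mulmx0 add0r => /eqP.
rewrite row_mx_eq0 => /andP[/eqP u0 /eqP au].
have a0 : a = 0.
  have := congr1 (mulmx^~ (conormal_mx (p := p) (E := E) (nu := nu))) au.
  rewrite mulmxDl -!mulmxA (poisson_conormal xE nuH) mulmx0 addr0 mul0mx.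
  by rewrite (conormal_mxE xE) nuN mulmx1.
rewrite a0 mul0mx add0r in au *.
have uT0 : coords (x := x) (N p) *m u^T = 0.
  by apply/trmx_inj; rewrite trmx_mul trmxK trmx0; apply/eqP;
    rewrite -oppr_eq0 -mulmxN u0.
have Pu : poisson_mx pi (p := p) (x := x) *m u^T = 0.
  apply/trmx_inj; rewrite trmx_mul trmxK trmx0 poisson_mx_skew.
  by rewrite mulmxN au oppr0.
suff -> : u = 0 by rewrite row_mx0.
apply/trmx_inj; rewrite trmx0; apply/row_matrixP => j; rewrite row0 rowE.
set w := delta_mx 0 j.
(* The component of [w] in F along N. *)
pose z := w - w *m conormal_mx (p := p) (E := E) (nu := nu) *m coords (x := x)
  (N p).
have /submx_trans/(_ (ker_conormal xE codim1 nu0 nuH))/submxP[y zy] :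
    (z <= kermx (conormal_mx (p := p) (E := E) (nu := nu)))%MS.
  by rewrite sub_kermx mulmxBl -[X in _ - X]mulmxA (conormal_mxE xE) nuN mulmx1
    subrr.
have -> : w = z + w *m conormal_mx (p := p) (E := E) (nu := nu) *m coords (x :=
  x) (N p).
  by rewrite subrK.
by rewrite mulmxDl zy -!mulmxA Pu uT0 !mulmx0 addr0.
Qed.

End Frame.
End Bordered.

Section LieDerivative.
Context {R : realType} {n : nat} {M : manifold R n}.
Context {p : M} {x : 'I_n -> Cinf M} {E : 'I_n -> vfield M}.
Implicit Types (f g : Cinf M) (X Y : vfield M).
Hypothesis nearE : \forall q \near p, frame q x E.

Let xE : frame p x E. Proof. exact: nbhs_singleton nearE. Qed.

Definition jacobian_mx X : 'M[R]_n := \matrix_(i, l) E l p (vf_app X (x i)).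

Lemma jacobian_mxE X (v : tangent p) i :
  v (vf_app X (x i)) = \sum_l v (x l) * jacobian_mx X i l.
Proof. by rewrite (frame_fun _ _ xE); apply: eq_bigr => l _; rewrite mxE. Qed.

Lemma tangent_det (v : tangent p) m (A : 'M[Cinf M]_m) :
  v (\det A) = \tr (map_mx (v : _ -> R) A *m \adj (map_mx (eval_at p) A)).
Proof.
exact: (@derivation_det R (Cinf M) (eval_at p) v (tangentD v) (tangentM v) m A).
Qed.

(** Derivatives of the coefficients of [Y] appear both in X(mu(Y)), through Jacobi's formula, and in
    the brackets, where they cancel; the trace of the Jacobian matrix remains. *)
Lemma lie_kform_frame X (mu : kform M n) (Y : 'I_n -> vfield M) :
  lie_kform X mu Y p =
  (X p (kf_app mu E) + \tr (jacobian_mx X) * mu p (fun i => E i p)) *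
    \det (\matrix_(j, i) Y j p (x i)).
Proof.
pose A : 'M[Cinf M]_n := \matrix_(j, i) vf_app (Y j) (x i).
pose m := mu p (fun i => E i p).
have Ap : map_mx (eval_at p) A = \matrix_(j, i) Y j p (x i).
  by apply/matrixP => j i; rewrite !mxE.
have muY : \forall q \near p, kf_app mu Y q = (\det A * kf_app mu E) q :> R.
  apply: (near_imply nearE) => q qE.
  rewrite -[RHS]/(eval_at q (\det A) * mu q (fun i => E i q)).
  rewrite -[LHS]/(mu q (fun i => Y i q)) (kform_frame mu _ qE) -det_map_mx.
  by congr (\det _ * _); apply/matrixP => j i; rewrite !mxE.
rewrite /lie_kform (tangent_local (X p) muY) tangentM.
(* Row [j] of [D] holds the coordinates of [lie X (Y j)] at [p]. *)
pose D := map_mx (X p) A - map_mx (eval_at p) A *m (jacobian_mx X)^T.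
have Lie j : mu p (fun k => [eta Y with j |-> lie X (Y j)] k p) =
    \det (\matrix_(k, i) if k == j then D k i else map_mx (eval_at p) A k i) *
      m.
  rewrite (kform_frame mu _ xE) -/m; congr (\det _ * _); apply/matrixP => k i.
  rewrite !mxE /=; case: eqP => [->|//].
  rewrite -[LHS]/(X p (vf_app (Y j) (x i)) - Y j p (vf_app X (x i)) : R).
  congr (_ - _); rewrite jacobian_mxE; apply: eq_bigr => l _.
  by rewrite !mxE.
rewrite (eq_bigr _ (fun j _ => Lie j)) -mulr_suml det_replace_rows.
rewrite mulmxBl linearB /= -tangent_det mxtrace_mulC mulmxA mul_adj_mx.
rewrite mul_scalar_mx mxtraceZ mxtrace_tr -[(\det A) p]/(eval_at p (\det A)).
rewrite -det_map_mx Ap -/m; ring.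
Qed.

End LieDerivative.

Section HamiltonianDensity.
Context {R : realType} {n : nat} {M : manifold R n} (pi : poisson M).
Variables (N : vfield M) (nu : oneform M).
Implicit Types (p : M) (f g : Cinf M) (X Y : vfield M).
Local Notation H := (hamiltonian pi).
Hypothesis codim1 : forall p, exists2 r,
  has_dim ((symplectic_foliation pi : forall q,
    set (tangent q)) p) r & (r + 1)%N = n.
Hypothesis nuN : forall p, nu p (N p) = 1.
Hypothesis nuH : forall p f, nu p (H f p) = 0.

Lemma hamiltonian_det_bordered p (x : 'I_n -> Cinf M) (E : 'I_n -> vfield M) f :
    (\forall q \near p, frame q x E) ->
  H f p (\det (bordered pi N x)) =
  (\tr (jacobian_mx (p := p) (x := x) (E := E) (H f)) + nu p (lie (H f) N p)) *
    \det (bordered_at pi N p x) *+ 2.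
Proof.
move=> nearE; have xE : frame p x E by exact: nbhs_singleton nearE.
set X := H f; set C := jacobian_mx X; set lam := nu p (lie X N p).
have nu0 : exists v, nu p v != 0 by exists (N p); rewrite nuN oner_eq0.
(* Being killed by nu, this vector is tangent to F, hence of the form [sharp pi a]. Its coordinates
   are [al] times the Poisson matrix, so [al] can be placed in the border of [Ct] without affecting
   the trace. *)
have : nu p (lie X N p - lam *: N p) = 0.
  by rewrite cotangentB cotangentZ nuN mulr1 subrr.
move=> /(symplectic_foliationP xE (codim1 p) nu0 (nuH p)).
move=> [a _ /(congr1 (coords (x := x)))]; rewrite (sharp_coords pi xE).
set al := \row_i a (E i p) => alE.
pose Ct : 'M[R]_(1 + n) := block_mx lam%:M al 0 C.
have trCt : \tr Ct = \tr C + lam by rewrite mxtrace_block mxtrace_scalar addrC.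
rewrite -trCt; apply: (@derivation_det_congruence R (Cinf M) (eval_at p) (X p)
  (tangentD (X p)) (tangentM (X p))).
rewrite -/(bordered_at pi N p x) bordered_atE tr_block_mx !mulmx_block.
set Nr := coords (N p); set P := poisson_mx pi.
(* X(N x_i) = [X, N] x_i + N(X x_i), with [X, N] split along N and F. *)
have LN i : X p (vf_app N (x i)) = lam * Nr 0 i + (al *m P) 0 i + (Nr *m C^T) 0
  i.
  rewrite alE -[LHS](subrK (N p (vf_app X (x i)))) -[X in X + _]/(lie X N p (x
    i)).
  have -> : lie X N p (x i) = lam * Nr 0 i + coords (x := x) (lie X N p - lam *:
    N p) 0 i.
    by rewrite !mxE -[(lie X N p - _) _]/(lie X N p (x i) - lam * N p (x i))
      subrKC.
  congr (_ + _); rewrite (jacobian_mxE nearE) mxE.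
  by apply: eq_bigr => l _; rewrite !mxE.
have LP i j : X p (bracket pi (x i) (x j)) = (C *m P) i j + (P *m C^T) i j.
  have brE g h : bracket pi g (vf_app X h) p = H g p (vf_app X h) by [].
  rewrite -[LHS]/(vf_app X (bracket pi (x i) (x j)) p) hamiltonian_bracket.
  rewrite -[LHS]/(bracket pi (vf_app X (x i)) (x j) p + bracket pi (x i) (vf_app
    X (x j)) p : R).
  have -> : bracket pi (vf_app X (x i)) (x j) p = - H (x j) p (vf_app X (x i))
    :> R.
    by rewrite bracket_skew.
  rewrite !brE !(jacobian_mxE nearE) !mxE -sumrN; congr (_ + _).
    apply: eq_bigr => l _; rewrite !mxE -mulNr mulrC; congr (_ * _).
    by rewrite bracket_skew.
  by apply: eq_bigr => l _; rewrite !mxE.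
have PT : P^T = - P by exact: poisson_mx_skew.
rewrite map_block_mx add_block_mx !(mulmx0, mul0mx, add0r, addr0).
rewrite trmx0 tr_scalar_mx !(mulmx0, mul0mx, add0r, addr0); congr block_mx.
- have -> : Nr *m al^T = (al *m Nr^T)^T by rewrite trmx_mul trmxK.
  rewrite mulmxN; apply/matrixP => i j.
  by rewrite !ord1 [RHS]mxE [X in _ = X + _]mxE [X in _ = _ + X]mxE addNr !mxE
    tangent0.
- by rewrite mul_scalar_mx; apply/matrixP => i j; rewrite ord1 !mxE LN !mxE.
- have -> : C *m - Nr^T + (- Nr^T *m lam%:M + P *m al^T) =
      - (lam *: Nr + al *m P + Nr *m C^T)^T.
    have -> : (lam *: Nr + al *m P + Nr *m C^T)^T =
        Nr^T *m lam%:M - P *m al^T + C *m Nr^T.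
      rewrite -mul_scalar_mx linearD linearD /= !trmx_mul trmxK tr_scalar_mx PT.
      by rewrite mulNmx.
    by rewrite mulmxN mulNmx !opprD opprK addrC.
  apply/matrixP => i j; rewrite ord1 !mxE -[- vf_app N (x i)]mulN1r.
  rewrite tangentM [X p (-1)](_ : _ = 0); last first.
    by rewrite -[-1]sub0r tangentB tangent0 tangent1 subrr.
  by rewrite mulr0 addr0 LN -[RHS]mulN1r !mxE.
- by apply/matrixP => i j; rewrite !mxE LP !mxE.
Qed.

End HamiltonianDensity.

Section Density.
Context {R : realType} {n : nat} {M : manifold R n} (pi : poisson M).
Variables (N : vfield M) (nu : oneform M).
Implicit Types (p : M) (f g : Cinf M) (X Y : vfield M) (mu : kform M n).
Local Notation H := (hamiltonian pi).
Hypothesis codim1 : forall p, exists2 r,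
  has_dim ((symplectic_foliation pi : forall q,
    set (tangent q)) p) r & (r + 1)%N = n.
Hypothesis nuN : forall p, nu p (N p) = 1.
Hypothesis nuH : forall p f, nu p (H f p) = 0.

Lemma frame_exists p :
  exists xE : ('I_n -> Cinf M) * ('I_n -> vfield M), frame p xE.1 xE.2.
Proof. by have [x [E /nbhs_singleton xE]] := local_frame p; exists (x, E). Qed.

(** Chosen point by point, without any continuity in [p]. Smoothness of what is built from it
    follows from independence of the frame. *)
Definition some_frame p := projT1 (cid (frame_exists p)).

Lemma some_frameP p : frame p (some_frame p).1 (some_frame p).2.
Proof. exact: projT2 (cid (frame_exists p)). Qed.

Lemma det_bordered_mx m (T : 'M[R]_m) : \det (block_mx 1%:M 0 0 T : 'M[R]_(1 +
  m)) = \det T.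
Proof. by rewrite det_lblock det1 mul1r. Qed.

(* If [mu = a nu /\ omega^k], where [omega] restricts to the leafwise
   symplectic form and [i_N omega = 0], then [density mu] is [a ^ 2] up to a
   constant factor. *)
Definition density mu p : R^o :=
  \det (bordered_at pi N p (some_frame p).1) *
  mu p (fun i => (some_frame p).2 i p) ^+ 2.

Lemma density_frame mu p x E : frame p x E ->
  density mu p = \det (bordered_at pi N p x) * mu p (fun i => E i p) ^+ 2.
Proof.
move=> xE; have fF := some_frameP p; rewrite /density.
rewrite (bordered_change pi N xE) !det_mulmx det_tr det_bordered_mx.
rewrite (kform_frame mu (fun i => E i p) fF).
have -> : \matrix_(j, i) E j p ((some_frame p).1 i) =
    (\matrix_(i, l) E l p ((some_frame p).1 i))^T.
  by apply/matrixP => i j; rewrite !mxE.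
rewrite det_tr; ring.
Qed.

Lemma density_near mu p x E : (\forall q \near p, frame q x E) ->
  \forall q \near p, (\det (bordered pi N x) * kf_app mu E ^+ 2) q = density mu
    q.
Proof.
move=> nearE; apply: (near_imply nearE) => q qE; rewrite (density_frame mu qE).
by rewrite /bordered_at det_map_mx.
Qed.

Lemma density_smooth mu : smooth (density mu).
Proof.
apply/smoothP => p; have [x [E nearE]] := local_frame p.
apply: smooth_at_eq (density_near mu nearE) _.
by apply: (smoothP _).1; exact: Cinf_smooth.
Qed.

Definition density_fun mu : Cinf M := mkCinf (density_smooth mu).

Lemma density_neq0 mu p : volume_form mu -> density mu p != 0.
Proof.
move=> /(_ p)[v]; rewrite (kform_frame mu v (some_frameP p)) mulf_eq0 negb_or =>
  /andP[_ m0].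
rewrite mulf_neq0 ?expf_neq0// -unitfE -unitmxE.
exact: (bordered_unit (some_frameP p) (codim1 p) (nuN p) (nuH p)).
Qed.

(** The congruence counts the trace twice and the square of mu(E) counts its logarithmic derivative
    twice, hence the division by 2. *)
Lemma lie_kform_hamiltonian mu f (Y : 'I_n -> vfield M) p : volume_form mu ->
  lie_kform (H f) mu Y p =
  (H f p (density_fun mu) / (density mu p *+ 2) - nu p (lie (H f) N p)) *
    mu p (fun i => Y i p).
Proof.
move=> vmu; have [x [E nearE]] := local_frame p.
have xE : frame p x E by exact: nbhs_singleton nearE.
have := density_neq0 p vmu.
rewrite (density_frame mu xE) mulf_eq0 negb_or => /andP[B0].
rewrite sqrf_eq0 => m0.
rewrite (lie_kform_frame nearE) (kform_frame mu (fun i => Y i p) xE).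
have densE : \forall q \near p, (\det (bordered pi N x) * kf_app mu E ^+ 2) q =
    density_fun mu q :> R by exact: density_near.
rewrite -(tangent_local (H f p) densE).
rewrite tangentM expr2 tangentM (hamiltonian_det_bordered codim1 nuN nuH f
  nearE).
rewrite -[(\det (bordered pi N x)) p]/(eval_at p (\det (bordered pi N x)))
  -det_map_mx.
rewrite -/(bordered_at pi N p x).
set m := mu p _ in m0 *; set D := \det (bordered_at _ _ _ _) in B0 *.
rewrite -[(kf_app mu E * kf_app mu E) p]/(m * m) -[kf_app mu E p]/m.
by field; rewrite m0 B0.
Qed.

Lemma even_pairing m : ~~ odd m -> exists k (c : bool -> 'I_k -> 'I_m)
    (h : 'I_m -> bool * 'I_k),
  (forall s i, h (c s i) = (s, i)) /\ (forall x, c (h x).1 (h x).2 = x).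
Proof.
move=> em; have mE : m = (m./2).*2 by rewrite -{1}(odd_double_half m) (negbTE
  em).
have cP (s : bool) (i : 'I_(m./2)) : (s + i.*2 < m)%N.
  rewrite {2}mE; apply: (@leq_trans i.+1.*2); last by rewrite leq_double.
  by rewrite doubleS; case: s.
have hP (x : 'I_m) : (x./2 < m./2)%N.
  by rewrite -ltn_double -mE (leq_ltn_trans _ (ltn_ord x))//
    -{2}(odd_double_half x) leq_addl.
exists m./2, (fun s i => Ordinal (cP s i)), (fun x : 'I_m =>
  (odd x, Ordinal (hP x))).
split=> [s i|x].
  congr (_, _); first by rewrite /= oddD odd_double addbF oddb.
  by apply: val_inj; rewrite /= half_bit_double.
by apply: val_inj; rewrite /= odd_double_half.
Qed.

Lemma skew_unit_even m (B : 'M[R]_m) : B^T = - B -> B \in unitmx -> ~~ odd m.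
Proof.
move=> skB; rewrite unitmxE unitfE; apply: contraNN => om.
have dB : \det B = - \det B.
  by rewrite -{1}det_tr skB -scaleN1r detZ -signr_odd om expr1 mulN1r.
by rewrite -eqNr -dB.
Qed.

Section VolumeForm.
Context {k : nat} {c : bool -> 'I_k -> 'I_(1 + n)} {h : 'I_(1 + n) ->
  bool * 'I_k}.
Hypothesis cK : forall s i, h (c s i) = (s, i).
Hypothesis hK : forall x, c (h x).1 (h x).2 = x.

(** Under a change of frame both terms acquire the same Jacobian determinant, sign included, so the
    quotients agree without any choice of orientation. *)
Definition volume_val p (v : 'I_n -> tangent p) : R^o :=
  \det (\matrix_(j, i) v j ((some_frame p).1 i)) /
    pfaffian c (bordered_at pi N p (some_frame p).1).

Lemma volume_val_frame p x E (v : 'I_n -> tangent p) : frame p x E ->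
  volume_val v = \det (\matrix_(j, i) v j (x i)) /
    pfaffian c (bordered_at pi N p x).
Proof.
move=> xE; have fF := some_frameP p; rewrite /volume_val.
set f := (some_frame p).1; pose T := \matrix_(i, l) E l p (f i).
have uB := bordered_unit xE (codim1 p) (nuN p) (nuH p).
have pB := pfaffian_neq0 cK hK (bordered_skew pi N p x) uB.
have uB' := bordered_unit fF (codim1 p) (nuN p) (nuH p).
have := pfaffian_neq0 cK hK (bordered_skew pi N p f) uB'.
rewrite (bordered_change pi N xE) (pfaffian_congruence cK hK) det_bordered_mx
  -/T.
rewrite mulf_eq0 negb_or => /andP[T0 _].
have -> : \matrix_(j, i) v j (f i) = (\matrix_(j, i) v j (x i)) *m T^T.
  apply/matrixP => j i; rewrite !mxE (frame_fun _ _ xE).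
  by apply: eq_bigr => l _; rewrite !mxE.
by rewrite det_mulmx det_tr; field; rewrite T0 pB.
Qed.

Lemma volume_val_alternating p : alternating_form (@volume_val p).
Proof.
pose f := (some_frame p).1; have [detl det0] := @alternating_det R n.
have E (v : 'I_n -> tangent p) : \matrix_(j,
  i) v j (f i) = \matrix_j coords (x := f) (v j).
  by apply/matrixP => i j; rewrite !mxE.
have cu v i (y : tangent p) : \matrix_j coords (x := f) (upd v i y j) =
    \matrix_j upd (fun j => coords (x := f) (v j)) i (coords (x := f) y) j.
  by apply/matrixP => j l; rewrite !mxE /upd; case: eqP; rewrite !mxE.
split=> [v i a y z|v i j ij vij]; rewrite /volume_val !E.
  rewrite !cu (_ : coords (a *: y + z) = a *: coords (x := f) y + coords (x :=
    f) z).
    by rewrite detl mulrDl -scalerAl.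
  by apply/rowP => l; rewrite !mxE.
rewrite (det0 (fun j => coords (x := f) (v j)) i j ij) ?mul0r//.
by rewrite vij.
Qed.

Lemma volume_val_smooth (X : 'I_n -> vfield M) :
  smooth (fun p => volume_val (fun i => X i p)).
Proof.
apply/smoothP => p; have [x [E nearE]] := local_frame p.
have xE : frame p x E by exact: nbhs_singleton nearE.
pose pfB : Cinf M := \sum_(s : 'S_(1 + n)) (-1) ^+ s *
  \prod_i (bordered pi N x) (s (c false i)) (s (c true i)).
have pfBE q : pfB q = pfaffian c (bordered_at pi N q x) :> R.
  rewrite -[LHS]/(eval_at q pfB) rmorph_sum; apply: eq_bigr => s _.
  rewrite rmorphM rmorph_sign rmorph_prod; congr (_ * _).
  by apply: eq_bigr => i _; rewrite [RHS]mxE.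
pose D : Cinf M := \det (\matrix_(j, i) vf_app (X j) (x i)).
apply: (@smooth_at_eq _ _ _ p (fun q => (D q : R) * (pfB q : R)^-1 : R^o)).
  apply: (near_imply nearE) => q qE; rewrite (volume_val_frame _ qE) pfBE.
  rewrite -[D q : R]/(eval_at q D) -det_map_mx; congr (\det _ / _).
  by apply/matrixP => j i; rewrite !mxE.
apply: smooth_atM; first exact: ((smoothP _).1 (Cinf_smooth D)).
apply: smooth_atV; last exact: ((smoothP _).1 (Cinf_smooth pfB)).
rewrite pfBE; apply: (pfaffian_neq0 cK hK (bordered_skew pi N p _)).
exact: (bordered_unit xE (codim1 p) (nuN p) (nuH p)).
Qed.

Definition liouville_form : kform M n :=
  @MkKform _ _ _ _ volume_val (fun p => (volume_val_alternating p).1)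
    (fun p => (volume_val_alternating p).2) volume_val_smooth.

Lemma liouville_volume : volume_form liouville_form.
Proof.
move=> p; have xE := some_frameP p; exists (fun i => (some_frame p).2 i p).
rewrite -[liouville_form p _]/(volume_val _) /volume_val.
have -> : \matrix_(j, i) (some_frame p).2 j p ((some_frame p).1 i) = 1%:M.
  by apply/matrixP => i j; rewrite !mxE xE.1.
rewrite det1 mul1r invr_eq0.
apply: (pfaffian_neq0 cK hK (bordered_skew pi N p _)).
exact: (bordered_unit xE (codim1 p) (nuN p) (nuH p)).
Qed.

End VolumeForm.

(** The point serves to show that 1 + n is even, through an invertible skew matrix; the pairing of
    indices depends on it. *)
Lemma volume_form_exists (p : M) : exists mu : kform M n, volume_form mu.
Proof.
have uB := bordered_unit (some_frameP p) (codim1 p) (nuN p) (nuH p).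
have [k [c [h [cK hK]]]] := even_pairing (skew_unit_even (bordered_skew _ _ _ _)
  uB).
by exists (liouville_form cK hK); exact: liouville_volume.
Qed.

End Density.

(** * Riemannian metrics *)

Section MetricDual.
Context {R : realType} {n : nat} {M : manifold R n}.
Implicit Types (p : M) (f : Cinf M) (X Y : vfield M).
Variables (g : metric M) (nu : oneform M).

Lemma metricDl p a (u v w : tangent p) : g p (a *: u + v) w = a * g p u w + g p
  v w.
Proof. exact: metric_linear. Qed.

Lemma metric0l p (v : tangent p) : g p 0 v = 0.
Proof. by have := metricDl (-1) 0 0 v; rewrite scaler0 addr0 mulN1r addNr. Qed.

Lemma metric_suml p (I : Type) (r : seq I) (a : I -> R) (u : I -> tangent p) v :
  g p (\sum_(i <- r) a i *: u i) v = \sum_(i <- r) a i * g p (u i) v.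
Proof.
by elim/big_rec2: _ => [|i y w _ <-]; [exact: metric0l|exact: metricDl].
Qed.

Lemma metric_eq0 p (u : tangent p) : g p u u = 0 -> u = 0.
Proof. by move=> uu; apply/eqP/negP => /negP/(metric_pos g);
  rewrite uu ltxx. Qed.

Lemma metric_nondegenerate p (u w : tangent p) :
  (forall v, g p u v = g p w v) -> u = w.
Proof.
move=> uw; apply/eqP; rewrite -subr_eq0; apply/eqP/metric_eq0.
have E z : g p (u - w) z = g p u z - g p w z.
  by have := metricDl (-1) w u z; rewrite scaleN1r mulN1r addrC => ->;
    rewrite addrC.
by rewrite E uw subrr.
Qed.

Definition gram (E : 'I_n -> vfield M) : 'M[Cinf M]_n :=
  \matrix_(i, j) metric_app g (E i) (E j).

Lemma gram_unit p x E : frame p x E -> map_mx (eval_at p) (gram E) \in unitmx.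
Proof.
move=> xE; rewrite -row_free_unit -kermx_eq0; apply/rowV0P => u.
rewrite sub_kermx => /eqP uG; pose v := \sum_i u 0 i *: E i p.
have gE i : g p v (E i p) = 0.
  rewrite /v metric_suml; have := congr1 (fun A : 'rV_n => A 0 i) uG.
  by rewrite !mxE => uGi; rewrite -[RHS]uGi; apply: eq_bigr => j _;
    rewrite !mxE.
have v0 : v = 0.
  apply: metric_eq0; rewrite {1}/v metric_suml big1// => i _.
  by rewrite metric_sym gE mulr0.
apply/rowP => j; rewrite mxE -(tangent0 (p := p) 0).
have : v (x j) = 0 by rewrite v0.
rewrite /v tangent_sumE (bigD1 j)//= xE.1 eqxx mulr1 big1 ?addr0 => [->//|i ij].
by rewrite xE.1 (negbTE ij) mulr0.
Qed.

(** Numerator of Cramer's formula for the coefficients of the dual field. The Gram matrix may be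
    singular where [E] is not a frame, so the division is left for later. *)
Definition dual_coord (E : 'I_n -> vfield M) j : Cinf M :=
  \sum_i of_app nu (E i) * \adj (gram E) i j.

Lemma metric_dual_frame p x E : frame p x E ->
  let u := \sum_j (dual_coord E j p / (\det (gram E) p : R)) *: E j p in
  forall v, g p u v = nu p v.
Proof.
move=> xE u v; have uG := gram_unit xE.
pose G := map_mx (eval_at p) (gram E).
have detG : \det (gram E) p = \det G :> R by rewrite det_map_mx.
have G0 : \det G != 0 by rewrite -unitfE -unitmxE.
have gE l : g p u (E l p) = nu p (E l p).
  rewrite /u metric_suml detG.
  pose r : 'rV[R]_n := \row_i nu p (E i p).
  have dE j : dual_coord E j p = (r *m \adj G) 0 j :> R.
    rewrite -[LHS]/(eval_at p (dual_coord E j)) rmorph_sum mxE;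
      apply: eq_bigr => i _.
    by rewrite rmorphM /G -map_mx_adj !mxE.
  have GE j : g p (E j p) (E l p) = G j l by rewrite !mxE.
  under eq_bigr do rewrite dE GE mulrAC.
  rewrite -mulr_suml -[X in X / _](_ : (r *m \adj G *m G) 0 l = _);
    last by rewrite mxE.
  by rewrite -mulmxA mul_adj_mx mul_mx_scalar !mxE mulrC mulKf.
rewrite (xE.2 v) metric_sym metric_suml [RHS](frame_cotangent _ _ xE) -(xE.2 v).
by apply: eq_bigr => l _; rewrite metric_sym gE.
Qed.

(** The dual vector is chosen at each point; uniqueness identifies it with Cramer's formula near
    every point, whence smoothness. *)
Lemma metric_dual : exists Y : vfield M, forall p v, g p (Y p) v = nu p v.
Proof.
have ex p : exists u : tangent p, forall v, g p u v = nu p v.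
  have [x [E /nbhs_singleton xE]] := local_frame p.
  by eexists; exact: (metric_dual_frame xE).
pose Y p := projT1 (cid (ex p)).
have YP p v : g p (Y p) v = nu p v by exact: (projT2 (cid (ex p))).
have sY f : smooth (fun p => Y p f).
  apply/smoothP => p; have [x [E nearE]] := local_frame p.
  have xE : frame p x E by exact: nbhs_singleton nearE.
  apply: (@smooth_at_eq _ _ _ p (fun q => \sum_j
     ((dual_coord E j q : R) * (\det (gram E) q : R)^-1) * E j q f)).
    apply: (near_imply nearE) => q qE.
    rewrite -tangent_sumE; congr (tangent_fun _ f).
    by apply: metric_nondegenerate => v; rewrite YP;
      exact: (metric_dual_frame qE).
  apply: smooth_at_sum => j _; apply: smooth_atM;
    last exact: ((smoothP _).1 (vf_smooth (E j) f)).
  apply: smooth_atM; first exact: ((smoothP _).1 (Cinf_smooth _)).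
  apply: smooth_atV; last exact: ((smoothP _).1 (Cinf_smooth _)).
  have := gram_unit xE; rewrite unitmxE unitfE.
  by rewrite det_map_mx.
by exists (MkVfield sY).
Qed.

End MetricDual.

(** * Existence of a Riemannian metric *)

Section MetricExistence.
Context {R : realType} {n : nat} (M : manifold R n).
Implicit Types (p q : M) (f b : Cinf M) (X Y : vfield M).

Lemma Cinf_continuous f : continuous (f : M -> R^o).
Proof.
move=> p; have [c ac cp] := atlas_cover p.
have cf := smooth_near_continuous ((smoothP _).1 (Cinf_smooth f) p c ac cp).
have cm := cmap_cont cp.
apply/continuous_near_le => e e0.
have /continuous_near_le/(_ e e0) H : {for p,
  continuous ((f \o cinv c) \o cmap c)}.
  exact: continuous_comp.
have cdp : \forall q \near p, cdom c q.
  exact: open_nbhs_nbhs (conj (@cdom_open _ _ _ c) cp).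
by apply: (near_imply (near_and H cdp)) => q [+ cq]; rewrite /comp !cmapK.
Qed.

Definition flat_fun f : Cinf M := mkCinf (smooth_flat 0 (Cinf_smooth f)).

(** Where [b] is positive, so is the quadratic form b (dx_1^2 + ... + dx_n^2). *)
Definition coordinate_patch b (x : 'I_n -> Cinf M) : Prop :=
  (forall q, 0 <= b q :> R) /\
  (forall q (v : tangent q), 0 < b q :> R -> (forall i, v (x i) = 0) -> v = 0).

Lemma coordinate_patch_near p : exists b x,
  coordinate_patch b x /\ \forall q \near p, 0 < b q :> R.
Proof.
have [x [E nearE]] := local_frame p; have [b [b0 b1 bE]] := bump_function nearE.
exists b, x; split; last by apply: (near_imply b1) => q ->; exact: ltr01.
split=> // q v bq vx; have [_ vE] := bE q (lt0r_neq0 bq); rewrite (vE v).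
by rewrite big1// => i _; rewrite vx scale0r.
Qed.

(** For each [k], one patch positive on the basic open set numbered [k] is kept if there is any;
    otherwise [b = 0] is a vacuous patch. The basic sets lying in some patch cover the manifold. *)
Lemma countable_patches : exists (b : nat -> Cinf M) (x : nat -> 'I_n ->
  Cinf M),
  (forall k, coordinate_patch (b k) (x k)) /\ forall p, exists k,
    0 < b k p :> R.
Proof.
have [B /countable_injP[e einj] [Bopen Bbase]]
  := @manifold_second_countable R n M.
pose good k (bx : Cinf M * ('I_n -> Cinf M)) := coordinate_patch bx.1 bx.2 /\
  forall U, B U -> e U = k ->
    (exists b x, coordinate_patch b x /\ U `<=` [set q | 0 < b q :> R]) ->
    U `<=` [set q | 0 < bx.1 q :> R].
have ex k : exists bx, good k bx.
  have [[U [BU eU [b [x [bx Ub]]]]]|no] := pselect (exists U, [/\ B U, e U = k &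
      exists b x, coordinate_patch b x /\ U `<=` [set q | 0 < b q :> R]]).
    exists (b, x); split=> // U' BU' eU' _; suff -> : U' = U by [].
    by apply: einj; rewrite ?inE// eU eU'.
  exists (0, fun _ => 0); split=> [|U BU eU H]; last by exfalso; apply: no;
    exists U.
  by split=> // q v; rewrite ltxx.
have /choice[F FP] := ex.
exists (fun k => (F k).1), (fun k => (F k).2); split=> [k|p];
  first by case: (FP k).
have [b [x [bx bp]]] := coordinate_patch_near p.
have [U [BU Up] Ub] := Bbase p _ bp.
exists (e U); have [_ /(_ U BU erefl)] := FP (e U).
by apply => //; exists b, x.
Qed.

Lemma sum_ord_tail (a : nat -> R) K K' : (forall k, (K <= k)%N -> a k = 0) ->
  (forall k, (K' <= k)%N -> a k = 0) -> \sum_(k < K) a k = \sum_(k < K') a k.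
Proof.
wlog KK' : K K' / (K <= K')%N.
  by move=> H aK aK'; have [/H->//|/ltnW/H->] := leqP K K'.
move=> aK _; rewrite -!(big_mkord xpredT a) (big_cat_nat (leq0n K) KK') /=.
rewrite [X in _ + X](_ : _ = 0) ?addr0//.
by rewrite big_nat_cond big1// => k /andP[/andP[/aK]].
Qed.

(* The factor [flat 0 (1 / (k + 1) - b_i)] kills [c_k], for [k] large, near any
   point where [b_i > 0], and is positive where [b_i = 0]: at the first [k] with
   [b_k > 0], also [c_k > 0]. *)
Lemma locally_finite_patches : exists (c : nat -> Cinf M) (x : nat -> 'I_n ->
  Cinf M),
  [/\ forall k, coordinate_patch (c k) (x k),
      forall p, exists k, 0 < c k p :> R &
      forall p, exists K, \forall q \near p, forall k, (K <= k)%N ->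
        c k q = 0 :> R].
Proof.
have [b [x [bx bpos]]] := countable_patches.
pose c k : Cinf M := b k * \prod_(i < k) flat_fun ((k.+1%:R^-1 : R) *: (1 : Cinf
  M) - b i).
have cE k q : c k q = b k q * \prod_(i < k) flat 0 (k.+1%:R^-1 - b i q) :> R.
  rewrite -[LHS]/(b k q * eval_at q (\prod_(i < k) flat_fun ((k.+1%:R^-1 : R) *:
    (1 : Cinf M) - b i))).
  rewrite rmorph_prod; congr (_ * _); apply: eq_bigr => i _.
  rewrite -[LHS]/(flat 0 (k.+1%:R^-1 * 1 - b i q)).
  by rewrite mulr1.
exists c, x; split.
- move=> k; have [b0 bv] := bx k; split=> [q|q v].
    by rewrite cE mulr_ge0 ?b0// prodr_ge0// => i _; exact: flat_ge0.
  rewrite cE => H; apply: bv; rewrite lt_neqAle b0 andbT eq_sym.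
  by apply: contraTneq H => ->; rewrite mul0r ltxx.
- move=> p; have [k0 k0p kmin] := ex_minnP (bpos p).
  exists k0; rewrite cE mulr_gt0// prodr_gt0// => i _.
  rewrite flat_gt0 subr_gt0; apply: (@le_lt_trans _ _ 0);
    last by rewrite invr_gt0.
  by rewrite leNgt; apply/negP => /kmin; rewrite leqNgt ltn_ord.
- move=> p; have [i bip] := bpos p.
  have b20 : 0 < b i p / 2 :> R by rewrite divr_gt0.
  have nearb : \forall q \near p, b i p / 2 < b i q :> R.
    have := continuous_near_lt (f := fun q =>
      - b i q : R) (x := p) (a := - (b i p / 2)).
    move=> /(_ _ _) H.
    have {}H : \forall q \near p, - b i q < - (b i p / 2) :> R.
      apply: H; last by rewrite ltrN2 ltr_pdivrMr// ltr_pMr// ltr1n.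
      by apply: cvgN; exact: Cinf_continuous.
    by apply: (near_imply H) => q; rewrite ltrN2.
  have [K Kb] : exists K, K.+1%:R^-1 < b i p / 2 :> R.
    exists (Num.bound (b i p / 2)^-1); rewrite invf_plt ?posrE//.
    apply: lt_le_trans (archi_boundP _) _; first by rewrite invr_ge0 ltW.
    by rewrite ler_nat.
  exists (maxn K i.+1); apply: (near_imply nearb) => q biq k.
  rewrite geq_max => /andP[Kk ik].
  rewrite cE (bigD1 (Ordinal ik))//= flat_le0 ?mul0r ?mulr0//.
  rewrite subr_le0 ltW// (le_lt_trans _ biq)// ltW// (le_lt_trans _ Kb)//.
  by rewrite lef_pV2 ?posrE// ler_nat ltnS.
Qed.

(** The metric is the sum of the forms c_k (dx_1^2 + ... + dx_n^2) over all patches; no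
    normalisation to a partition of unity is made. The truncation [K p] varies arbitrarily with the
    point, so smoothness uses a bound [L] valid on a neighbourhood. *)
Lemma metric_exists : inhabited (metric M).
Proof.
have [c [x [cx cpos cfin]]] := locally_finite_patches.
have fin p : exists K, forall k, (K <= k)%N -> c k p = 0 :> R.
  by have [K /nbhs_singleton ?] := cfin p; exists K.
pose K p := projT1 (cid (fin p)).
have KP p k : (K p <= k)%N -> c k p = 0 :> R by exact: (projT2 (cid (fin p))).
pose term p (u v : tangent p) k : R := c k p * \sum_i u (x k i) * v (x k i).
pose g p (u v : tangent p) : R^o := \sum_(k < K p) term p u v k.
have gl p (v : tangent p) : linear (fun u => g p u v).
  move=> a u w; rewrite /g scaler_sumr -big_split; apply: eq_bigr => k _ /=.
  rewrite /term [a *: (_ * _)]mulrCA -mulrDr; congr (_ * _).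
  rewrite mulr_sumr -big_split; apply: eq_bigr => i _ /=.
  by rewrite mulrA -mulrDl.
have gs p (u v : tangent p) : g p u v = g p v u.
  apply: eq_bigr => k _; congr (_ * _); apply: eq_bigr => i _; exact: mulrC.
have sq_ge0 p (v : tangent p) k : 0 <= \sum_i v (x k i) * v (x k i) :> R.
  by apply: sumr_ge0 => i _; rewrite -expr2 sqr_ge0.
have gp p (v : tangent p) : v != 0 -> 0 < g p v v.
  move=> v0; have [k ck] := cpos p.
  have kK : (k < K p)%N.
    by rewrite ltnNge; apply: contraTN ck => /KP ->; rewrite ltxx.
  rewrite /g (bigD1 (Ordinal kK))//= ltr_pwDl//; last first.
    by apply: sumr_ge0 => j _; rewrite mulr_ge0// (cx j).1.
  rewrite mulr_gt0// lt_neqAle sq_ge0 andbT eq_sym.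
  have sq i : true -> 0 <= v (x k i) * v (x k i) by rewrite -expr2 sqr_ge0.
  apply: contraNneq v0 => S0; apply/eqP; apply: (cx k).2 => // i.
  by have /(_ i isT)/eqP := psumr_eq0P sq S0; rewrite mulf_eq0 orbb => /eqP.
have gsm X Y : smooth (fun p => g p (X p) (Y p)).
  apply/smoothP => p; have [L nearL] := cfin p.
  pose G : Cinf M := \sum_(k < L) c k * \sum_i vf_app X (x k i) * vf_app Y (x k
    i).
  apply: (@smooth_at_eq _ _ _ p G); last exact: ((smoothP _).1 (Cinf_smooth G)).
  apply: (near_imply nearL) => q qL; rewrite -[LHS]/(eval_at q G) rmorph_sum /g.
  rewrite (sum_ord_tail (a := term q (X q) (Y q)) (K' := L)); last 2 first.
  - by move=> k /KP ck; rewrite /term ck mul0r.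
  - by move=> k /qL ck; rewrite /term ck mul0r.
  apply: eq_bigr => k _; rewrite rmorphM rmorph_sum /term; congr (_ * _).
exact: inhabits (MkMetric gl gs gp gsm).
Qed.

End MetricExistence.

(** * Modular class and bundle-like metrics *)

Section ExteriorDerivative.
Context {R : realType} {n : nat} {M : manifold R n}.
Implicit Types (p : M) (f : Cinf M) (X Y Z : vfield M) (a : oneform M).

Lemma lie_scale X Y Z f p : (forall q, Y q = (f q : R) *: Z q) ->
  lie X Y p = (X p f : R) *: Z p + (f p : R) *: lie X Z p.
Proof.
move=> YZ; apply/val_inj/funext => h.
have YE : vf_app Y h = f * vf_app Z h by apply/val_inj/funext => q;
  rewrite /= YZ.
rewrite -[LHS]/(X p (vf_app Y h) - Y p (vf_app X h) : R) YE tangentM YZ.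
rewrite -[RHS]/(X p f * Z p h + f p * (X p (vf_app Z h) - Z p (vf_app X h)) :
  R).
rewrite -[(f p *: Z p) _]/(f p * Z p (vf_app X h) : R) -[vf_app Z h p]/(Z p h :
  R).
ring.
Qed.

(* (da)(X, Y) at the point p *)
Definition exterior_derivative a X Y p : R :=
  X p (of_app a Y) - Y p (of_app a X) - a p (lie X Y p).

(** The derivatives of the coefficients of [X] cancel. A field tangent to F may thus be replaced, at
    one point, by a combination of hamiltonian fields. *)
Lemma exterior_derivative_tensorial a Y p : exists K : tangent p -> R,
  (forall (I : Type) (r : seq I) (c : I -> R) (v : I -> tangent p),
    K (\sum_(i <- r) c i *: v i) = \sum_(i <- r) c i * K (v i)) /\
  forall X, exterior_derivative a X Y p = K (X p).
Proof.
have [x [E nearE]] := local_frame p.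
have xE : frame p x E by exact: nbhs_singleton nearE.
exists (fun v => v (of_app a Y) - \sum_i (v (x i) * Y p (of_app a (E i)) +
  v (vf_app Y (x i)) * a p (E i p))); split=> [I r c v|X].
  rewrite tangent_sumE; under [X in _ - X]eq_bigr do rewrite !tangent_sumE
    !mulr_suml -big_split.
  rewrite exchange_big -sumrB /=; apply: eq_bigr => i _.
  by rewrite mulrBr mulr_sumr; congr (_ - _); apply: eq_bigr => j _;
    rewrite mulrDr !mulrA.
have aX : \forall q \near p, of_app a X q =
    (\sum_i vf_app X (x i) * of_app a (E i)) q :> R.
  apply: (near_imply nearE) => q qE.
  rewrite -[RHS]/(eval_at q _) rmorph_sum -[LHS]/(a q (X q)) (frame_cotangent _
    _ qE).
  by apply: eq_bigr => i _; rewrite rmorphM.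
rewrite /exterior_derivative (tangent_local (Y p) aX) tangent_sum.
rewrite -addrA -opprD; congr (_ - _).
rewrite [a p _](frame_cotangent _ _ xE) -big_split; apply: eq_bigr => i _ /=.
rewrite tangentM -[vf_app X (x i) p]/(X p (x i) : R) -[of_app a (E i) p]/(a p (E
  i p)).
ring.
Qed.

End ExteriorDerivative.

(** * From a bundle-like metric to the vanishing of the modular class *)

Section Main.
Context {R : realType} {n : nat} {M : manifold R n} (pi : poisson M).
Implicit Types (p : M) (f g : Cinf M) (X Y Z : vfield M) (mu : kform M n).
Local Notation H := (hamiltonian pi).
Local Notation F := (symplectic_foliation pi : forall q, set (tangent q)).
Variable nu : oneform M.
Hypothesis codim1 : forall p, exists2 r, has_dim (F p) r & (r + 1)%N = n.
Hypothesis nu0 : forall p, exists v, nu p v != 0.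
Hypothesis nuH : forall p f, nu p (H f p) = 0.

Lemma foliationP p (v : tangent p) : nu p v = 0 <-> F p v.
Proof.
have [x [E /nbhs_singleton xE]] := local_frame p.
exact: (symplectic_foliationP xE (codim1 p) (nu0 p) (nuH p)).
Qed.

(** With Y the g-dual of nu, q = nu(Y) = g(Y, Y) is positive and N = Y / q; in particular g(N, N) =
    1 / q. *)
Lemma normal_field (g : metric M) : exists (N : vfield M) (q : Cinf M),
  [/\ forall p, 0 < q p :> R, forall p, nu p (N p) = 1 &
      forall p v, g p (N p) v = nu p v / q p].
Proof.
have [Y YE] := metric_dual g nu; pose q := of_app nu Y.
have q0 p : 0 < q p :> R.
  rewrite -[q p : R]/(nu p (Y p)) -YE metric_pos//; have [v] := nu0 p.
  by apply: contraNneq => Y0; rewrite -YE Y0 metric0l.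
have qN p : q p != 0 :> R by rewrite gt_eqF.
exists (vscale (inv_fun qN) Y), q; split=> // p.
  by rewrite -[vscale _ _ p]/((q p)^-1 *: Y p) cotangentZ mulVf.
move=> v; rewrite -[vscale _ _ p]/((q p)^-1 *: Y p) mulrC -YE.
by rewrite -[_ *: Y p]addr0 metricDl metric0l addr0.
Qed.

(** The square stands for the absolute value, as the sign of [f] is unknown: a quarter of ln(f^2) is
    half of ln |f|. *)
Lemma tangent_ln_sqr p (v : tangent p) f (f0 : forall p, 0 < (f ^+ 2) p :> R) :
  v (4^-1 *: ln_fun f0) = v f / (f p *+ 2).
Proof.
rewrite tangentZ tangent_ln expr2 tangentM.
have fp : f p != 0 :> R.
  by have := f0 p; rewrite -[(f ^+ 2) p]/(f p * f p : R) lt0r mulf_eq0 orbb =>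
    /andP[].
by rewrite -[(f * f) p]/(f p * f p : R); field.
Qed.

Lemma sqr_fun_gt0 f : (forall p, f p != 0 :> R) ->
  forall p, 0 < (f ^+ 2) p :> R.
Proof.
move=> f0 p; rewrite -[(f ^+ 2) p]/(eval_at p (f ^+ 2)) rmorphXn /=.
by rewrite exprn_even_gt0 //=; exact: f0.
Qed.

Lemma normal_orthogonal (g : metric M) (N : vfield M) (q : Cinf M) :
    (forall p v, g p (N p) v = nu p v / q p) ->
  orthogonal_to g (symplectic_foliation pi) N.
Proof. by move=> gN p v /foliationP nuv; rewrite gN nuv mul0r. Qed.

Lemma riemannian_divergence (g : metric M) mu :
    bundle_like (symplectic_foliation pi) g -> volume_form mu ->
  exists w : Cinf M, forall f (Y : 'I_n -> vfield M) p,
    lie_kform (H f) mu Y p = H f p w * mu p (fun i => Y i p).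
Proof.
move=> gbl vmu; have [N [q [q0 nuN gN]]] := normal_field g.
pose D := density_fun pi N mu.
have D0 p : D p != 0 :> R by exact: (density_neq0 codim1 nuN nuH).
exists (4^-1 *: ln_fun (sqr_fun_gt0 D0) + 2^-1 *: ln_fun q0) => f Y p.
rewrite (lie_kform_hamiltonian codim1 nuN nuH)// tangentD tangent_ln_sqr.
rewrite tangentZ tangent_ln; congr ((_ + _) * _).
have oN := normal_orthogonal gN.
(* As g(N, N) = 1 / q, this reads X(1 / q) = 2 nu([X, N]) / q for X = [H f], that is, - nu([X, N]) =
   X(ln q) / 2. *)
have := gbl (H f) N N (tangent_hamiltonian _ _) oN oN p.
rewrite /lie_metric (metric_sym g (lie _ _ _)) gN.
have qN p' : q p' != 0 :> R by rewrite gt_eqF.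
have -> : metric_app g N N = inv_fun qN.
  by apply/val_inj/funext => z; rewrite /= gN nuN mul1r.
have /(congr1 (H f p)) : q * inv_fun qN = 1.
  by apply/val_inj/funext => z; rewrite -[LHS]/(q z * (q z : R)^-1) mulfV.
rewrite tangentM tangent1 -[inv_fun qN p : R]/((q p)^-1) => Hq.
have {}Hq : H f p (inv_fun qN) = - (H f p q / (q p) ^+ 2).
  apply: (mulfI (qN p)); apply/eqP; rewrite -subr_eq0; apply/eqP.
  by rewrite -[RHS]Hq; field.
rewrite Hq => /eqP; rewrite -addrA -opprD -mulr2n subr_eq0 => /eqP E.
have -> : nu p (lie (H f) N p) = q p * (nu p (lie (H f) N p) / q p *+ 2) / 2 by
  field.
by rewrite -E; field.
Qed.

Lemma hamiltonianD f g p : H (f + g) p = H f p + H g p.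
Proof. by have := hamiltonian_linear pi 1 f g p; rewrite !scale1r. Qed.

Lemma hamiltonian0 p : H 0 p = 0.
Proof. by have := hamiltonianD 0 0 p; rewrite addr0 => /eqP;
  rewrite addrC -subr_eq subrr => /eqP. Qed.

Lemma hamiltonianN f p : H (- f) p = - H f p.
Proof. by apply/eqP; rewrite -addr_eq0 -hamiltonianD addNr hamiltonian0. Qed.

Lemma hamiltonian_swap f g p : H f p g = - H g p f :> R.
Proof. exact: bivector_skew. Qed.

Lemma modular_vfield_val mu phi f p c : volume_form mu ->
  modular_vfield pi mu phi ->
    (forall Y : 'I_n -> vfield M,
      lie_kform (H f) mu Y p = c * mu p (fun i => Y i p)) ->
  phi p f = c.
Proof.
move=> vmu mphi Hc; have xE := some_frameP p.
have [v] := vmu p; rewrite (kform_frame mu v xE) mulf_eq0 negb_or =>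
  /andP[_ m0].
have := mphi f (some_frame p).2 p; by rewrite Hc => /(mulIf m0)/esym.
Qed.

Definition zero_kform k : kform M k.
Proof.
apply: (@MkKform _ _ _ _ (fun p _ => 0)) => [p v i a x y|//|X].
  by rewrite scaler0 addr0.
exact: smooth_cst.
Defined.

(** On an empty manifold even the zero form vanishes nowhere. *)
Lemma volume_exists (g : metric M) : exists mu, volume_form mu.
Proof.
have [[p _]|noM] := pselect (exists p : M, True).
  have [N [q [_ nuN _]]] := normal_field g.
  exact: (volume_form_exists codim1 nuN nuH p).
by exists (zero_kform n) => p; exfalso; apply: noM; exists p.
Qed.

(** The divergence of [H f] is [H f] applied to [w], which by skewness is [H (- w)] applied to [f]:
    the modular field is [H (- w)]. *)
Lemma riemannian_modular :
  riemannian_foliation (symplectic_foliation pi) ->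
    modular_class pi = H1_zero pi.
Proof.
move=> [g gbl]; apply/seteqP; split=> xi.
  move=> [mu [phi [vmu mphi [Pxi [h xiE]]]]]; split=> //.
  have [w Hw] := riemannian_divergence gbl vmu.
  exists (h - w) => p; rewrite xiE -[vzero M p]/(0 : tangent p) add0r
    hamiltonianD hamiltonianN addrC.
  congr (_ + _); apply/val_inj/funext => f.
  rewrite -[LHS]/(phi p f : R) (modular_vfield_val vmu mphi (Hw f ^~ p)).
  exact: hamiltonian_swap.
move=> [Pxi [h xiE]]; have [mu vmu] := volume_exists g.
have [w Hw] := riemannian_divergence gbl vmu.
exists mu, (H (- w)); split=> //.
  move=> f Y p; rewrite Hw; congr (_ * _).
  by rewrite /= -[LHS]/(H f p w : R) hamiltonian_swap -[RHS]/(H (- w) p f : R)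
    hamiltonianN.
by split=> //; exists (h + w) => p; rewrite xiE -[vzero M p]/(0 : tangent p)
  add0r hamiltonianD hamiltonianN addrCA addNr addr0.
Qed.

End Main.

(** * The metric adapted to a normal field *)

Section Adapted.
Context {R : realType} {n : nat} {M : manifold R n} (pi : poisson M).
Implicit Types (p : M) (f : Cinf M) (X Y Z : vfield M).
Local Notation H := (hamiltonian pi).
Local Notation F := (symplectic_foliation pi : forall q, set (tangent q)).
Variables (nu : oneform M) (N : vfield M) (g0 : metric M).
Hypothesis nuN : forall p, nu p (N p) = 1.
Hypothesis nuF : forall p (v : tangent p), nu p v = 0 <-> F p v.

Definition tangential p (v : tangent p) : tangent p := v - (nu p v : R) *: N p.

Lemma tangential_linear p : linear (@tangential p).
Proof.
move=> a u v; rewrite /tangential cotangentD cotangentZ scalerDl -scalerA.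
by rewrite scalerBr opprD addrACA.
Qed.

Definition adapted_val p (u v : tangent p) : R^o :=
  g0 p (tangential u) (tangential v) + nu p u * nu p v.

Lemma adapted_linear p (v : tangent p) : linear (fun u => adapted_val u v).
Proof.
move=> a u w; rewrite /adapted_val tangential_linear metricDl cotangentD
  cotangentZ.
by rewrite -[RHS]/(a * (_ + _ * _) + (_ + _)); ring.
Qed.

Lemma adapted_sym p (u v : tangent p) : adapted_val u v = adapted_val v u.
Proof. by rewrite /adapted_val metric_sym mulrC. Qed.

Lemma adapted_pos p (v : tangent p) : v != 0 -> 0 < adapted_val v v.
Proof.
move=> v0; rewrite /adapted_val -expr2;
  case: (eqVneq (tangential v) 0) => [t0|t0].
  rewrite t0 metric0l add0r exprn_even_gt0//=; apply: contraNneq v0 => nv0.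
  by move: t0; rewrite /tangential nv0 scale0r subr0 => ->.
by rewrite ltr_pwDl ?sqr_ge0// metric_pos.
Qed.

Lemma adapted_smooth X Y : smooth (fun p => adapted_val (X p) (Y p)).
Proof.
pose T Z := vadd Z (vscale (- of_app nu Z) N).
have TE Z p : T Z p = tangential (Z p).
  by rewrite /tangential -scaleNr.
have -> : (fun p => adapted_val (X p) (Y p)) =
    ((metric_app g0 (T X) (T Y) + of_app nu X * of_app nu Y : Cinf M) : M ->
      R^o).
  by apply/funext => p; rewrite /adapted_val -!TE.
exact: Cinf_smooth.
Qed.

Definition adapted_metric : metric M :=
  MkMetric adapted_linear adapted_sym adapted_pos adapted_smooth.

Lemma adapted_orthogonal Y : orthogonal_to adapted_metric (symplectic_foliation
  pi) Y ->
  forall p, Y p = (of_app nu Y p : R) *: N p.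
Proof.
move=> oY p; pose y := tangential (Y p).
have ny : nu p y = 0 by rewrite /y /tangential cotangentB cotangentZ nuN mulr1
  subrr.
have ty : tangential y = y by rewrite {1}/tangential ny scale0r subr0.
have := oY p y ((nuF y).1 ny); rewrite -[adapted_metric p _ _]/(adapted_val _
  _).
rewrite /adapted_val ny mulr0 addr0 ty => /metric_eq0 /eqP.
by rewrite subr_eq0 => /eqP.
Qed.

(** An orthogonal field is U = nu(U) N, so nu([X, N]) = 0 gives nu([X, U]) = X(nu(U)); the Leibniz
    rule for nu(Y) nu(Z) concludes. *)
Lemma adapted_bundle_like :
    (forall X p, tangent_to (symplectic_foliation pi) X ->
      nu p (lie X N p) = 0) ->
  bundle_like (symplectic_foliation pi) adapted_metric.
Proof.
move=> nuL X Y Z tX oY oZ p; rewrite /lie_metric.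
have gE U : orthogonal_to adapted_metric (symplectic_foliation pi) U ->
    forall q (v : tangent q), adapted_metric q (U q) v = nu q (U q) * nu q v.
  move=> oU q v; rewrite -[LHS]/(adapted_val _ _) /adapted_val.
  have -> : tangential (U q) = 0.
    by apply/eqP; rewrite subr_eq0 {1}(adapted_orthogonal oU q).
  by rewrite metric0l add0r.
have L U : orthogonal_to adapted_metric (symplectic_foliation pi) U ->
    nu p (lie X U p) = X p (of_app nu U).
  move=> /adapted_orthogonal UE; rewrite (lie_scale X p UE) cotangentD
    !cotangentZ.
  by rewrite nuN nuL// mulr0 addr0 mulr1.
have -> : metric_app adapted_metric Y Z = of_app nu Y * of_app nu Z.
  by apply/val_inj/funext => q; exact: (gE Y oY).
rewrite tangentM (metric_sym _ (lie X Y p)) (gE Z oZ) (gE Y oY) !L//.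
by rewrite -[of_app nu Y p]/(nu p (Y p)) -[of_app nu Z p]/(nu p (Z p)); ring.
Qed.

End Adapted.

(** * From the vanishing of the modular class to a bundle-like metric *)

Section Converse.
Context {R : realType} {n : nat} {M : manifold R n} (pi : poisson M).
Implicit Types (p : M) (f : Cinf M) (X Y Z : vfield M) (mu : kform M n).
Local Notation H := (hamiltonian pi).
Local Notation F := (symplectic_foliation pi : forall q, set (tangent q)).
Variable nu : oneform M.
Hypothesis codim1 : forall p, exists2 r, has_dim (F p) r & (r + 1)%N = n.
Hypothesis nu0 : forall p, exists v, nu p v != 0.
Hypothesis nuH : forall p f, nu p (H f p) = 0.

Lemma vzero_H1 : H1_zero pi (vzero M).
Proof.
split.
  move=> f g; have v0 h : vf_app (vzero M) h = 0 by apply/val_inj.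
  have b0 h : bracket pi 0 h = 0.
    by apply/val_inj/funext => p; rewrite -[LHS]/(H 0 p h : R) hamiltonian0.
  by rewrite !v0 b0 bracket_skew b0 oppr0 addr0.
by exists 0 => p; rewrite hamiltonian0 addr0.
Qed.

(** The zero field lies in the modular class, so some modular field is phi = - [H h], and phi(f) =
    X_f(h) by skewness. Comparison with the divergence formula gives u = ln(D^2) / 4 - h. *)
Lemma modular_normal_form (N : vfield M) :
    modular_class pi = H1_zero pi -> (forall p, nu p (N p) = 1) ->
  exists u : Cinf M, forall f p, nu p (lie (H f) N p) = H f p u.
Proof.
move=> mod0 nuN; have := vzero_H1; rewrite -mod0.
move=> [mu [phi [vmu mphi [_ [h hE]]]]].
have D0 p : density_fun pi N mu p != 0 :> R by exact: (density_neq0 codim1 nuN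
  nuH).
exists (4^-1 *: ln_fun (sqr_fun_gt0 D0) - h) => f p.
rewrite tangentB tangent_ln_sqr.
have := modular_vfield_val vmu mphi (fun Y : 'I_n ->
  vfield M => lie_kform_hamiltonian codim1 nuN nuH f Y p vmu).
have -> : phi p f = H f p h.
  rewrite hamiltonian_swap; have := hE p;
    rewrite -[vzero M p]/(0 : tangent p) => /esym/eqP.
  by rewrite addr_eq0 => /eqP ->.
by move=> ->; rewrite opprB addrC subrK.
Qed.

Lemma modular_riemannian : modular_class pi = H1_zero pi ->
  riemannian_foliation (symplectic_foliation pi).
Proof.
move=> mod0; have [g0] := metric_exists M.
have [N [q [q0 nuN gN]]] := normal_field nu0 g0.
have [u uE] := modular_normal_form mod0 nuN.
(* In nu'([X_f, N']), the term - X_f(u) from differentiating exp(- u) cancels nu([X_f, N]) =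
   X_f(u). *)
pose nu' := oneform_scale (exp_fun u) nu; pose N' := vscale (exp_fun (- u)) N.
have nu'E p v : nu' p v = expR (u p) * nu p v by [].
have eu p : expR (u p) * expR (- u p) = 1 by exact: expRxMexpNx_1.
have nuN' p : nu' p (N' p) = 1.
  by rewrite nu'E -[N' p]/(expR (- u p) *: N p) cotangentZ nuN mulr1 eu.
have nuF p (v : tangent p) : nu' p v = 0 <-> F p v.
  rewrite -(foliationP codim1 nu0 nuH) nu'E; split=> [/eqP|->];
    last by rewrite mulr0.
  by rewrite mulf_eq0 gt_eqF ?expR_gt0//= => /eqP.
have LH f p : nu' p (lie (H f) N' p) = 0.
  rewrite nu'E (lie_scale (Z := N) (f := exp_fun (- u)) _ p)//.
  rewrite cotangentD !cotangentZ nuN uE tangent_exp mulr1.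
  have -> : H f p (- u) = - H f p u by rewrite -[- u]sub0r tangentB tangent0
    sub0r.
  by rewrite -[exp_fun (- u) p]/(expR (- u p)) -[(- u) p]/(- u p); ring.
exists (adapted_metric nu' N' g0); apply: adapted_bundle_like => // X p tX.
(* The bracket is not tensorial in [Y], but on tangent fields it agrees up to sign with the exterior
   derivative, which is. *)
have ext Y : (forall q, nu' q (Y q) = 0) ->
    exterior_derivative nu' Y N' p = - nu' p (lie Y N' p).
  move=> Y0; rewrite /exterior_derivative.
  have -> : of_app nu' Y = 0 by apply/val_inj/funext => z; exact: Y0.
  have -> : of_app nu' N' = 1 by apply/val_inj/funext => z; exact: nuN'.
  by rewrite tangent1 tangent0 subrr sub0r.
have [K [Ksum KE]] := exterior_derivative_tensorial nu' N' p.
have X0 z : nu' z (X z) = 0 by apply/nuF; exact: tX.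
have H0 f z : nu' z (H f z) = 0 by apply/nuF; exact: tangent_hamiltonian.
apply/eqP; rewrite -oppr_eq0 -ext// KE; apply/eqP.
have [x [E /nbhs_singleton xE]] := local_frame p.
have [a _ Xa] := tX p.
(* Only an identity at [p], from expanding the covector [a] in the differentials of the [x i]. *)
have -> : X p = \sum_i a (E i p) *: H (x i) p.
  apply: (coords_inj xE); rewrite -Xa (sharp_coords pi xE) coords_comb.
  rewrite mulmx_sum_row; apply: eq_bigr => i _; rewrite mxE; congr (_ *: _).
  by apply/rowP => j; rewrite !mxE.
by rewrite Ksum big1// => i _; rewrite -KE ext// LH oppr0 mulr0.
Qed.

End Converse.

Theorem corollary1p2 (R : realType) (n : nat) (P : manifold R n)
    (pi : poisson P)
    (pi_regular : regular pi)
    (F_codim1 : has_codim (symplectic_foliation pi) 1)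
    (F_oriented : transversally_oriented (symplectic_foliation pi) 1) :
  modular_class pi = H1_zero pi <->
  riemannian_foliation (symplectic_foliation pi).
Proof.
have [w [w0 wF]] := F_oriented; pose nu := oneform_of_kform w.
have nu0 p : exists v, nu p v != 0.
  have [v wv] := w0 p; exists (v ord0); apply: contraNneq wv => nv.
  apply/eqP; rewrite -nv oneform_of_kformE.
  by congr (kf_val w p); apply/funext => i; rewrite ord1.
have nuH p f : nu p (hamiltonian pi f p) = 0.
  have := wF _ (tangent_hamiltonian pi f) p (fun _ => 0) ord0; apply: etrans.
  rewrite oneform_of_kformE.
  by congr (kf_val w p); apply/funext => i; rewrite /= ord1.
have codim1 p := F_codim1 p.
by split; [exact: modular_riemannian|exact: (riemannian_modular codim1 nu0
  nuH)].
Qed.
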